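(* Let $\mathsf G$ be an infinite isoradial graph whose faces cover the whole plane, and let $k\in(0,1)$. There exists a unique measure $\mathbb P^k_{\mathrm{forest}}$ on rooted spanning forests of $\mathsf G$ such that for any distinct edges $e_1,\dots,e_j$ and any distinct vertices $x_1,\dots,x_\kappa$ of $\mathsf G$, the probability that $e_1,\dots,e_j$ belong to the rooted spanning forest and $x_1,\dots,x_\kappa$ are roots is $$\mathbb P^k_{\mathrm{forest}}(\{e_1,\dots,e_j,x_1,\dots,x_\kappa\})=\det\begin{pmatrix}\bigl(\mathsf H^k(e_i,e_\ell)\bigr)_{1\le i,\ell\le j}&\bigl(\mathsf H^k(e_i,x_\ell)\bigr)_{1\le i\le j,\,1\le\ell\le\kappa}\\ \bigl(\mathsf H^k(x_i,e_\ell)\bigr)_{1\le i\le\kappa,\,1\le\ell\le j}&\bigl(\mathsf H^k(x_i,x_\ell)\bigr)_{1\le i,\ell\le\kappa}\end{pmatrix},$$ where $\mathsf H^k$ is the transfer impedance on $\mathsf G$. The measure $\mathbb P^k_{\mathrm{forest}}$ is the weak limit of the sequence $(\mathbb P^{k,(n)}_{\mathrm{forest}})$ of Boltzmann measures on rooted spanning forests of any exhaustion $(\mathsf G_n)_{n\ge1}$ of $\mathsf G$ by finite graphs. Under $\mathbb P^k_{\mathrm{forest}}$, the connected components of the random rooted spanning forest are finite almost surely.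
   Context: Elliptic notation. $k$ is the elliptic modulus, $k'=\sqrt{1-k^2}$, $K=K(k)=\int_0^{\pi/2}(1-k^2\sin^2\tau)^{-1/2}d\tau$, $E=E(k)=\int_0^{\pi/2}(1-k^2\sin^2\tau)^{1/2}d\tau$. $\mathrm{sc}=\mathrm{sn}/\mathrm{cn}$ and $\mathrm{dc}=\mathrm{dn}/\mathrm{cn}$ are Jacobi elliptic functions of modulus $k$. $\mathrm A(u|k)=\frac1{k'}\left(\int_0^u\mathrm{dc}^2(v|k)\,dv+\frac{E-K}{K}u\right)$. Isoradial graphs. A planar graph $\mathsf G=(\mathsf V,\mathsf E)$ is isoradial if it is embedded in the plane so that all faces are inscribable in circles of radius $1$ with circumcenters in the interior of the faces; it is always given with such an embedding. The diamond graph $\mathsf G^\diamond$ has as vertices those of $\mathsf G$ and the circumcenters of faces, each circumcenter being joined to the vertices on the boundary of its face; its faces are rhombi of side length $1$. Each edge $e$ of $\mathsf G$ is a diagonal of exactly one rhombus, and $\overline\theta_e$ is the half-angle of that rhombus at the vertex it has in common with $e$. It is assumed that for some $\varepsilon>0$, $\overline\theta_e\in(\varepsilon,\frac\pi2-\varepsilon)$ for all $e$. Put $\theta_e=\overline\theta_e\frac{2K}{\pi}$. Conductances, masses, Green function. $\rho(e)=\mathrm{sc}(\theta_e|k)$, $m^2(x|k)=\sum_{e\ni x}[\mathrm A(\theta_e|k)-\mathrm{sc}(\theta_e|k)]$, $(\Delta^{m(k)}f)(x)=\sum_{y\sim x}\rho(xy)[f(x)-f(y)]+m^2(x|k)f(x)$.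 The massive Green function $G^{m(k)}$ is the inverse of $\Delta^{m(k)}$ on $L^2(\mathsf V)$, $G^{m(k)}(x,y)=(G^{m(k)}\delta_y)(x)$. Rooted spanning forests. A rooted spanning forest of a graph is a subgraph spanning all vertices, each of whose connected components is a rooted tree, i.e. a tree $\mathsf T$ with a distinguished vertex $x_{\mathsf T}$ (the root). On a finite graph with conductances $\rho$ and masses $m^2$, the Boltzmann measure gives a rooted spanning forest $\mathsf F$ probability proportional to $\prod_{\mathsf T\in\mathsf F}\left(m^2(x_{\mathsf T})\prod_{e\in\mathsf T}\rho(e)\right)$. $\mathbb P^{k,(n)}_{\mathrm{forest}}$ is this Boltzmann measure on the finite graph $\mathsf G_n\subset\mathsf G$ with the conductances and masses inherited from $\mathsf G$. Transfer impedance. Fix an arbitrary orientation $e=(e_-,e_+)$ of each edge. With $G^m=G^{m(k)}$, for edges $e,e'$ and vertices $x,x'$: $\mathsf H^k(e,e')=\rho(e')\bigl(G^m(e_-,e'_-)-G^m(e_+,e'_-)-G^m(e_-,e'_+)+G^m(e_+,e'_+)\bigr)$, $\mathsf H^k(e,x)=m^2(x|k)\bigl(G^m(e_-,x)-G^m(e_+,x)\bigr)$, $\mathsf H^k(x,e)=\rho(e)\bigl(G^m(x,e_-)-G^m(x,e_+)\bigr)$, $\mathsf H^k(x,x')=m^2(x'|k)\,G^m(x,x')$. *)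

(* Defs.v *)
From HB Require Import structures.
From mathcomp Require Import all_boot all_order all_algebra.
From mathcomp Require Import all_classical all_reals all_analysis.
Import Order.TTheory GRing.Theory Num.Theory.
Import numFieldNormedType.Exports.

Set Implicit Arguments.
Unset Strict Implicit.
Unset Printing Implicit Defensive.

Local Open Scope classical_set_scope.
Local Open Scope ring_scope.

Section Elliptic.
Context {R : realType}.
Implicit Types (f : R -> R) (a b k u phi : R).

(* Oriented integral; one of the two terms is an integral over a set with at
   most one point. *)
Definition oint f a b : R :=
  \int[lebesgue_measure]_(t in `[a, b]) f t
  - \int[lebesgue_measure]_(t in `[b, a]) f t.

Definition ell_delta k phi : R := Num.sqrt (1 - k ^+ 2 * sin phi ^+ 2).

Definition ellF k phi : R := oint (fun t => (ell_delta k t)^-1) 0 phi.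

Definition ellK k : R := ellF k (pi / 2).

Definition ellE k : R := oint (ell_delta k) 0 (pi / 2).

Definition compl_modulus k : R := Num.sqrt (1 - k ^+ 2).

(* Jacobi amplitude: for 0 <= k < 1, [ellF k] is a bijection of the reals and
   [jacobi_am k] is its inverse. *)
Definition jacobi_am k u : R := xget 0 [set phi | ellF k phi = u].

Definition jacobi_sn k u : R := sin (jacobi_am k u).
Definition jacobi_cn k u : R := cos (jacobi_am k u).
Definition jacobi_dn k u : R := ell_delta k (jacobi_am k u).
Definition jacobi_sc k u : R := jacobi_sn k u / jacobi_cn k u.
Definition jacobi_dc k u : R := jacobi_dn k u / jacobi_cn k u.

Definition ellA k u : R :=
  (compl_modulus k)^-1 *
  (oint (fun v => jacobi_dc k v ^+ 2) 0 u + (ellE k - ellK k) / ellK k * u).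

End Elliptic.

Section Plane.
Context {R : realType}.
Implicit Types p q r : R * R.

(* The norm that the library puts on a product is the sup norm, hence an
   explicit Euclidean distance. *)
Definition edist p q : R :=
  Num.sqrt ((p.1 - q.1) ^+ 2 + (p.2 - q.2) ^+ 2).

Definition segment p q : set (R * R) :=
  [set z | exists t : R, 0 <= t <= 1 /\
     z = ((1 - t) * p.1 + t * q.1, (1 - t) * p.2 + t * q.2)].

(* Angle at p between the vectors pq and pr, in [0, pi]. *)
Definition angle p q r : R :=
  acos (((q.1 - p.1) * (r.1 - p.1) + (q.2 - p.2) * (r.2 - p.2))
        / (edist p q * edist p r)).

Definition ebounded (A : set (R * R)) : Prop :=
  exists M : R, forall p, A p -> edist (0, 0) p <= M.

End Plane.

(* A graph with vertices at points of the plane; the ends of an edge are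
   listed in an (arbitrary) order (e_-, e_+), which orients the edge. *)
Record drawn_graph (R : realType) := DrawnGraph {
  vertex : choiceType;
  edge : choiceType;
  pos : vertex -> R * R;
  em : edge -> vertex;
  ep : edge -> vertex }.

Section Isoradial.
Context {R : realType} (G : drawn_graph R).
Implicit Types (v x y : vertex G) (e : edge G) (F : set (R * R)) (c : R * R).

Definition incident e v : Prop := em e = v \/ ep e = v.

Definition edge_segment e : set (R * R) := segment (pos (em e)) (pos (ep e)).

(* Embedding with straight edges, locally finite in the plane; it excludes
   loops and multiple edges. *)
Definition planar_embedding : Prop :=
  [/\ injective (@pos R G),
      (forall e, em e <> ep e),
      (forall e v, edge_segment e (pos v) -> incident e v),
      (forall e e' p, e <> e' -> edge_segment e p -> edge_segment e' p ->
         exists v, [/\ incident e v, incident e' v & pos v = p])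
    & (forall M : R,
         finite_set [set v : vertex G | edist (0, 0) (pos v) <= M] /\
         finite_set [set e : edge G | exists2 p, edge_segment e p &
                                        edist (0, 0) p <= M])].

Definition drawing : set (R * R) :=
  [set p | (exists v, pos v = p) \/ (exists e, edge_segment e p)].

(* The bounded faces, as open sets. *)
Definition face F : Prop :=
  (exists2 p, ~ drawing p & F = connected_component (~` drawing) p) /\
  ebounded F.

Definition on_boundary v F : Prop := closure F (pos v).

Definition circumcenter F c : Prop :=
  forall v, on_boundary v F -> edist c (pos v) = 1.

Definition isoradial : Prop :=
  planar_embedding /\
  (forall F, face F -> exists c, circumcenter F c /\ F c).

Definition faces_cover_plane : Prop :=
  forall p : R * R, exists F, face F /\ closure F p.

(* Edges of the diamond graph: a vertex of G and the circumcenter of a face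
   having it on its boundary. *)
Definition diamond_edge v c : Prop :=
  exists F, [/\ face F, circumcenter F c, F c & on_boundary v F].

(* e_-, c, e_+, c' is the rhombus of the diamond graph with diagonal e. *)
Definition rhombus e c c' : Prop :=
  [/\ c <> c', diamond_edge (em e) c, diamond_edge (ep e) c,
      diamond_edge (em e) c' & diamond_edge (ep e) c'].

Definition half_angle e : R :=
  xget 0 [set t | exists c c',
    rhombus e c c' /\ t = angle (pos (em e)) c c' / 2].

End Isoradial.

Section Laplacian.
Context {R : realType} (G : drawn_graph R) (k : R).
Implicit Types (v x y : vertex G) (e : edge G) (f : vertex G -> R).

Definition theta e : R := half_angle e * (2 * ellK k / pi).

Definition rho e : R := jacobi_sc k (theta e).

Definition mass2 x : R :=
  \sum_(e \in [set e | incident e x]) (ellA k (theta e) - jacobi_sc k (theta e)).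

Definition other_end e x : vertex G := if em e == x then ep e else em e.

Definition laplacian f : vertex G -> R := fun x =>
  \sum_(e \in [set e | incident e x]) (rho e * (f x - f (other_end e x)))
  + mass2 x * f x.

Definition ell2 f : Prop :=
  (\esum_(x in [set: vertex G]) ((f x) ^+ 2)%:E < +oo)%E.

(* Inverse of the Laplacian as an operator of l^2, its domain being the f in
   l^2 with Laplacian in l^2; outside l^2 the value of A is irrelevant. *)
Definition inverse_on_ell2 (A : (vertex G -> R) -> (vertex G -> R)) : Prop :=
  (forall f, ell2 f -> ell2 (A f) /\ laplacian (A f) = f) /\
  (forall f, ell2 f -> ell2 (laplacian f) -> A (laplacian f) = f).

Definition laplacian_inv : (vertex G -> R) -> (vertex G -> R) :=
  @xget ((vertex G -> R) -> (vertex G -> R)) id [set A | inverse_on_ell2 A].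

Definition delta y : vertex G -> R := fun x => (x == y)%:R.

Definition green x y : R := laplacian_inv (delta y) x.

Definition Hee e e' : R :=
  rho e' * (green (em e) (em e') - green (ep e) (em e')
            - green (em e) (ep e') + green (ep e) (ep e')).
Definition Hev e x : R := mass2 x * (green (em e) x - green (ep e) x).
Definition Hve x e : R := rho e * (green x (em e) - green x (ep e)).
Definition Hvv x x' : R := mass2 x' * green x x'.

End Laplacian.

(* A configuration is a set of edges and a set of roots, given together by an
   indicator function on the disjoint union of edges and vertices; the
   sigma-algebra is the one generated by the coordinates. *)
Definition coordinate_events {R : realType} (G : drawn_graph R) :
    set (set ((edge G + vertex G)%type -> bool)) :=
  [set A | exists i, A = [set w : (edge G + vertex G)%type -> bool | w i]].

Notation config G := (g_sigma_algebraType (@coordinate_events _ G)).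

Section Forests.
Context {R : realType} (G : drawn_graph R) (k : R).
Implicit Types (x y : vertex G) (e : edge G) (w : config G).
Implicit Types (S : set (edge G)) (H : set (vertex G) * set (edge G)).

Definition edges_of w : set (edge G) := [set e | w (inl e)].
Definition roots_of w : set (vertex G) := [set x | w (inr x)].

Definition adj S : rel (vertex G) := fun x y =>
  `[< exists2 e, S e & (em e = x /\ ep e = y) \/ (em e = y /\ ep e = x) >].

Definition connected_by S x y : Prop :=
  exists2 s : seq (vertex G), path (adj S) x s & last x s = y.

(* Cycles have length at least 3, as the graph is simple. *)
Definition acyclic S : Prop :=
  forall s : seq (vertex G), (2 < size s)%N -> uniq s -> ~~ cycle (adj S) s.

(* A subgraph H is a pair (vertex set, edge set); in an infinite subgraph the
   trees are allowed to be infinite. *)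
Definition rooted_spanning_forest H w : Prop :=
  [/\ edges_of w `<=` H.2, roots_of w `<=` H.1, acyclic (edges_of w)
    & forall x, H.1 x ->
        exists! r, roots_of w r /\ connected_by (edges_of w) x r].

Definition whole_graph : set (vertex G) * set (edge G) := ([set: _], [set: _]).

Definition finite_subgraph H : Prop :=
  [/\ finite_set H.1, finite_set H.2
    & forall e, H.2 e -> H.1 (em e) /\ H.1 (ep e)].

Definition exhaustion (Gn : nat -> set (vertex G) * set (edge G)) : Prop :=
  [/\ (forall n, finite_subgraph (Gn n)),
      (forall n, (Gn n).1 `<=` (Gn n.+1).1 /\ (Gn n).2 `<=` (Gn n.+1).2),
      (forall x, exists n, (Gn n).1 x)
    & (forall e, exists n, (Gn n).2 e)].

(* The trees of w are indexed by their roots. *)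
Definition forest_weight w : R :=
  \big[*%R/1]_(x \in roots_of w)
    (mass2 k x *
     \big[*%R/1]_(e \in [set e | edges_of w e /\
                                 connected_by (edges_of w) x (em e)]) rho k e).

Definition partition_function H : R :=
  \sum_(w \in [set w | rooted_spanning_forest H w]) forest_weight w.

(* Boltzmann measure of the finite graph H, carried to configurations of G by
   inclusion of subsets of H into subsets of G. *)
Definition boltzmann H (P : probability (config G) R) : Prop :=
  forall A : set (config G), measurable A ->
    P A = ((\sum_(w \in [set w | rooted_spanning_forest H w /\ A w])
              forest_weight w) / partition_function H)%:E.

(* The default topology on a function type is that of uniform convergence;
   prod_topology gives the product of the discrete spaces bool. *)
Definition weak_limit (Pn : nat -> probability (config G) R)
    (P : probability (config G) R) : Prop :=
  forall f : prod_topology (fun _ : (edge G + vertex G)%type => bool) -> R,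
    continuous f -> (exists M : R, forall w, `|f w| <= M) ->
    (fun n => (\int[Pn n]_w (f w))%R) @ \oo --> (\int[P]_w (f w))%R.

Definition on_rooted_spanning_forests (P : probability (config G) R) : Prop :=
  {ae P, forall w, rooted_spanning_forest whole_graph w}.

Definition transfer_matrix (j kappa : nat)
    (e : 'I_j -> edge G) (x : 'I_kappa -> vertex G) : 'M[R]_(j + kappa) :=
  block_mx (\matrix_(i < j, l < j) Hee k (e i) (e l))
           (\matrix_(i < j, l < kappa) Hev k (e i) (x l))
           (\matrix_(i < kappa, l < j) Hve k (x i) (e l))
           (\matrix_(i < kappa, l < kappa) Hvv k (x i) (x l)).

Definition determinantal_formula (P : probability (config G) R) : Prop :=
  forall (j kappa : nat) (e : 'I_j -> edge G) (x : 'I_kappa -> vertex G),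
    injective e -> injective x ->
    P [set w | (forall i, edges_of w (e i)) /\ (forall i, roots_of w (x i))]
    = (\det (transfer_matrix e x))%:E.

Definition finite_components w : Prop :=
  forall x, finite_set [set y | connected_by (edges_of w) x y].

End Forests.

(* Main.v *)
(* On a finite subgraph the massive Laplacian is L = B^T C B, where B is the
   incidence matrix of edges and masses. Expanding det L along the rows gives a
   sum over functions sending each vertex to an incident edge or to its own mass;
   those with a cycle contribute 0 and the others are the rooted spanning forests, so
   that det L is the partition function. Multiplying the weights of some items by
   a variable and using Sylvester's identity gives the determinantal formula with
   the Green function of the subgraph, and P(b is the root of a) = m^2(b) G(a,b).

   As theta stays away from 0 and K(k), sc is bounded and A - sc has a positive
   lower bound, so the conductances at a vertex sum to at most a constant times the
   mass. Hence the massive Laplace equation is a contraction for the sup norm: its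
   bounded solutions are unique, and the Green functions of an exhaustion converge
   to that of G. So the probabilities of all local events converge; their limits
   define a measure as the image of Lebesgue measure under a nested interval
   construction.

   In the limit m^2(b) G(a,b) sums to 1 over b, hence almost surely every
   vertex has a root at finite distance; and it has a finite sum over a, by
   symmetry of G, hence almost surely every tree is finite. *)
Require Import Defs.
From HB Require Import structures.
From mathcomp Require Import all_boot all_order all_algebra all_fingroup.
From mathcomp Require Import all_classical all_reals all_analysis.
From mathcomp Require Import ring lra.
Import Order.TTheory GRing.Theory Num.Theory.
Import numFieldNormedType.Exports.
Set Implicit Arguments.
Unset Strict Implicit.
Unset Printing Implicit Defensive.
Local Open Scope classical_set_scope.
Local Open Scope ring_scope.

(** * Determinants of pointer functions *)

(** The event that b is the root of a depends on infinitely many items, so convergence of local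
    events alone does not give its limit probability. What is missing is a tail bound uniform in the
    subgraph: when m0 bounds the masses below, the expected number of vertices with root b is at
    most m^2(b)/m0, so the probability that a has root b at distance more than L is at most
    m^2(b)/(m0 (L+1)).

    The Green function of the definition is a chosen inverse on l^2, while finite Green functions
    converge pointwise under a sup bound. An energy estimate provides the inverse, and uniqueness of
    bounded solutions identifies it with the limit.

    A positive lower bound of the masses requires an edge at every vertex. This is a geometric fact,
    drawn from the covering of the plane by faces that have a circumcenter.

    Positivity of A - sc is proved in the amplitude variable: there k'(A - sc) is a smooth function
    that vanishes at 0 and pi/2, with a derivative changing sign at most once between them, from
    positive to negative. *)

(** Multiplying the block matrix [L] by the same unipotent factor on the right and on the left gives
    two block triangular matrices with the same determinant. *)
Lemma det_sylvester (R : comNzRingType) (m n : nat) (A : 'M[R]_(m, n))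
    (B : 'M[R]_(n, m)) :
  \det (1%:M + A *m B) = \det (1%:M + B *m A).
Proof.
pose L := block_mx (1%:M : 'M[R]_m) (- A) B (1%:M : 'M[R]_n).
have h1 : L *m block_mx 1%:M A 0 1%:M = block_mx 1%:M 0 B (1%:M + B *m A).
  rewrite mulmx_block !mul1mx !mulmx1 !mulmx0 !addr0; congr block_mx.
  - by rewrite subrr.
  - by rewrite addrC.
have h2 : block_mx 1%:M A 0 1%:M *m L = block_mx (1%:M + A *m B) 0 B 1%:M.
  rewrite mulmx_block !mul1mx !mulmx1 !mul0mx !add0r; congr block_mx.
  by rewrite addNr.
have := congr1 determinant h1; rewrite det_mulmx det_ublock det_lblock !det1 !mul1r mulr1 => <-.
by have := congr1 determinant h2; rewrite det_mulmx det_ublock det_lblock !det1 !mul1r mulr1 => ->.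
Qed.

(** Multilinearity: each row chooses its own term of the sum, whence a sum over functions from rows
    to terms. *)
Lemma det_row_expansion (R : comNzRingType) (n : nat) (T : finType)
    (a : 'I_n -> T -> R) (M : 'I_n -> T -> 'I_n -> R) :
  \det (\matrix_(x, y) \sum_(i : T) a x i * M x i y) =
  \sum_(f : {ffun 'I_n -> T})
     (\prod_x a x (f x)) * \det (\matrix_(x, y) M x (f x) y).
Proof.
rewrite /determinant.
under eq_bigr => s _ do under eq_bigr => x _ do rewrite mxE.
under eq_bigr => s _ do rewrite bigA_distr_bigA mulr_sumr.
rewrite exchange_big; apply: eq_bigr => f _; rewrite mulr_sumr.
apply: eq_bigr => s _; rewrite big_split /= mulrCA; congr (_ * _).
by under [in RHS]eq_bigr => x _ do rewrite mxE.
Qed.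

Lemma det0_row (R : comNzRingType) (n : nat) (A : 'M[R]_n) (x : 'I_n) :
  (forall y, A x y = 0) -> \det A = 0.
Proof. by move=> A0; rewrite (expand_det_row _ x) big1// => y _; rewrite A0 mul0r. Qed.

Section Pointers.
Context {n : nat}.
Implicit Types (g : 'I_n -> option 'I_n) (x y r : 'I_n).

(** A root is a point where [g] is [None]; the value [None] of the walk means that it has stepped
    past its root, and it is absorbing. *)
Definition walk g (x : 'I_n) (m : nat) : option 'I_n := iter m (obind g) (Some x).

Definition stops g x : bool := `[< exists m, walk g x m = None >].

Definition acyclic_pointer g : bool := [forall x, stops g x].

Definition ends g x r : bool :=
  `[< exists2 m, walk g x m = Some r & g r = None >].

Lemma walkS g x m :
  walk g x m.+1 = if g x is Some y then walk g y m else None.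
Proof.
rewrite /walk iterSr /=; case: (g x) => //=.
by elim: m => //= m ->.
Qed.

Lemma stopsE g x : stops g x = if g x is Some y then stops g y else true.
Proof.
case gx: (g x) => [y|]; last by apply/asboolP; exists 1%N; rewrite walkS gx.
apply/asboolP/asboolP => -[m].
  by case: m => // m; rewrite walkS gx => e; exists m.
by move=> e; exists m.+1; rewrite walkS gx.
Qed.

Lemma endsE g x r :
  ends g x r = if g x is Some y then ends g y r else x == r.
Proof.
case gx: (g x) => [y|].
  apply/asboolP/asboolP => -[m].
    case: m => [[<-]|m]; first by rewrite gx.
    by rewrite walkS gx => e gr; exists m.
  by move=> e gr; exists m.+1 => //; rewrite walkS gx.
apply/asboolP/eqP => [[m]|<-]; last by exists 0%N.
by case: m => [[<-]//|m]; rewrite walkS gx.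
Qed.

(** The height is the number of steps after which the walk becomes [None]. It replaces acyclicity in
    all later inductions along pointers. *)
Lemma pointer_height g : acyclic_pointer g ->
  exists h : 'I_n -> nat, forall x y, g x = Some y -> (h y < h x)%N.
Proof.
move=> /forallP ac.
have Q x : exists m, walk g x m == None.
  by have /asboolP[m e] := ac x; exists m; apply/eqP.
exists (fun x => ex_minn (Q x)) => x y gxy.
case: ex_minnP => m _ mP; case: ex_minnP => p /eqP e _.
case: p e => // p; rewrite walkS gxy => e.
by rewrite ltnS; apply: mP; apply/eqP.
Qed.

Lemma height_acyclic g (h : 'I_n -> nat) :
  (forall x y, g x = Some y -> (h y < h x)%N) -> acyclic_pointer g.
Proof.
move=> hg; apply/forallP => x.
have [m] := ubnP (h x); elim: m x => // m IH x hx.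
rewrite stopsE; case gx: (g x) => [y|//]; apply: IH.
exact: leq_trans (hg _ _ gx) _.
Qed.

Lemma ends_exists g x : stops g x -> exists r, ends g x r.
Proof.
move=> /asboolP[m]; elim: m x => // m IH x; rewrite walkS.
case gx: (g x) => [y|].
  by move=> /IH[r er]; exists r; rewrite endsE gx.
by exists x; rewrite endsE gx.
Qed.

Lemma ends_root g x r : ends g x r -> g r = None.
Proof. by move=> /asboolP[]. Qed.

Lemma ends_inj g x r r' : ends g x r -> ends g x r' -> r = r'.
Proof.
move=> /asboolP[m]; elim: m x => [x [->] gr|m IH x].
  by rewrite endsE gr => /eqP.
rewrite walkS [ends _ _ r']endsE; case: (g x) => // y; exact: IH.
Qed.

Definition pointer_mx (R : nzRingType) g : 'M[R]_n :=
  \matrix_(x, y) ((x == y)%:R - (g x == Some y)%:R).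

(** For acyclic [g], a permutation with a nonzero term never raises the height and lowers it at
    every point that it moves; as it preserves the sum of heights, it is the identity. For other
    [g], the indicator of the points whose walk never stops lies in the kernel. *)
Lemma det_pointer_mx (R : idomainType) g :
  \det (pointer_mx R g) = (acyclic_pointer g)%:R.
Proof.
have [ac|nac] := boolP (acyclic_pointer g).
  have [h hP] := pointer_height ac.
  rewrite /determinant (bigD1 (1%g : {perm _})) //= [X in _ + X]big1 => [|s s1].
    rewrite odd_perm1 expr0 mul1r addr0 big1// => x _.
    rewrite mxE perm1 eqxx; case: eqP => [e|_]; last by rewrite subr0.
    by have := hP _ _ e; rewrite ltnn.
  apply/eqP; rewrite mulf_eq0 signr_eq0 /=; apply/negP => /negP nz.
  move/negP : s1; apply; apply/eqP/permP => x; rewrite perm1.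
  have le y : (h (s y) <= h y)%N /\ (s y != y -> (h (s y) < h y)%N).
    have : pointer_mx R g y (s y) != 0.
      by move: nz; apply: contraNneq => e; rewrite (bigD1 y)//= e mul0r.
    rewrite mxE [y == _]eq_sym; case: (s y =P y) => [->//|_] /=.
    case: (g y =P _) => [/hP e _|_]; last by rewrite subrr eqxx.
    by split=> //; exact: ltnW.
  apply/eqP/negPn/negP => sx.
  have : (\sum_y h (s y) < \sum_y h y)%N.
    rewrite (bigD1 x) //= [X in (_ < X)%N](bigD1 x) //=.
    rewrite -addSn leq_add ?(le x).2//; apply: leq_sum => y _; exact: (le y).1.
  by rewrite [X in (_ < X)%N](reindex_inj (@perm_inj _ s)) ltnn.
apply/eqP; rewrite -det_tr; apply/det0P.
exists (\row_x (~~ stops g x)%:R).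
  move: nac; rewrite negb_forall => /existsP[x nx].
  by apply/eqP => /rowP/(_ x); rewrite !mxE nx => /eqP; rewrite oner_eq0.
apply/rowP => x; rewrite !mxE.
under eq_bigr => y _ do rewrite !mxE mulrBr.
rewrite sumrB (bigD1 x) //= eqxx mulr1 big1 ?addr0; last first.
  by move=> y yx; rewrite eq_sym (negbTE yx) mulr0.
rewrite stopsE; case gx: (g x) => [z|].
  rewrite (bigD1 z) //= eqxx mulr1 big1 ?addr0 ?subrr// => y yz.
  by rewrite [Some z == _]eq_sym (inj_eq Some_inj) (negbTE yz) mulr0.
by rewrite big1 ?subrr// => y _; rewrite mulr0.
Qed.

(* Replacing row r by that of x is the difference of pointing r to the root
   and of pointing r to x. *)
Lemma det_pointer_mx_row (R : idomainType) g r x : g r = None ->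
  \det (\matrix_(y, z) (if y == r then (x == z)%:R else pointer_mx R g y z))
  = (acyclic_pointer g && ends g x r)%:R.
Proof.
move=> gr.
pose g' y := if y == r then Some x else g y.
rewrite (determinant_multilinear (A := _) (B := pointer_mx R g)
  (C := pointer_mx R g') (i0 := r) (b := 1) (c := -1)).
- rewrite mul1r mulN1r !det_pointer_mx.
  have st' y : stops g' y -> stops g y.
    move=> /asboolP[m]; elim: m y => // m IH y; rewrite walkS stopsE /g'.
    case: (y =P r) => [->|_]; first by rewrite gr.
    by case: (g y) => // z; exact: IH.
  have [ac|nac] := boolP (acyclic_pointer g); last first.
    rewrite (_ : acyclic_pointer g' = false) ?subrr //.
    apply: contraNF nac => /forallP s; apply/forallP => y.
    exact/st'/s.
  have [ex|nex] := boolP (ends g x r).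
    rewrite (_ : acyclic_pointer g' = false) ?subr0 //.
    apply/negP => /forallP /(_ x)/asboolP[m].
    have : ends g x r by [].
    elim: m {1 2}x => // m IH y ey; rewrite walkS /g'.
    case: (y =P r) => [_|yr]; first exact: IH.
    move: ey; rewrite endsE; case: (g y) => [z|/eqP//]; exact: IH.
  rewrite (_ : acyclic_pointer g' = true) ?subrr //.
  have [h hP] := pointer_height ac.
  (* [H] exceeds all heights: the points ending at [r] are lifted above all others, so that the new
     pointer from [r] to [x] goes down. *)
  pose H := (\sum_y h y).+1.
  have leH y : (h y < H)%N by rewrite ltnS (bigD1 y) //= leq_addr.
  apply: (@height_acyclic _ (fun y => if ends g y r then H + h y else h y)%N).
  move=> y z; rewrite /g'; case: (y =P r) => [-> [<-]|_ gyz].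
    rewrite (negbTE nex) endsE gr eqxx.
    exact: leq_trans (leH _) (leq_addr _ _).
  rewrite [ends g y r]endsE gyz; have := hP _ _ gyz.
  by case: ifP => // _; rewrite ltn_add2l.
- apply/rowP => z; rewrite !mxE eqxx /g' gr eqxx /=.
  by rewrite (inj_eq Some_inj) [r == z]eq_sym [x == z]eq_sym; ring.
- apply/matrixP => y z; rewrite !mxE [lift r y == r]eq_sym.
  by rewrite (negbTE (neq_lift _ _)).
- apply/matrixP => y z; rewrite !mxE /g' [lift r y == r]eq_sym.
  by rewrite (negbTE (neq_lift _ _)).
Qed.

End Pointers.

(** * Spanning forests of finite graphs *)

Section Graph.
Context {R : realType} {G : drawn_graph R}.
Implicit Types (a b : vertex G) (e : edge G) (S : set (edge G)).

Lemma adj_sym S a b : adj S a b = adj S b a.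
Proof.
by apply/asboolP/asboolP => -[e Se h]; exists e => //; case: h => h; [right|left|right|left].
Qed.

Lemma connected_refl S a : connected_by S a a.
Proof. by exists [::]. Qed.

Lemma connected_trans S a b c :
  connected_by S a b -> connected_by S b c -> connected_by S a c.
Proof.
move=> [s ps ls] [t pt lt]; exists (s ++ t).
  by rewrite cat_path ps ls.
by rewrite last_cat ls.
Qed.

Lemma connected_adj S a b : adj S a b -> connected_by S a b.
Proof. by move=> ab; exists [:: b] => //=; rewrite ab. Qed.

Lemma connected_sym S a b : connected_by S a b -> connected_by S b a.
Proof.
move=> [s]; elim: s a => [a _ <-|c s IH a /= /andP[ac ps] ls].
  exact: connected_refl.
apply: connected_trans (IH _ ps ls) _; apply: connected_adj.
by rewrite adj_sym.
Qed.

Lemma sub_adj S S' a b : S `<=` S' -> adj S a b -> adj S' a b.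
Proof. by move=> SS /asboolP[e /SS Se h]; apply/asboolP; exists e. Qed.

Lemma sub_connected S S' a b :
  S `<=` S' -> connected_by S a b -> connected_by S' a b.
Proof.
move=> SS [s ps ls]; exists s => //; apply: sub_path ps => x y.
exact: sub_adj.
Qed.

(** A mass acts as an edge to a cemetery vertex whose column is deleted; edges and masses thus form
    the rows of one incidence matrix. *)
Definition incidence (i : edge G + vertex G) a : R :=
  match i with
  | inl e => (em e == a)%:R - (ep e == a)%:R
  | inr b => (b == a)%:R
  end.

Lemma other_endP e a : incident e a ->
  (em e = a /\ ep e = other_end e a) \/ (em e = other_end e a /\ ep e = a).
Proof.
rewrite /incident /other_end; case: (em e =P a) => [<- _|n [//|<-]]; first by left.
by right.
Qed.

Lemma other_end_adj S e a : S e -> incident e a -> adj S a (other_end e a).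
Proof.
by move=> Se /other_endP h; apply/asboolP; exists e.
Qed.

End Graph.

Definition in_subgraph (R : realType) (G : drawn_graph R)
    (H : set (vertex G) * set (edge G)) (i : edge G + vertex G) : Prop :=
  match i with inl e => H.2 e | inr a => H.1 a end.

Definition simple_graph (R : realType) (G : drawn_graph R) : Prop :=
  (forall e : edge G, em e <> ep e) /\
  (forall e e' : edge G,
    (em e = em e' /\ ep e = ep e') \/ (em e = ep e' /\ ep e = em e') -> e = e').

(** Enumerations of the vertices and of the items of [H] by ordinals, through which the finite graph
    is accessible to matrices. *)
Record presentation (R : realType) (G : drawn_graph R)
    (H : set (vertex G) * set (edge G)) (n N : nat) (v : 'I_n -> vertex G)
    (it : 'I_N -> edge G + vertex G) : Prop := Presentation {
  vertices_inj : injective v;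
  items_inj : injective it;
  vertices_im : forall a, H.1 a <-> exists x, v x = a;
  items_im : forall i, in_subgraph H i <-> exists t, it t = i;
  edges_sub : forall e, H.2 e -> H.1 (em e) /\ H.1 (ep e) }.

Section FiniteGraph.
Context {R : realType} {G : drawn_graph R} (H : set (vertex G) * set (edge G)).
Context {n N : nat} (v : 'I_n -> vertex G) (it : 'I_N -> edge G + vertex G).
Hypothesis sG : simple_graph G.
Hypothesis pr : presentation H v it.

Let loopless := sG.1.
Let simple := sG.2.
Let v_inj := vertices_inj pr.
Let it_inj := items_inj pr.
Let v_im := vertices_im pr.
Let it_im := items_im pr.
Let Hsub := edges_sub pr.

Implicit Types (a b : vertex G) (e : edge G) (f : {ffun 'I_n -> 'I_N}) (x y r : 'I_n) (c : edge G + vertex G -> R).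

(* A rooted spanning forest is encoded by the function f sending each vertex to
   the first edge on the way to its root, or to itself as a root; the forests are
   then the valid f whose [parent] map has no cycle. *)
Definition parent f x : option 'I_n :=
  match it (f x) with
  | inl e => [pick y | v y == other_end e (v x)]
  | inr _ => None
  end.

Definition valid f : bool := [forall x, incidence (it (f x)) (v x) != 0].

Definition good f : bool := valid f && acyclic_pointer (parent f).

(** The weights [c] are arbitrary because they are perturbed later on to count the items of a
    forest. *)
Definition lapmx c : 'M[R]_n :=
  \matrix_(x, y) \sum_(i < N) c (it i) * incidence (it i) (v x) * incidence (it i) (v y).

Lemma incidence_edge e a : (incidence (inl e) a != 0) <-> incident e a.
Proof.
rewrite /incidence /incident; have := @loopless e.
case: (em e =P a) => [->|h1]; case: (ep e =P a) => [->|h2] //= _.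
- by rewrite subr0 oner_eq0; split=> // _; left.
- by rewrite sub0r oppr_eq0 oner_eq0; split=> // _; right.
- by rewrite subrr eqxx; split=> // -[].
Qed.

Lemma incidence_root b a : (incidence (inr b) a != 0) <-> b = a.
Proof.
by rewrite /incidence; case: (b =P a) => h //=; rewrite ?oner_eq0 ?eqxx.
Qed.

Lemma validP f x : valid f ->
  match it (f x) with
  | inl e => [/\ H.2 e, incident e (v x)
             & exists2 y, parent f x = Some y & v y = other_end e (v x)]
  | inr b => b = v x /\ parent f x = None
  end.
Proof.
move=> /forallP/(_ x); rewrite /parent; case itf: (it (f x)) => [e|b] nz.
  have He : H.2 e by apply/(it_im (inl e)); exists (f x).
  move/incidence_edge : nz => inc; split => //.
  have [x' vx'] : exists x', v x' = other_end e (v x).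
    apply/v_im; have [] := Hsub He.
    by case: (other_endP inc) => -[-> ->].
  case: pickP => [y /eqP|/(_ x')]; first by exists y.
  by rewrite vx' eqxx.
by move/incidence_root : nz.
Qed.

(** The sign of the incidence at [v x] enters twice and cancels, so the orientation of the chosen
    edge disappears from the row. *)
Lemma valid_entry f x y : valid f ->
  incidence (it (f x)) (v x) * incidence (it (f x)) (v y) =
  pointer_mx R (parent f) x y.
Proof.
move=> /(validP x); rewrite mxE; case: (it (f x)) => [e [_ inc [z -> vz]]|b [-> ->]].
  have lo := @loopless e.
  rewrite /incidence !(inj_eq Some_inj) -(inj_eq v_inj x) -(inj_eq v_inj z) vz.
  case: (other_endP inc) => -[<- <-].
    rewrite eqxx eq_sym; case: eqP => [/esym//|_] /=.
    by rewrite subr0 mul1r.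
  rewrite eqxx; case: (em e =P _) => // _ /=.
  by rewrite sub0r mulN1r opprB.
by rewrite /incidence eqxx mul1r subr0 (inj_eq v_inj).
Qed.

Lemma det_lapmx c :
  \det (lapmx c) = \sum_(f | good f) \prod_x c (it (f x)).
Proof.
rewrite /lapmx; under eq_mx => x y do under eq_bigr => i _ do rewrite -mulrA.
rewrite (det_row_expansion (fun _ i => c (it i))
  (fun x i y => incidence (it i) (v x) * incidence (it i) (v y))).
rewrite [RHS]big_mkcond; apply: eq_bigr => f _; rewrite /good.
have [va|nv] /= := boolP (valid f).
  under eq_mx => x y do rewrite valid_entry //.
  rewrite (_ : \matrix_(i, j) _ = pointer_mx R (parent f)); last first.
    by apply/matrixP => x y; rewrite [LHS]mxE.
  rewrite det_pointer_mx; case: ifP => _; [exact: mulr1|exact: mulr0].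
move: nv; rewrite negb_forall => /existsP[x /negPn/eqP x0].
rewrite (det0_row (x := x)) ?mulr0// => y.
by rewrite mxE x0 mul0r.
Qed.

(** The factor [c (inr (v r))] is moved into row [r] as the weight of the single item [t0]. Only
    functions choosing the mass at [r] survive; for them [r] is a root, and the replaced row tests
    whether [x] ends at [r]. *)
Lemma det_lapmx_row c x r :
  c (inr (v r)) *
    \det (\matrix_(y, z) (if y == r then (x == z)%:R else lapmx c y z)) =
  \sum_(f | good f && ends (parent f) x r) \prod_y c (it (f y)).
Proof.
have [t0 it0] : exists t, it t = inr (v r) by apply/it_im/v_im; exists r.
have -> : c (inr (v r)) *
    \det (\matrix_(y, z) (if y == r then (x == z)%:R else lapmx c y z)) =
  \det (\matrix_(y, z) \sum_(i < N)
      (if y == r then (i == t0)%:R * c (inr (v r)) else c (it i)) *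
      (if y == r then (x == z)%:R
       else incidence (it i) (v y) * incidence (it i) (v z))).
  apply/esym; set B := (X in _ = _ * \det X).
  rewrite (determinant_multilinear (A := _) (B := B) (C := B) (i0 := r)
    (b := c (inr (v r))) (c := 0)) ?mul0r ?addr0 //.
  - apply/rowP => z; rewrite !mxE eqxx mul0r addr0 (bigD1 t0) //= eqxx mul1r.
    by rewrite big1 ?addr0// => i /negbTE->; rewrite !mul0r.
  - apply/matrixP => y z; rewrite !mxE [lift r y == r]eq_sym (negbTE (neq_lift _ _)).
    by apply: eq_bigr => i _; rewrite mulrA.
  - apply/matrixP => y z; rewrite !mxE [lift r y == r]eq_sym (negbTE (neq_lift _ _)).
    by apply: eq_bigr => i _; rewrite mulrA.
rewrite (det_row_expansion
  (fun y i => if y == r then (i == t0)%:R * c (inr (v r)) else c (it i))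
  (fun y i z => if y == r then (x == z)%:R
       else incidence (it i) (v y) * incidence (it i) (v z))).
rewrite [RHS]big_mkcond; apply: eq_bigr => f _ /=.
have [fr|fr] := eqVneq (f r) t0; last first.
  rewrite (bigD1 r) //= eqxx (negbTE fr) !mul0r; case: ifP => // /andP[].
  move=> /andP[va _] /ends_root; have := validP r va.
  case e: (it (f r)) => [e'|b] [].
    by move=> _ _ [y -> _].
  move=> eb _ _; case/eqP: fr; apply: it_inj.
  by rewrite e it0 eb.
have -> : \prod_(i : 'I_n) (if i == r then (f i == t0)%:R * c (inr (v r))
     else c (it (f i))) = \prod_y c (it (f y)).
  apply: eq_bigr => y _; case: eqP => // ->; by rewrite fr eqxx mul1r it0.
rewrite /good; have [va|nv] /= := boolP (valid f); last first.
  move: nv; rewrite negb_forall => /existsP[y /negPn/eqP y0].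
  have yr : y != r.
    apply: contra_eqN y0 => /eqP->; rewrite fr it0.
    exact/incidence_root.
  rewrite (det0_row (x := y)) ?mulr0// => z.
  by rewrite mxE (negbTE yr) y0 mul0r.
under eq_mx => y z do rewrite valid_entry //.
rewrite det_pointer_mx_row; last by rewrite /parent fr it0.
by case: ifP => _; rewrite ?mulr1 ?mulr0.
Qed.

(** Cramer's rule: the cofactor giving the entry at [x] and [r] of the inverse is the determinant
    with row [r] replaced by the unit vector at [x]. *)
Lemma lapmx_inv c x r : \det (lapmx c) != 0 ->
  \det (lapmx c) * (c (inr (v r)) * invmx (lapmx c) x r) =
  \sum_(f | good f && ends (parent f) x r) \prod_y c (it (f y)).
Proof.
move=> nz; rewrite -det_lapmx_row mulrCA; congr (_ * _).
rewrite /invmx unitmxE unitfE nz !mxE mulVKf //.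
rewrite (expand_det_row _ r) (bigD1 x) //= mxE !eqxx mul1r big1 ?addr0.
  rewrite /cofactor; congr (_ * \det _).
  apply/matrixP => y z; rewrite !mxE [lift r y == r]eq_sym (negbTE (neq_lift _ _)).
  by [].
by move=> z zx; rewrite mxE eqxx eq_sym (negbTE zx) mul0r.
Qed.

Definition forest_of f : config G := fun i => `[< exists x, it (f x) = i >].

Local Notation S f := (edges_of (forest_of f)).

Lemma forest_edge f x e : it (f x) = inl e -> S f e.
Proof. by move=> h; apply/asboolP; exists x. Qed.

Lemma forest_edgeP f e : valid f -> S f e ->
  exists x y, [/\ it (f x) = inl e, parent f x = Some y, incident e (v x)
                & v y = other_end e (v x)].
Proof.
move=> va /asboolP[x itx]; have := validP x va.
by rewrite itx => -[_ inc [y nx vy]]; exists x, y.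
Qed.

Lemma forest_root f x : valid f ->
  roots_of (forest_of f) (v x) <-> parent f x = None.
Proof.
move=> va; split.
  move=> /asboolP[y ity]; have := validP y va; rewrite ity => -[/v_inj -> ->] //.
move=> nx; apply/asboolP; exists x; have := validP x va.
by case: (it (f x)) => [e [_ _ [y]]|b [->]//]; rewrite nx.
Qed.

Lemma parent_adj f x y : valid f -> parent f x = Some y -> adj (S f) (v x) (v y).
Proof.
move=> va nx; have := validP x va.
case itx: (it (f x)) => [e|b]; last by case=> _; rewrite nx.
move=> [He inc [z]]; rewrite nx => -[<-] ->.
by apply: other_end_adj => //; exact: forest_edge itx.
Qed.

Lemma forest_adj f a b : valid f -> adj (S f) a b ->
  exists x y, [/\ v x = a, v y = b & parent f x = Some y \/ parent f y = Some x].
Proof.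
move=> va /asboolP[e /(forest_edgeP va)[x [y [itx nx inc vy]]]].
case: (other_endP inc); rewrite -vy => -[-> ->] [] [<- <-].
- by exists x, y; split=> //; left.
- by exists y, x; split=> //; right.
- by exists y, x; split=> //; right.
- by exists x, y; split=> //; left.
Qed.

(** A mass belongs to one vertex only, and two vertices choosing the same edge would point to each
    other, a cycle of length two. *)
Lemma good_inj f : good f -> injective f.
Proof.
move=> /andP[va /pointer_height[h hP]] x x' ff.
have := validP x va; have := validP x' va; rewrite -ff.
case itx: (it (f x)) => [e|b]; last by move=> [-> _] [/v_inj -> _].
move=> [_ inc' [y' ny' vy']] [_ inc [y ny vy]].
case: (other_endP inc); case: (other_endP inc'); rewrite -vy -vy'.
- by move=> [-> _] [/v_inj -> _].
- move=> [e1 e2] [e3 e4]; have /v_inj e5 : v y' = v x by rewrite -e1 -e3.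
  have /v_inj e6 : v x' = v y by rewrite -e2 -e4.
  move: (hP _ _ ny) (hP _ _ ny'); rewrite e5 e6 => lt1 lt2.
  by have := ltn_trans lt1 lt2; rewrite ltnn.
- move=> [e1 e2] [e3 e4]; have /v_inj e5 : v y' = v x by rewrite -e2 -e4.
  have /v_inj e6 : v x' = v y by rewrite -e1 -e3.
  move: (hP _ _ ny) (hP _ _ ny'); rewrite e5 e6 => lt1 lt2.
  by have := ltn_trans lt1 lt2; rewrite ltnn.
- by move=> [_ ->] [_ /v_inj ->].
Qed.

Lemma parent_connected f x r : valid f -> ends (parent f) x r ->
  connected_by (S f) (v x) (v r).
Proof.
move=> va /asboolP[m + _]; elim: m x => [x [->]|m IH x].
  exact: connected_refl.
rewrite walkS; case nx: (parent f x) => [y|//] /IH.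
by apply: connected_trans; apply: connected_adj; exact: parent_adj.
Qed.

Lemma connected_ends f x b : valid f -> connected_by (S f) (v x) b ->
  exists2 y, b = v y & forall r, ends (parent f) x r = ends (parent f) y r.
Proof.
move=> va [s]; elim: s x b => [|c s IH] x b /=; first by move=> _ <-; exists x.
move=> /andP[/(forest_adj va)[x' [y [/v_inj-> <-]]] nxy] ps ls.
have [z bz hz] := IH y b ps ls; exists z => // r; rewrite -hz.
by case: nxy => nx; [rewrite endsE nx|rewrite [RHS]endsE nx].
Qed.

Lemma forest_ends f x r : valid f ->
  ends (parent f) x r <->
  roots_of (forest_of f) (v r) /\ connected_by (S f) (v x) (v r).
Proof.
move=> va; split.
  move=> ex; split; last exact: parent_connected.
  by apply/forest_root => //; exact: ends_root ex.
move=> [/(forest_root _ va) nr /(connected_ends va)[y /v_inj <-] ->].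
by rewrite endsE nr.
Qed.

(** At a vertex of greatest height on a cycle, both neighbours in the cycle must be its parent; they
    coincide, which a cycle of length at least three forbids. *)
Lemma forest_acyclic f : good f -> acyclic (S f).
Proof.
move=> /andP[va /pointer_height[h hP]] s ss us; apply/negP => cs.
pose hG a := if [pick x | v x == a] is Some x then h x else 0%N.
have hGE x : hG (v x) = h x.
  rewrite /hG; case: pickP => [y /eqP/v_inj->//|/(_ x)]; by rewrite eqxx.
have [a as_ amax] : exists2 a, a \in s & forall b, b \in s -> (hG b <= hG a)%N.
  case: s ss {us cs} => // a s _.
  elim: s a => [|b s IH] a.
    by exists a; rewrite ?mem_head // => b; rewrite inE => /eqP->.
  have [c cs cP] := IH b; have [ac|ca] := leqP (hG a) (hG c).
    exists c; first by rewrite inE cs orbT.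
    by move=> d; rewrite inE => /orP[/eqP->//|/cP].
  exists a; first exact: mem_head.
  move=> d; rewrite inE => /orP[/eqP->//|/cP dc].
  exact: leq_trans dc (ltnW ca).
have [k s' def_s] := rot_to as_.
move: cs us ss; rewrite -(rot_cycle k) -(rot_uniq k) -(size_rot k) def_s.
have {}amax b : b \in a :: s' -> (hG b <= hG a)%N.
  by rewrite -def_s mem_rot; exact: amax.
case: s' def_s amax => [//|b q] _ amax; case: (lastP q) amax => [//|{}q d] amax.
rewrite /= rcons_path last_rcons => /andP[ab /andP[_ da]].
have bq : b \in a :: b :: rcons q d by rewrite !inE eqxx orbT.
have dq : d \in a :: b :: rcons q d by rewrite !inE mem_rcons mem_head !orbT.
have nxt (c : vertex G) : adj (S f) a c -> (hG c <= hG a)%N ->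
    exists x y, [/\ v x = a, v y = c & parent f x = Some y].
  move=> /(forest_adj va)[x [y [<- <-]]]; rewrite !hGE => -[nx _|/hP lt le].
    by exists x, y.
  by move: lt; rewrite ltnNge le.
have [x [y [vx vy nx]]] := nxt b ab (amax _ bq).
have [||x' [y' [vx' vy' nx']]] := nxt d; [by rewrite adj_sym|exact: amax|].
have xx' : x = x' by apply: v_inj; rewrite vx vx'.
have bd : b = d by rewrite -vy -vy'; move: nx'; rewrite -xx' nx => -[->].
by rewrite bd mem_rcons mem_head /= andbF.
Qed.

Lemma good_forest f : good f -> rooted_spanning_forest H (forest_of f).
Proof.
move=> gf; have /andP[va ac] := gf; split.
- move=> e /asboolP[x itx]; apply/(it_im (inl e)); by exists (f x).
- move=> a /asboolP[x itx]; apply/(it_im (inr a)); by exists (f x).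
- exact: forest_acyclic.
- move=> a /v_im[x <-]; have [r er] := ends_exists (forallP ac x).
  exists (v r); split; first exact/forest_ends.
  move=> b [rb cb]; have [y by_ hy] := connected_ends va cb.
  rewrite by_; congr v; apply: ends_inj er _; rewrite hy endsE.
  by move: rb; rewrite by_ => /(forest_root _ va) ->.
Qed.

(** Induction on the height for [f]. If the edge chosen by [x] under [f] were chosen under [f'] by
    its other end [z], then, as [f] and [f'] agree at [z], both [x] and [z] would choose it under
    [f]. *)
Lemma forest_of_inj f f' : good f -> good f' -> forest_of f = forest_of f' -> f = f'.
Proof.
move=> gf gf' ff; have /andP[va ac] := gf; have /andP[va' ac'] := gf'.
have [h hP] := pointer_height ac.
apply/ffunP => x; have [m] := ubnP (h x); elim: m x => // m IH x hx.
apply: it_inj; have := validP x va.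
have : forest_of f' (it (f x)) by rewrite -ff; apply/asboolP; exists x.
case itx: (it (f x)) => [e|b] /asboolP[y ity]; last first.
  move=> [bx _]; have := validP y va'; rewrite ity => -[by_ _].
  by rewrite -ity; congr (it (f' _)); apply: v_inj; rewrite -by_.
move=> [_ inc [z nx vz]]; rewrite -ity.
have [<-//|yx] := eqVneq y x.
have /IH fz : (h z < m)%N by apply: leq_trans (hP _ _ nx) _.
have yz : y = z.
  have := validP y va'; rewrite ity => -[_ incy _].
  apply: v_inj; move/eqP: yx => yx.
  case: (other_endP inc) vz => -[e1 e2] vz; case: incy => e3.
  - by case: yx; apply: v_inj; rewrite -e3.
  - by rewrite vz -e2.
  - by rewrite vz -e1.
  - by case: yx; apply: v_inj; rewrite -e3.
have : f x = f z by apply: it_inj; rewrite fz itx -yz ity.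
by move=> /(good_inj gf) xz; have := hP _ _ nx; rewrite -xz ltnn.
Qed.

(** Each vertex takes the first edge of a shortest path to a root. An edge of [w] left over would
    join two vertices already connected through their common root, and so close a cycle. *)
Lemma forest_pointer (w : config G) : rooted_spanning_forest H w ->
  exists2 f, good f & forest_of f = w.
Proof.
move=> [wE wV wac wr].
have vH x : H.1 (v x) by apply/v_im; exists x.
pose reach x m := exists s, [/\ size s = m, path (adj (edges_of w)) (v x) s
  & roots_of w (last (v x) s)].
have Q x : exists m, `[< reach x m >].
  have [r [[rr [s ps ls]] _]] := wr _ (vH x).
  by exists (size s); apply/asboolP; exists s; rewrite ls.
pose d x := ex_minn (Q x).
have dP x : reach x (d x) by rewrite /d; case: ex_minnP => m /asboolP.
have dmin x m : reach x m -> (d x <= m)%N.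
  by move=> h; rewrite /d; case: ex_minnP => p _; apply; apply/asboolP.
have step x : exists t : 'I_N,
    (roots_of w (v x) /\ it t = inr (v x)) \/
    exists e y, [/\ w (inl e), ~ roots_of w (v x), it t = inl e,
      incident e (v x) & v y = other_end e (v x) /\ (d y < d x)%N].
  have [[|b s] [sd ps ls]] := dP x.
    have [t ht] : exists t, it t = inr (v x) by apply/it_im; exact: vH.
    by exists t; left.
  have nr : ~ roots_of w (v x).
    by move=> rx; have : (d x <= 0)%N by [apply: dmin; exists [::]]; rewrite -sd.
  move: ps => /= /andP[/asboolP[e we eab] ps].
  have inc : incident e (v x) by case: eab => -[? ?]; [left|right].
  have ob : other_end e (v x) = b.
    case: (other_endP inc) eab => -[e1 e2] [] [e3 e4].
    - by rewrite -e2.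
    - by rewrite -e2 e4 -e1 e3.
    - by rewrite -e1 e3 -e2 e4.
    - by rewrite -e1.
  have [t ht] : exists t, it t = inl e by apply/it_im; exact: wE.
  have [y vy] : exists y, v y = b.
    by apply/v_im; have [h1 h2] := Hsub (wE _ we); case: eab => -[e1 e2]; rewrite -?e1 -?e2; [exact: h2|exact: h1].
  exists t; right; exists e, y; split=> //; split; first by rewrite ob.
  rewrite -sd ltnS; apply: dmin; exists s; split=> //; by rewrite vy.
have [f0 f0P] := choice step; pose f := [ffun x => f0 x].
have va : valid f.
  apply/forallP => x; rewrite ffunE; case: (f0P x) => [[_ ->]|[e [y [_ _ -> inc _]]]].
    exact/incidence_root.
  exact/incidence_edge.
have ac : acyclic_pointer (parent f).
  apply: (@height_acyclic _ _ d) => x y nx; have := validP x va.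
  rewrite ffunE; case: (f0P x) => [[_ ->]|[e [z [_ _ -> inc [vz lt]]]]].
    by rewrite nx => -[].
  by move=> [_ _ [z']]; rewrite nx => -[<-]; rewrite -vz => /v_inj ->.
have gf : good f by rewrite /good va ac.
have sub i : forest_of f i -> w i.
  move=> /asboolP[x]; rewrite ffunE.
  by case: (f0P x) => [[rx ->] <-//|[e [y [we _ -> _ _]]] <-].
exists f => //; apply/funext => i; apply/idP/idP; first exact: sub.
have SS : S f `<=` edges_of w by move=> e; exact: sub.
case: i => [e|a] wi; last first.
  have [x vx] : exists x, v x = a by apply/v_im/wV.
  apply/asboolP; exists x; rewrite ffunE -vx.
  by case: (f0P x) => [[_ ->]//|[e [y [_ nr]]]]; case: nr; rewrite vx.
apply: contrapT => nSe.
have [ha hb] := Hsub (wE _ wi).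
move: (ha) (hb) => /v_im[x vx] /v_im[y vy].
have [r er] := ends_exists (forallP ac x).
have [r' er'] := ends_exists (forallP ac y).
have [rr crx] := (forest_ends x r va).1 er.
have [rr' cry] := (forest_ends y r' va).1 er'.
have eab : adj (edges_of w) (v x) (v y).
  by apply/asboolP; exists e => //; left.
have rr'E : v r = v r'.
  have [u [_ uP]] := wr _ (vH x).
  rewrite -(uP (v r)) ?(uP (v r'))//; split.
  - exact: sub rr'.
  - apply: connected_trans (connected_adj eab) _; exact: sub_connected cry.
  - exact: sub rr.
  - exact: sub_connected crx.
have := connected_trans crx; rewrite rr'E => /(_ _ (connected_sym cry)) [s ps].
case/shortenP: ps => p pp up _ lp.
(* A path with one edge would make this edge parallel to [e], hence equal to it, although [e] is not
   in the forest of [f]. *)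
have sz : (2 < size (v x :: p))%N.
  case: p pp up lp => [|b [|//]] /=.
    by move=> _ _ xy; case: (@loopless e); rewrite -vx -vy.
  rewrite andbT => /asboolP[e' Se' he'] _ by_; case: nSe.
  rewrite (@simple e e') // -vx -vy -by_.
  by case: he' => -[-> ->]; [left|right].
move/negP: (wac _ sz up); apply; rewrite /= rcons_path lp [adj _ _ (v x)]adj_sym eab andbT.
by apply: sub_path pp => a b; exact: sub_adj.
Qed.

End FiniteGraph.

(** Turns operations over sets of edges, vertices or configurations into operations over ordinals or
    functions; the partial map [h] both selects the indices and renames them. *)
Lemma fsbig_pmap (R : Type) (idx : R) (op : Monoid.com_law idx)
    (T J : choiceType) (X : set T) (r : seq J) (h : J -> option T) (F : T -> R) :
  uniq r ->
  (forall i j t, h i = Some t -> h j = Some t -> i = j) ->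
  (forall t, X t <-> exists2 i, i \in r & h i = Some t) ->
  \big[op/idx]_(t \in X) F t = \big[op/idx]_(i <- r) oapp F idx (h i).
Proof.
move=> ur hinj XE; rewrite -big_pmap.
have -> : X = [set` pmap h r].
  apply/seteqP; split => t /=; rewrite mem_pmap.
    by move=> /XE[i ir hi]; apply/mapP; exists i.
  by move=> /mapP[i ir hi]; apply/XE; exists i.
apply/esym/fsbig_seq; elim: r ur {XE} => //= i r IH /andP[ir /IH ur].
case hi: (h i) => [t|//] /=; rewrite ur andbT mem_pmap.
apply/negP => /mapP[j jr hj]; move/negP: ir; apply.
by rewrite (hinj i j t).
Qed.

Lemma prod_if_unique (R : comNzRingType) (I : finType) (P : pred I) (u : R) :
  (forall i j, P i -> P j -> i = j) ->
  \prod_i (if P i then u else 1) = if [exists i, P i] then u else 1.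
Proof.
move=> uP; case: existsP => [[i Pi]|no].
  rewrite (bigD1 i) //= Pi big1 ?mulr1// => j ji.
  by case: ifP => // Pj; rewrite (uP _ _ Pj Pi) eqxx in ji.
by rewrite big1// => i _; case: ifP => // Pi; case: no; exists i.
Qed.

Lemma sum_if_unique (R : pzSemiRingType) (I : finType) (P : pred I) :
  (forall i j, P i -> P j -> i = j) ->
  \sum_i (P i)%:R = [exists i, P i]%:R :> R.
Proof.
move=> uP; case: existsP => [[i Pi]|no].
  rewrite (bigD1 i) //= Pi big1 ?addr0// => j ji.
  by case: (boolP (P j)) => // Pj; rewrite (uP _ _ Pj Pi) eqxx in ji.
by rewrite big1// => i _; case: (boolP (P i)) => // Pi; case: no; exists i.
Qed.

Lemma poly_eq_nonzero (R : realDomainType) (p q : {poly R}) :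
  (forall s, s != 0 -> p.[s] = q.[s]) -> p = q.
Proof.
move=> pq; apply/eqP; rewrite -subr_eq0; apply/eqP.
apply: (@roots_geq_poly_eq0 _ _ [seq n.+1%:R | n <- iota 0 (size (p - q))]).
- apply/allP => s /mapP[n _ ->]; rewrite /root !hornerE subr_eq0; apply/eqP/pq.
  by rewrite pnatr_eq0.
- by rewrite map_inj_uniq ?iota_uniq// => m n /eqP; rewrite eqr_nat => /eqP[].
- by rewrite size_map size_iota.
Qed.

(** * Weights of forests and the transfer matrix of a finite graph *)

Section Weight.
Context {R : realType} {G : drawn_graph R} (k : R).

Definition item_weight (i : edge G + vertex G) : R :=
  match i with inl e => rho k e | inr a => mass2 k a end.

(** The incidence matrix applied to [phi]: minus the increment along an edge, the value at a
    mass. *)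
Definition pairing (phi : vertex G -> R) (i : edge G + vertex G) : R :=
  match i with inl e => phi (em e) - phi (ep e) | inr a => phi a end.

(** One formula for the four blocks of the transfer impedance: the entries of B g B^T C. *)
Definition transfer (c : edge G + vertex G -> R)
    (g : vertex G -> vertex G -> R) (i i' : edge G + vertex G) : R :=
  c i' * pairing (fun a => pairing (g a) i') i.

End Weight.

Section FiniteGraph.
Context {R : realType} {G : drawn_graph R} (H : set (vertex G) * set (edge G)).
Context {n N : nat} (v : 'I_n -> vertex G) (it : 'I_N -> edge G + vertex G).
Hypothesis sG : simple_graph G.
Hypothesis pr : presentation H v it.

Let loopless := sG.1.
Let simple := sG.2.
Let v_inj := vertices_inj pr.
Let it_inj := items_inj pr.
Let v_im := vertices_im pr.
Let it_im := items_im pr.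
Let Hsub := edges_sub pr.

Implicit Types (a b : vertex G) (e : edge G) (f : {ffun 'I_n -> 'I_N}) (x y r : 'I_n).

Local Notation good := (good v it).
Local Notation parent := (parent v it).
Local Notation forest_of := (forest_of it).
Local Notation S f := (edges_of (forest_of f)).

(** Every vertex carries exactly one item, a mass at a root and an edge elsewhere. Grouping the
    vertices by the root at which they end turns the product over vertices into the product over
    trees. *)
Lemma forest_weightE k f : good f ->
  forest_weight k (forest_of f) = \prod_x item_weight k (it (f x)).
Proof.
move=> gf; have /andP[va ac] := gf; rewrite /forest_weight.
have vP x := validP sG pr x va.
pose root x := odflt x [pick r | ends (parent f) x r].
have rootP x : ends (parent f) x (root x).
  rewrite /root; case: pickP => //= no.
  by have [r er] := ends_exists (forallP ac x); rewrite no in er.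
have -> : \big[*%R/1]_(a \in roots_of (forest_of f))
      (mass2 k a * \big[*%R/1]_(e \in [set e | S f e /\ connected_by (S f) a (em e)])
          rho k e) =
  \prod_(r | parent f r == None) (item_weight k (it (f r)) *
    \prod_(x | (parent f x != None) && ends (parent f) x r) item_weight k (it (f x))).
  rewrite (@fsbig_pmap _ _ _ _ _ _ (enum 'I_n)
    (fun r => if parent f r == None then Some (v r) else None)); first last.
  - move=> a; split.
      move=> ra; have [r vr] : exists r, v r = a.
        by apply/v_im; have [_ + _ _] := good_forest sG pr gf; exact.
      exists r; first by rewrite mem_enum.
      by move: ra; rewrite -vr => /(forest_root sG pr _ va) ->.
    move=> [r _]; case: eqP => // nr [<-].
    exact/(forest_root sG pr _ va).
  - by move=> i j t; do 2![case: eqP => // _] => -[<-] [/v_inj].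
  - exact: enum_uniq.
  rewrite big_enum /= [RHS]big_mkcond; apply: eq_bigr => r _.
  case: eqP => // nr /=; congr (_ * _).
    by have := vP r; case: (it (f r)) => [e [_ _ [y]]|b [->//]]; rewrite nr.
  rewrite (@fsbig_pmap _ _ _ _ _ _ (enum 'I_n)
    (fun x => if ends (parent f) x r then
        (if it (f x) is inl e then Some e else None) else None)); first last.
  - move=> e; split.
      move=> [/= Se cr]; have [x [y [itx nx inc vy]]] := forest_edgeP sG pr va Se.
      exists x; first by rewrite mem_enum.
      suff -> : ends (parent f) x r by rewrite itx.
      apply/(forest_ends sG pr _ _ va).
      split; first exact/(forest_root sG pr _ va).
      apply: connected_sym; case: (other_endP inc) => -[e1 e2]; first by rewrite -e1.
      apply: connected_trans cr _; rewrite -e2; apply: connected_adj.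
      by apply/asboolP; exists e => //; left.
    move=> [x _]; case: ifP => // /(forest_ends sG pr _ _ va)[_ cx].
    case itx: (it (f x)) => [e'|//] [ee]; rewrite ee in itx.
    have Se := forest_edge itx; split=> //=.
    apply: connected_trans (connected_sym cx) _.
    have := vP x; rewrite itx => -[_ inc _].
    case: (other_endP inc) => -[-> e2]; first exact: connected_refl.
    by apply: connected_adj; exact: other_end_adj.
  - move=> x y e; do 2![case: ifP => // _].
    case itx: (it (f x)) => [e1|//] [e1e]; case ity: (it (f y)) => [e2|//] [e2e].
    by apply: (good_inj sG pr gf); apply: it_inj; rewrite itx ity e1e e2e.
  - exact: enum_uniq.
  rewrite big_enum /= [RHS]big_mkcond; apply: eq_bigr => x _.
  case: ifP => [ex|ex]; last by rewrite andbF.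
  rewrite andbT; have := vP x; case: (it (f x)) => [e [_ _ [y -> _]]//|b [_ ->]].
  by rewrite eqxx.
rewrite big_split /= [RHS](bigID (fun x => parent f x == None)) /=; congr (_ * _).
rewrite [RHS](partition_big root (fun r => parent f r == None)) /=; last first.
  by move=> x _; rewrite (ends_root (rootP x)).
apply: eq_bigr => r nr; apply: eq_bigl => x; congr (_ && _).
apply/idP/eqP => [ex|<-]; last exact: rootP.
exact: ends_inj (rootP x) ex.
Qed.

Lemma forest_sum k (A : set (config G)) :
  \sum_(w \in [set w | rooted_spanning_forest H w /\ A w]) forest_weight k w =
  \sum_(f | good f && `[< A (forest_of f) >]) \prod_x item_weight k (it (f x)).
Proof.
rewrite (@fsbig_pmap _ _ _ _ _ _ (enum {ffun 'I_n -> 'I_N})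
  (fun f => if good f && `[< A (forest_of f) >] then Some (forest_of f) else None));
  first last.
- move=> w; split.
    move=> [/(forest_pointer sG pr)[f gf <-] Af]; exists f; first by rewrite mem_enum.
    by rewrite gf asboolT.
  move=> [f _]; case: ifP => // /andP[gf /asboolP Af] [<-]; split=> //.
  exact: (good_forest sG pr gf).
- move=> f f' w; do 2![case: ifP => // /andP[? _]] => -[<-] [/esym].
  exact: (forest_of_inj sG pr).
- exact: enum_uniq.
rewrite big_enum [RHS]big_mkcond; apply: eq_bigr => f _.
by case: ifP => // /andP[gf _] /=; rewrite forest_weightE.
Qed.

(** The inverse of the finite Laplacian, extended by zero to all pairs of vertices, so that the
    Green functions of different subgraphs have the same type. *)
Definition green_ext (c : edge G + vertex G -> R) a b : R :=
  \sum_x \sum_y (v x == a)%:R * (v y == b)%:R * invmx (lapmx v it c) x y.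

Lemma green_extE c x y : green_ext c (v x) (v y) = invmx (lapmx v it c) x y.
Proof.
rewrite /green_ext (bigD1 x) //= [X in _ + X]big1 => [|x' xx']; last first.
  by rewrite big1// => y' _; rewrite (inj_eq v_inj) (negbTE xx') !mul0r.
rewrite addr0 (bigD1 y) //= [X in _ + X]big1 => [|y' yy']; last first.
  by rewrite [v y' == _](inj_eq v_inj) (negbTE yy') mulr0 mul0r.
by rewrite !eqxx !mul1r addr0.
Qed.

Lemma pairingE (phi : vertex G -> R) i : in_subgraph H i ->
  pairing phi i = \sum_x incidence i (v x) * phi (v x).
Proof.
have pick_sum a : H.1 a -> \sum_x (a == v x)%:R * phi (v x) = phi a.
  move=> /v_im[x <-]; rewrite (bigD1 x) //= eqxx mul1r big1 ?addr0// => y yx.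
  by rewrite (inj_eq v_inj) eq_sym (negbTE yx) mul0r.
case: i => [e /Hsub[h1 h2]|a /pick_sum -> //] /=.
under eq_bigr do rewrite mulrBl.
by rewrite sumrB !pick_sum.
Qed.

Section Transfer.
Context {p : nat} (J : 'I_p -> edge G + vertex G) (c : edge G + vertex G -> R).
Hypothesis J_inj : injective J.
Hypothesis JH : forall l, in_subgraph H (J l).
Hypothesis det_neq0 : \det (lapmx v it c) != 0.

Let B : 'M[R]_(p, n) := \matrix_(l, x) incidence (J l) (v x).
Let C : 'M[R]_p := diag_mx (\row_l c (J l)).
Let T : 'M[R]_p := \matrix_(l, l') transfer c (green_ext c) (J l) (J l').

Lemma transfer_mxE : T = B *m (invmx (lapmx v it c) *m (B^T *m C)).
Proof.
apply/matrixP => l l'; rewrite !mxE /transfer pairingE // mulr_sumr.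
apply: eq_bigr => x _; rewrite !mxE pairingE // mulrCA; congr (_ * _); rewrite mulr_sumr.
apply: eq_bigr => y _; rewrite green_extE mul_mx_diag !mxE; ring.
Qed.

(* Weights of the items of J multiplied by 1 + z: the determinant of the Laplacian
   then counts the items of J in a forest, and the matrix determinant lemma
   factors it through [transfer]. *)
Let bump z (i : edge G + vertex G) : R := c i * (1 + z * [exists l, J l == i]%:R).

Lemma lapmx_bump z : lapmx v it (bump z) = lapmx v it c + z *: (B^T *m (C *m B)).
Proof.
apply/matrixP => x y; rewrite !mxE.
under eq_bigr => i _.
  rewrite /bump -sum_if_unique; last by move=> l l' /eqP <- /eqP/J_inj.
  rewrite mulrDr mulr1 !mulrDl mulr_sumr mulr_sumr !mulr_suml. over.
rewrite big_split /=; congr (_ + _); rewrite exchange_big mulr_sumr.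
apply: eq_bigr => l _; rewrite mul_diag_mx !mxE.
have [t jt] := (it_im _).1 (JH l).
rewrite (bigD1 t) //= big1 ?addr0 => [|t' tt'].
  by rewrite jt eqxx mulr1; ring.
by rewrite -jt (inj_eq it_inj) eq_sym (negbTE tt'); rewrite !mulr0 !mul0r.
Qed.

Lemma prod_bump z f : good f ->
  \prod_x bump z (it (f x)) =
  (\prod_x c (it (f x))) * \prod_l (if forest_of f (J l) then 1 + z else 1).
Proof.
move=> gf; rewrite big_split /=; congr (_ * _).
transitivity (\prod_x \prod_l (if J l == it (f x) then 1 + z else 1)).
  apply: eq_bigr => x _; rewrite prod_if_unique; last first.
    by move=> l l' /eqP <- /eqP/J_inj.
  by case: ifP => _; rewrite ?mulr1 ?mulr0 ?addr0.
rewrite exchange_big; apply: eq_bigr => l _; rewrite prod_if_unique; last first.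
  by move=> x y /eqP -> /eqP/it_inj/(good_inj sG pr gf).
congr (if _ then _ else _); apply/existsP/asboolP => -[x].
  by move=> /eqP->; exists x.
by move=> <-; exists x.
Qed.

Lemma bump_det z :
  \sum_(f | good f) (\prod_x c (it (f x))) *
     \prod_l (if forest_of f (J l) then 1 + z else 1) =
  \det (lapmx v it c) * \det (1%:M + z *: T).
Proof.
transitivity (\det (lapmx v it (bump z))).
  by rewrite (det_lapmx sG pr); apply: eq_bigr => f /prod_bump ->.
have uL : lapmx v it c \in unitmx by rewrite unitmxE unitfE.
rewrite lapmx_bump transfer_mxE.
have -> : lapmx v it c + z *: (B^T *m (C *m B)) =
    lapmx v it c *m (1%:M + (invmx (lapmx v it c) *m (B^T *m C)) *m (z *: B)).
  by rewrite mulmxDr mulmx1 !mulmxA mulmxV // mul1mx scalemxAr.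
by rewrite det_mulmx det_sylvester scalemxAl.
Qed.

Lemma transfer_forest_sum :
  \sum_(f | good f && [forall l, forest_of f (J l)]) \prod_x c (it (f x)) =
  \det (lapmx v it c) * \det T.
Proof.
(* The case [z = -1] of [bump_det] gives the forests avoiding J; substituting
   [z = 1/X] and evaluating at X = 0 gives those containing J. *)
pose P : {poly R} := \sum_(f | good f)
  (\prod_x c (it (f x))) *: \prod_l ('X + (forest_of f (J l))%:R%:P).
pose Q : {poly R} := \det (lapmx v it c) *: \det ('X%:M + map_mx polyC T).
have PE s : P.[s] = \sum_(f | good f)
    (\prod_x c (it (f x))) * \prod_l (s + (forest_of f (J l))%:R).
  rewrite horner_sum; apply: eq_bigr => f _; rewrite hornerZ horner_prod.
  by congr (_ * _); apply: eq_bigr => l _; rewrite !hornerE.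
have QE s : Q.[s] = \det (lapmx v it c) * \det (s%:M + T).
  rewrite hornerZ -horner_evalE -det_map_mx; congr (_ * \det _).
  rewrite map_mxD map_scalar_mx /= horner_evalE hornerX; congr (_ + _).
  by apply/matrixP => l l'; rewrite !mxE horner_evalE hornerC.
have PQ : P = Q.
  apply: poly_eq_nonzero => s s0; rewrite PE QE.
  have -> : s%:M + T = s *: (1%:M + s^-1 *: T).
    by rewrite scalerDr scalerA mulfV // scale1r scalemx1.
  rewrite detZ mulrCA -bump_det mulr_sumr; apply: eq_bigr => f _.
  rewrite mulrCA; congr (_ * _).
  rewrite -[X in s ^+ X](card_ord p) -prodr_const -big_split /=.
  apply: eq_bigr => l _; case: forest_of => /=; last by rewrite addr0 mulr1.
  by rewrite mulrDr mulr1 mulfV.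
have := congr1 (horner ^~ 0) PQ; rewrite /= PE QE.
rewrite (_ : 0%:M = 0) ?add0r; last by apply/matrixP => ? ?; rewrite !mxE mul0rn.
move=> <-; rewrite big_mkcondr; apply: eq_bigr => f gf /=.
case: ifP => [/forallP all1|/negbT].
  by rewrite [X in _ * X]big1 ?mulr1// => l _; rewrite all1 add0r.
rewrite negb_forall => /existsP[l /negbTE nl].
by rewrite [X in _ * X](bigD1 l) //= nl addr0 mul0r mulr0.
Qed.

End Transfer.

End FiniteGraph.

(** * Limits of local probabilities *)

Section Configurations.
Context {R : realType} {G : drawn_graph R}.
Local Notation item := (edge G + vertex G)%type.
Implicit Types (w : config G) (A B : set (config G)) (J L : seq item) (i : item).

Definition present J : set (config G) := [set w : config G | all w J].

Lemma measurable_coordinate i : measurable [set w : config G | w i].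
Proof. by apply: sub_sigma_algebra; exists i. Qed.

Lemma present_cons i J : present (i :: J) = [set w : config G | w i] `&` present J.
Proof. by apply/seteqP; split => w; rewrite /present /= => /andP. Qed.

Lemma present_nil : present [::] = setT.
Proof. by apply/seteqP; split. Qed.

Lemma measurable_present J : measurable (present J).
Proof.
elim: J => [|i J IH]; first by rewrite present_nil.
by rewrite present_cons; apply: measurableI => //; exact: measurable_coordinate.
Qed.

(** The events [present J] generate the sigma-algebra and are stable under intersection; this is
    what makes a determinantal formula determine the measure. *)
Lemma present_unique (P Q : probability (config G) R) :
  (forall J, uniq J -> P (present J) = Q (present J)) ->
  forall A, measurable A -> P A = Q A.
Proof.
move=> PQ A mA.
apply: (measure_unique [set present J | J in [set: seq item]] (fun=> setT)) => //.
- apply/seteqP; split.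
    apply: smallest_sub; first exact: smallest_sigma_algebra.
    move=> _ [i ->]; apply: sub_sigma_algebra; exists [:: i] => //.
    by apply/seteqP; split => w; rewrite /present /= andbT.
  apply: smallest_sub; first exact: sigma_algebra_measurable.
  by move=> _ [J _ <-]; exact: measurable_present.
- move=> _ _ [J _ <-] [L _ <-]; exists (J ++ L) => //.
  by apply/seteqP; split => w; rewrite /present /= all_cat => /andP.
- by move=> _; exists [::] => //; rewrite present_nil.
- by rewrite bigcup_const //; exists 0%N.
- move=> _ [J _ <-]; suff -> : present J = present (undup J).
    exact: PQ (undup_uniq _).
  apply/seteqP; split => w /allP h; apply/allP => i iJ; apply: h;
  by rewrite mem_undup in iJ *.
- by move=> n; exact: le_lt_trans (probability_le1 P measurableT) (ltry 1).
Qed.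

Definition supported J A : Prop :=
  forall w w', (forall i, i \in J -> w i = w' i) -> A w -> A w'.

Definition local A : Prop := exists J, supported J A.

Lemma supported_sub J L A : {subset J <= L} -> supported J A -> supported L A.
Proof. by move=> JL sA w w' ww'; apply: sA => i /JL; exact: ww'. Qed.

Lemma local_coordinate i : local [set w : config G | w i].
Proof. by exists [:: i] => w w' /(_ i) /=; rewrite mem_head => <-. Qed.

Lemma localI A B : local A -> local B -> local (A `&` B).
Proof.
move=> [J sA] [L sB]; exists (J ++ L) => w w' ww' [Aw Bw]; split.
  by apply: sA Aw => i iJ; apply: ww'; rewrite mem_cat iJ.
by apply: sB Bw => i iJ; apply: ww'; rewrite mem_cat iJ orbT.
Qed.

Lemma localC A : local A -> local (~` A).
Proof.
move=> [J sA]; exists J => w w' ww' nAw Aw'; apply: nAw.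
by apply: sA Aw' => i iJ; rewrite ww'.
Qed.

Lemma localU A B : local A -> local B -> local (A `|` B).
Proof.
move=> lA lB; rewrite -[_ `|` _]setCK setCU; apply: localC.
by apply: localI; exact: localC.
Qed.

Lemma local_const (p : Prop) : local [set w : config G | p].
Proof. by exists [::]. Qed.

Lemma local_bigcup_seq (T : eqType) (s : seq T) (F : T -> set (config G)) :
  (forall t, t \in s -> local (F t)) -> local (\bigcup_(t in [set` s]) F t).
Proof.
elim: s => [|t s IH] lF.
  by rewrite set_nil bigcup_set0; exact: (local_const False).
have -> : [set` t :: s] = [set t] `|` [set` s].
  apply/seteqP; split => u /=; rewrite inE; first by case/orP => [/eqP|]; [left|right].
  by case=> [->|->]; rewrite ?eqxx ?orbT.
rewrite bigcup_setU bigcup_set1; apply: localU.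
  by apply: lF; rewrite mem_head.
by apply: IH => u us; apply: lF; rewrite inE us orbT.
Qed.

Lemma local_bigcup (T : choiceType) (X : set T) (F : T -> set (config G)) :
  finite_set X -> (forall t, X t -> local (F t)) -> local (\bigcup_(t in X) F t).
Proof.
move=> /finite_seqP[s ->] lF; exact: local_bigcup_seq.
Qed.

Lemma local_present J : local (present J).
Proof.
by exists J => w w' ww' /allP h; apply/allP => i iJ; rewrite -ww' // h.
Qed.

(* Inclusion-exclusion: a local event is obtained from the events [present J]
   by finitely many disjoint unions and proper differences. *)
Lemma local_ind (K : set (config G) -> Prop) :
  (forall J, K (present J)) ->
  (forall A B, K A -> K B -> A `&` B = set0 -> K (A `|` B)) ->
  (forall A B, K A -> K B -> A `<=` B -> K (B `\` A)) ->
  forall A, local A -> K A.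
Proof.
move=> KJ KU KD A [L sA].
pose E J L := [set w : config G | all w J && all (predC w) L].
have E0 J : E J [::] = present J.
  by apply/seteqP; split => w; rewrite /E /present /= andbT.
have KE : forall L J, K (E J L).
  elim=> [|i L' IH] J; first by rewrite E0.
  have -> : E J (i :: L') = E J L' `\` E (i :: J) L'.
    apply/seteqP; split => w; rewrite /E /=.
      by move=> /and3P[-> /negbTE -> ->].
    by move=> [/andP[-> ->]]; case: (w i).
  by apply: KD => // w; rewrite /E /=; case: (w i).
have K0 : K set0 by rewrite -(setDv (present [::])); exact: KD.
(* [J] and [L1] hold the coordinates already fixed as present and absent, [L2] the free ones. When
   none is free, the cylinder is contained in [A] or disjoint from it. *)
suff H : forall L2 J L1, supported (J ++ L1 ++ L2) A -> K (A `&` E J L1).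
  have := H L [::] [::] sA; rewrite E0 present_nil setIT //.
elim=> [|i L2 IH] J L1 sA'.
  have [[w [Aw Ew]]|no] := pselect (exists w, A w /\ E J L1 w).
    suff -> : A `&` E J L1 = E J L1 by exact: KE.
    apply/setIidr => w' Ew'; apply: sA' Aw => j; rewrite cats0 mem_cat.
    move: Ew Ew' => /andP[/allP h1 /allP h2] /andP[/allP h3 /allP h4].
    case/orP => [jJ|jL]; first by rewrite h1 // h3.
    by move: (h2 _ jL) (h4 _ jL) => /= /negbTE -> /negbTE ->.
  suff -> : A `&` E J L1 = set0 by [].
  by rewrite -subset0 => w [Aw Ew]; apply: no; exists w.
have -> : A `&` E J L1 = (A `&` E (i :: J) L1) `|` (A `&` E J (i :: L1)).
  rewrite -setIUr; congr (_ `&` _); apply/seteqP; split => w; rewrite /E /=.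
    by move=> /andP[-> ->]; case: (w i); [left|right].
  by move=> [/andP[/andP[_ ->] ->//]|/and3P[-> _ ->]].
apply: KU.
- apply: IH; apply: supported_sub sA' => j.
  by rewrite !(mem_cat, inE); do ![case: (_ \in _)]; case: (j == i).
- apply: IH; apply: supported_sub sA' => j.
  by rewrite !(mem_cat, inE); do ![case: (_ \in _)]; case: (j == i).
- rewrite -subset0 => w [[_ /andP[/= /andP[wi _] _]]] [_ /andP[_ /= /andP[nwi _]]].
  by rewrite wi in nwi.
Qed.

Lemma local_measurable A : local A -> measurable A.
Proof.
move: A; apply: local_ind => [J|A B mA mB _|A B mA mB _].
- exact: measurable_present.
- exact: measurableU.
- exact: measurableD.
Qed.

End Configurations.

Section Convergence.
Context {R : realType} {G : drawn_graph R}.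
Local Notation item := (edge G + vertex G)%type.
Implicit Types (P : probability (config G) R) (w : config G) (A B : set (config G)).
Implicit Types (J L : seq item) (i : item).

Definition prob P A : R := fine (P A).

Lemma probE P A : measurable A -> P A = (prob P A)%:E.
Proof. by move=> mA; rewrite fineK // fin_num_measure. Qed.

Lemma prob_ge0 P A : 0 <= prob P A.
Proof. exact/fine_ge0/measure_ge0. Qed.

Lemma probT P : prob P setT = 1.
Proof. by rewrite /prob probability_setT. Qed.

Lemma probU P A B : measurable A -> measurable B -> A `&` B = set0 ->
  prob P (A `|` B) = prob P A + prob P B.
Proof.
move=> mA mB AB; apply/eqP; rewrite -eqe EFinD -!probE ?measureU//.
  exact: measurableU.
Qed.

Lemma probD P A B : measurable A -> measurable B -> A `<=` B ->
  prob P (B `\` A) = prob P B - prob P A.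
Proof.
move=> mA mB AB; rewrite -[X in prob P X - _](setDUK AB) probU ?setDIK//.
- by rewrite addrC addKr.
- exact: measurableD.
Qed.

Lemma prob_le P A B : measurable A -> measurable B -> A `<=` B ->
  prob P A <= prob P B.
Proof. by move=> mA mB AB; rewrite -subr_ge0 -probD // prob_ge0. Qed.

Lemma prob_le1 P A : measurable A -> prob P A <= 1.
Proof. by move=> mA; rewrite -(probT P) prob_le. Qed.

Variable Pn : nat -> probability (config G) R.

Lemma local_cvg P :
  (forall J, prob (Pn n) (present J) @[n --> \oo] --> prob P (present J)) ->
  forall A, local A -> prob (Pn n) A @[n --> \oo] --> prob P A.
Proof.
move=> cJ A lA.
(* Measurability is carried along: the induction forgets that its events are local, and additivity
   asks for it. *)
suff [] : measurable A /\ prob (Pn n) A @[n --> \oo] --> prob P A by [].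
move: A lA; apply: local_ind => [J|A B [mA cA] [mB cB] AB|A B [mA cA] [mB cB] AB].
- by split; [exact: measurable_present|exact: cJ].
- split; first exact: measurableU.
  rewrite probU //; under eq_fun do rewrite probU //; exact: cvgD.
- split; first exact: measurableD.
  rewrite probD //; under eq_fun do rewrite probD //; exact: cvgB.
Qed.

Lemma local_is_cvg :
  (forall J, cvgn (fun n => prob (Pn n) (present J))) ->
  forall A, local A -> cvgn (fun n => prob (Pn n) A).
Proof.
move=> cJ A lA.
suff [] : measurable A /\ cvgn (fun n => prob (Pn n) A) by [].
move: A lA; apply: local_ind => [J|A B [mA cA] [mB cB] AB|A B [mA cA] [mB cB] AB].
- by split; [exact: measurable_present|exact: cJ].
- split; first exact: measurableU.
  under eq_fun do rewrite probU //; exact: is_cvgD.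
- split; first exact: measurableD.
  under eq_fun do rewrite probD //; exact: is_cvgB.
Qed.

End Convergence.

(** * A measure with prescribed limits on local events *)

Section Existence.
Context {R : realType} {G : drawn_graph R}.
Local Notation item := (edge G + vertex G)%type.
Variable Pn : nat -> probability (config G) R.
Hypothesis Pn_cvg :
  forall J : seq item, cvgn (fun n => prob (Pn n) (present J)).
Variables (idx : nat -> item) (rnk : item -> nat).
Hypotheses (idxK : cancel idx rnk) (rnkK : cancel rnk idx).
Implicit Types (s : seq bool) (w : config G) (A B : set (config G)) (t : R).

Let L A : R := limn (fun n => prob (Pn n) A).

(* A sequence of bits records the states of the first items, last one first. *)
Let pcyl s : set (config G) :=
  [set w | [forall j : 'I_(size s), w (idx j) == nth false (rev s) j]].

Let pcyl_cons b s :
  pcyl (b :: s) = pcyl s `&` [set w : config G | w (idx (size s)) = b].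
Proof.
apply/seteqP; split => w.
  move=> /forallP h; split.
    apply/forallP => j; have := h (widen_ord (leqnSn _) j); rewrite /= => /eqP->.
    by rewrite rev_cons nth_rcons size_rev ltn_ord.
  by have := h ord_max; rewrite /= rev_cons nth_rcons size_rev ltnn eqxx => /eqP.
move=> [/forallP h wb]; apply/forallP => -[j /= js].
rewrite rev_cons nth_rcons size_rev; move: js; rewrite ltnS leq_eqVlt.
case: ltngtP => // [js _|-> _]; last by rewrite wb.
by have := h (Ordinal js).
Qed.

Let local_pcyl s : local (pcyl s).
Proof.
elim: s => [|b s IH].
  rewrite (_ : pcyl [::] = setT); first exact: (local_const True).
  by apply/seteqP; split => // w _; apply/forallP => -[].
rewrite pcyl_cons; apply: localI => //.
exists [:: idx (size s)] => w w' /(_ (idx (size s))); rewrite mem_head => /(_ isT).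
by move=> /= ->.
Qed.

Let p s := L (pcyl s).

Let L_cvg A : local A -> prob (Pn n) A @[n --> \oo] --> L A.
Proof. by move=> lA; exact: local_is_cvg. Qed.

Let p_ge0 s : 0 <= p s.
Proof.
apply: limr_ge; first exact: local_is_cvg.
by apply: nearW => n; exact: prob_ge0.
Qed.

Let p_nil : p [::] = 1.
Proof.
rewrite /p (_ : pcyl [::] = setT); last first.
  by apply/seteqP; split => // w _; apply/forallP => -[].
by rewrite /L; under eq_fun do rewrite probT; exact: lim_cst.
Qed.

Let p_split s : p s = p (false :: s) + p (true :: s).
Proof.
have lp b : local (pcyl (b :: s)) by exact: local_pcyl.
have E n : prob (Pn n) (pcyl s) =
    prob (Pn n) (pcyl (false :: s)) + prob (Pn n) (pcyl (true :: s)).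
  rewrite -probU; [|exact: local_measurable|exact: local_measurable|].
    rewrite !pcyl_cons -setIUr; congr (prob _ _); apply/esym/setIidl => w _ /=.
    by case: (w _); [right|left].
  by rewrite !pcyl_cons -subset0 => w [[_ /= ->]] [].
rewrite [LHS]/p /L; apply: cvg_lim => //; under eq_fun do rewrite E.
exact: cvgD (L_cvg (lp false)) (L_cvg (lp true)).
Qed.

(** The total limit mass of the cylinders of the same depth that precede [s], with [false] before
    [true] and the earliest item compared first. *)
Let lft := fix lft s : R :=
  if s is b :: s' then lft s' + (if b then p (false :: s') else 0) else 0.

(* The half-open intervals [lft s, lft s + p s) with [size s = n] partition
   [0, 1); [bits t n] is the index of the one containing t. *)
Let bits t := fix bits n : seq bool :=
  if n is n'.+1 then (lft (bits n') + p (false :: bits n') <= t) :: bits n'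
  else [::].

Let size_bits t n : size (bits t n) = n.
Proof. by elim: n => //= n ->. Qed.

Let bitsP t s : 0 <= t < 1 ->
  (bits t (size s) == s) = (lft s <= t < lft s + p s).
Proof.
move=> t01; elim: s => [|b s IH]; first by rewrite /= add0r p_nil t01.
rewrite [bits _ _]/= eqseq_cons andbC IH; have := p_split s.
have := p_ge0 (false :: s); have := p_ge0 (true :: s).
have [|no] := boolP (lft s <= t < lft s + p s); rewrite ?andbF ?andbT.
  rewrite -IH => /[dup] + /eqP -> /=; rewrite IH => /andP[l1 l2] p1 p0 ps.
  case: b => /=; rewrite ?addr0 ?eqb_id ?eqbF_neg -?ltNge ?andbT.
    by apply/idP/andP => [h|[]//]; split=> //; lra.
  by apply/idP/andP => [h|[]//]; split=> //; lra.
move=> p1 p0 ps; rewrite andFb.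
apply/esym/negP => /andP[h1 h2]; move/negP: no; apply; apply/andP.
by split; move: h1 h2; case: b => /=; lra.
Qed.

Let lft_bounds s : 0 <= lft s /\ lft s + p s <= 1.
Proof.
elim: s => [|b s [IH1 IH2]]; first by rewrite p_nil add0r.
have := p_split s; have := p_ge0 (false :: s); have := p_ge0 (true :: s).
by case: b => /= *; split; lra.
Qed.

Let config_of t : config G := fun i => head false (bits t (rnk i).+1).

Let pcyl_config_of t s : pcyl s (config_of t) <-> bits t (size s) = s.
Proof.
elim: s => [|b s IH].
  by split=> // _; apply/forallP => -[].
rewrite pcyl_cons; split.
  by move=> [/IH e /=]; rewrite /config_of idxK /= e => ->.
move=> [e1 e2]; split; first exact/IH.
by move: e1; rewrite /= /config_of idxK /= e2.
Qed.

Let measurable_bits s : measurable [set t | bits t (size s) = s].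
Proof.
elim: s => [|b s IH].
  by rewrite (_ : [set _ | _] = setT) //; apply/seteqP; split.
have -> : [set t | bits t (size (b :: s)) = b :: s] =
    [set t | bits t (size s) = s] `&`
    [set` if b then `[lft s + p (false :: s), +oo[ else `]-oo, lft s + p (false :: s)[].
  apply/seteqP; split => t /=.
    move=> [<- ->]; split => //.
    by case: leP => h; rewrite /= in_itv /= ?andbT.
  move=> [-> h]; congr (_ :: _).
  by case: b h; rewrite /= in_itv /= ?andbT => h; [|rewrite leNgt h].
by apply: measurableI => //; case: b.
Qed.

Let measurable_config_of : measurable_fun [set: measurableTypeR R] config_of.
Proof.
apply: (@measurability _ _ (measurableTypeR R) (config G) setT config_of
  (@coordinate_events R G)) => // _ [_ [i ->] <-].
rewrite setTI.
have -> : config_of @^-1` [set w | w i] =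
    \bigcup_(s in [set: seq bool]) ([set t | bits t (size s) = s] `&`
      [set t | size s = rnk i /\ lft s + p (false :: s) <= t]).
  apply/seteqP; split => t /=.
    move=> h; exists (bits t (rnk i)) => //=; rewrite size_bits.
    by split.
  by move=> [s _ [/= e [e2 h]]]; rewrite /config_of /= -e2 e.
apply: countable_bigcupT_measurable => [|s]; first exact: countableP.
apply: measurableI; first exact: measurable_bits.
have [e|ne] := pselect (size s = rnk i).
  have -> : [set t | size s = rnk i /\ lft s + p (false :: s) <= t] =
      [set` `[lft s + p (false :: s), +oo[]; last exact: measurable_itv.
  by apply/seteqP; split => t /=; rewrite in_itv /= andbT => // -[].
have -> : [set t | size s = rnk i /\ lft s + p (false :: s) <= t] = set0 by
  apply/seteqP; split => t // -[].
exact: measurable0.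
Qed.

Let unit_itv : set R := `[0, 1[%classic.
Let measurable_unit_itv : measurable unit_itv.
Proof. exact: measurable_itv. Qed.

Lemma local_limit_exists :
  exists P : probability (config G) R,
    forall A, local A -> prob (Pn n) A @[n --> \oo] --> prob P A.
Proof.
pose X : {mfun measurableTypeR R >-> config G} :=
  HB.pack config_of (isMeasurableFun.Build _ _ (measurableTypeR R) (config G) config_of
    (@measurable_config_of)).
(* This restriction of Lebesgue measure has mass one; normalizing it leaves its values unchanged and
   supplies the structure of a probability. *)
pose mu : {measure set (measurableTypeR R) -> \bar R} :=
  mrestr lebesgue_measure measurable_unit_itv.
have muT : mu setT = 1%E.
  by rewrite /mu /= /mrestr setTI lebesgue_measure_itv /= lte_fin ltr01 oppr0 adde0.
pose P : probability (config G) R := distribution (mnormalize mu point) X.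
have PE A : P A = lebesgue_measure ((config_of @^-1` A) `&` unit_itv).
  by rewrite /P /= /distribution /pushforward /mnormalize muT /= onee_eq0 /= invr1 mule1.
have Ppcyl s : prob P (pcyl s) = p s.
  rewrite /prob PE.
  have -> : config_of @^-1` pcyl s `&` unit_itv = `[lft s, lft s + p s[%classic.
    apply/seteqP; split => t /=; rewrite !in_itv /=.
      by move=> [/pcyl_config_of/eqP + t01]; rewrite bitsP.
    move=> h; have t01 : 0 <= t < 1.
      by case/andP: h => h1 h2; have [h3 h4] := lft_bounds s; apply/andP; split; lra.
    by split=> //; apply/pcyl_config_of/eqP; rewrite bitsP.
  rewrite lebesgue_measure_itv /= lte_fin.
  case: ltP => [_|]; first by rewrite -EFinB /= addrAC subrr add0r.
  by have := p_ge0 s; rewrite /=; lra.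
exists P => A lA.
have [J sA] := lA.
(* All items of [J] have rank less than [N], so a cylinder of depth [N] decides [A]; shallower
   cylinders are split in two until that depth. *)
pose N := (\max_(i <- J) rnk i).+1.
have good : forall m s, (size s + m = N)%N ->
    prob (Pn n) (A `&` pcyl s) @[n --> \oo] --> prob P (A `&` pcyl s).
  elim=> [|m IH] s sN.
    have [[w [Aw sw]]|no] := pselect (exists w, A w /\ pcyl s w).
      have -> : A `&` pcyl s = pcyl s.
        apply/setIidr => w' sw'; apply: sA Aw => i iJ.
        have ri : (rnk i < size s)%N.
          by rewrite -[size s]addn0 sN ltnS; apply: leq_bigmax_seq.
        move/forallP/(_ (Ordinal ri)) : sw; move/forallP/(_ (Ordinal ri)) : sw'.
        by rewrite /= rnkK => /eqP -> /eqP.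
      by rewrite Ppcyl; apply: L_cvg.
    have -> : A `&` pcyl s = set0.
      by rewrite -subset0 => w [Aw sw]; apply: no; exists w.
    rewrite {2}/prob measure0 /=; under eq_fun do rewrite /prob measure0 /=.
    exact: cvg_cst.
  have lb b : local (A `&` pcyl (b :: s)) by apply: localI.
  have E Q : prob Q (A `&` pcyl s) =
      prob Q (A `&` pcyl (false :: s)) + prob Q (A `&` pcyl (true :: s)).
    rewrite -probU; [|exact: local_measurable|exact: local_measurable|].
      rewrite -setIUr !pcyl_cons -setIUr; congr (prob _ (_ `&` _)).
      by apply/esym/setIidl => w _ /=; case: (w _); [right|left].
    by rewrite !pcyl_cons -subset0 => w [[_ [_ /= ->]]] [_ []].
  rewrite E; under eq_fun do rewrite E.
  by apply: cvgD; apply: IH; rewrite /= addSnnS.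
have := good N [::] (add0n _).
rewrite (_ : pcyl [::] = setT) ?setIT //.
by apply/seteqP; split => // w _; apply/forallP => -[].
Qed.

End Existence.

Section FiniteProbability.
Context d (T : measurableType d) (R : realType) (F : finType) (W : F -> R)
  (om : F -> T).
Hypothesis W_ge0 : forall f, 0 <= W f.
Hypothesis W_gt0 : 0 < \sum_f W f.

Lemma finite_probability : exists P : probability T R,
  forall A : set T, P A = ((\sum_(f | `[< A (om f) >]) W f) / \sum_f W f)%:E.
Proof.
have [f0 _] : exists f0 : F, True.
  apply: contrapT => no; move: W_gt0; rewrite big1 ?ltxx// => f.
  by case: no; exists f.
pose m (i : nat) : {measure set T -> \bar R} :=
  mscale (NngNum (W_ge0 (nth f0 (enum F) i))) (dirac (om (nth f0 (enum F) i))).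
pose mu : {measure set T -> \bar R} := msum m #|F|.
have mE A : mu A = (\sum_(f | `[< A (om f) >]) W f)%:E.
  rewrite /mu /= /msum -(big_mkord xpredT (fun i => m i A)) cardE.
  rewrite -(big_nth f0 xpredT (fun f => mscale (NngNum (W_ge0 f)) (dirac (om f)) A)).
  rewrite big_enum /= [in RHS]big_mkcond -sumEFin; apply: eq_bigr => f _.
  rewrite /mscale /= diracE /in_mem /= /in_set; case: asboolP => _ /=.
    by rewrite mule1.
  by rewrite mule0.
exists (mnormalize mu (dirac (om f0))) => A.
have mT : mu setT = (\sum_f W f)%:E.
  by rewrite mE; congr (_%:E); apply: eq_bigl => f; rewrite asboolT.
by rewrite /= /mnormalize mT eqe gt_eqF //= mE.
Qed.

End FiniteProbability.

(** * Continuous functions of configurations and weak convergence *)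

Section Product.
Context {I : choiceType}.
Local Notation X := (prod_topology (fun _ : I => bool)).
Implicit Types (w : X) (J : seq I).

(** The sets containing a cylinder around [w] form a filter. It converges to [w] in each coordinate,
    hence in the product topology, so it contains all neighbourhoods of [w]. *)
Lemma cylinder_nbhs w (U : set X) : nbhs w U ->
  exists J, forall w', (forall i, i \in J -> w i = w' i) -> U w'.
Proof.
pose F : set_system X :=
  [set U | exists J, forall w', (forall i, i \in J -> w i = w' i) -> U w'].
have FF : Filter F.
  split.
  - by exists [::].
  - move=> A B [J JA] [L LB]; exists (J ++ L) => w' ww'; split.
      by apply: JA => i iJ; apply: ww'; rewrite mem_cat iJ.
    by apply: LB => i iJ; apply: ww'; rewrite mem_cat iJ orbT.
  - by move=> A B AB [J JA]; exists J => w' /JA/AB.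
suff : F --> w by apply.
apply/cvg_sup => i; apply/cvg_image.
  by apply/seteqP; split=> // b _; exists (fun=> b).
move=> A /nbhs_singleton Awi; exists (@^~ i @^-1` A).
  exists [:: i] => w' /(_ i); rewrite mem_head => /(_ isT) e.
  by rewrite /= -e.
by apply: image_preimage; apply/seteqP; split=> // b _; exists (fun=> b).
Qed.

Lemma cylinder_open w J : open [set w' : X | forall i, i \in J -> w i = w' i].
Proof.
elim: J => [|j J IH].
  by rewrite (_ : mkset _ = setT); [exact: openT|apply/seteqP; split].
have -> : [set w' : X | forall i, i \in j :: J -> w i = w' i] =
  proj j @^-1` [set w j] `&` [set w' : X | forall i, i \in J -> w i = w' i].
  apply/seteqP; split => w' /=.
    move=> h; split; first by rewrite /proj h // mem_head.
    by move=> i iJ; apply: h; rewrite inE iJ orbT.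
  by move=> [h1 h2] i; rewrite inE => /orP[/eqP->|/h2//].
apply: openI => //; apply: (continuousP _).1; last exact: discrete_open.
exact: (@proj_continuous I (fun=> bool) j).
Qed.

Lemma bool_product_compact : compact [set: X].
Proof.
have -> : [set: X] = [set w : X | forall i, [set: bool] (w i)].
  by apply/seteqP; split.
exact: (@tychonoff I (fun=> bool) (fun=> setT) (fun=> bool_compact)).
Qed.

(** Compactness, as a near-covering property for the filter of finite lists of coordinates directed
    by inclusion, makes continuity uniform. Two errors of [e / 2] are added through the centre [v]
    of a cylinder. *)
Lemma cylinder_uniform (R : realType) (f : X -> R) (e : R) :
  continuous f -> 0 < e ->
  exists J, forall w w', (forall i, i \in J -> w i = w' i) -> `|f w - f w'| < e.
Proof.
move=> cf e0.
have near_f w : exists J, forall w', (forall i, i \in J -> w i = w' i) ->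
    `|f w - f w'| < e / 2.
  apply: (@cylinder_nbhs w [set w' | `|f w - f w'| < e / 2]).
  have e20 : 0 < e / 2 by rewrite divr_gt0.
  by have /cvgr_dist_lt/(_ _ e20) := cf w.
have [J JP] := choice near_f.
pose F : set_system (seq I) :=
  [set U | exists J0 : seq I, forall J1 : seq I, {subset J0 <= J1} -> U J1].
have FF : Filter F.
  split.
  - by exists [::].
  - move=> A B [K KA] [L LB]; exists (K ++ L) => M KLM; split.
      by apply: KA => i iK; apply: KLM; rewrite mem_cat iK.
    by apply: LB => i iL; apply: KLM; rewrite mem_cat iL orbT.
  - by move=> A B AB [K KA]; exists K => M /KA/AB.
have := (compact_near_coveringP _).1 bool_product_compact _ F
  (fun L w => forall w', (forall i, i \in L -> w i = w' i) -> `|f w - f w'| < e) FF.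
case=> [v _|L /(_ L (fun _ => id)) LP]; last first.
  by exists L => w w'; exact: LP.
exists ([set w : X | forall i, i \in J v -> v i = w i],
  [set L : seq I | {subset J v <= L}]) => /=.
  split; last by exists (J v).
  by apply: open_nbhs_nbhs; split => //; exact: cylinder_open.
move=> [w L] /= [vw JL] w' ww'.
have vw' i : i \in J v -> v i = w' i.
  by move=> iJ; rewrite vw // ww' //; exact: JL.
rewrite (_ : f w - f w' = (f v - f w') - (f v - f w)); last by ring.
rewrite (le_lt_trans (ler_normB _ _)) // [e]splitr ltrD //; exact: JP.
Qed.

End Product.

Section WeakLimit.
Context {R : realType} {G : drawn_graph R}.
Local Notation item := (edge G + vertex G)%type.
Implicit Types (J : seq item) (P : probability (config G) R) (w : config G).

Definition local_fun J (g : config G -> R) : Prop :=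
  forall w w', (forall i, i \in J -> w i = w' i) -> g w = g w'.

Lemma local_fun_measurable J (g : config G -> R) (B : set (config G)) :
  local_fun J g -> measurable B -> measurable_fun B g.
Proof.
move=> lg mB _ Y mY; apply: measurableI => //; apply: local_measurable.
by exists J => w w' ww'; rewrite /preimage /= (lg _ _ ww').
Qed.

Lemma bounded_integrable_prob P (g : config G -> R) (M : R) (B : set (config G)) :
  measurable B -> measurable_fun B g -> (forall w, `|g w| <= M) ->
  P.-integrable B (EFin \o g).
Proof.
move=> mB mg gM; apply: measurable_bounded_integrable => //.
  exact: le_lt_trans (probability_le1 P mB) (ltry 1).
exists M; split; first exact: num_real.
by move=> x Mx w _; exact: le_trans (gM w) (ltW Mx).
Qed.

Variables (Pn : nat -> probability (config G) R) (P : probability (config G) R).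
Hypothesis Pn_local : forall A : set (config G), local A ->
  prob (Pn n) A @[n --> \oo] --> prob P A.

(** Splitting [B] by the value of a coordinate freezes this coordinate in the integrand. In the end
    a constant times the probability of a local event remains. *)
Lemma local_fun_cvg J (g : config G -> R) (M : R) (B : set (config G)) :
  local_fun J g -> (forall w, `|g w| <= M) -> local B ->
  \int[Pn n]_(w in B) g w @[n --> \oo] --> \int[P]_(w in B) g w.
Proof.
elim: J g B => [|i J IH] g B lg gM lB.
  have gc : g = cst (g point) by apply/funext => w; apply: lg.
  have E (Q : probability (config G) R) :
      \int[Q]_(w in B) g w = g point * prob Q B.
    rewrite gc Rintegral_cst //; exact: local_measurable.
  rewrite E; under eq_fun do rewrite E.
  by apply: cvgM; [exact: cvg_cst|exact: Pn_local].
pose upd b w : config G := fun j => if j == i then b else w j.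
pose C b : set (config G) := [set w | w i = b].
have lC b : local (B `&` C b).
  by apply: localI => //; exists [:: i] => w w' /(_ i); rewrite mem_head /C /= => ->.
have lgb b : local_fun J (g \o upd b).
  move=> w w' ww' /=; apply: lg => j; rewrite inE /upd.
  by case: eqP => //= _; exact: ww'.
have E (Q : probability (config G) R) : \int[Q]_(w in B) g w =
   \int[Q]_(w in B `&` C true) (g \o upd true) w +
   \int[Q]_(w in B `&` C false) (g \o upd false) w.
  have BE : B = (B `&` C true) `|` (B `&` C false).
    rewrite -setIUr; apply/esym/setIidl => w _; rewrite /C /=.
    by case: (w i); [left|right].
  rewrite {1}BE Rintegral_setU.
  - congr (_ + _); apply: eq_Rintegral => w; rewrite inE => -[_ wi] /=;
      apply: lg => j _; rewrite /upd; by case: eqP => // ->.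
  - exact: local_measurable.
  - exact: local_measurable.
  - rewrite -BE; apply: (@bounded_integrable_prob _ _ M) => //.
      exact: local_measurable.
    by apply: local_fun_measurable lg _; exact: local_measurable.
  - apply/eqP; rewrite -subset0 => w [[_ w1] [_]].
    by rewrite /C /= in w1 *; rewrite w1.
rewrite E; under eq_fun do rewrite E.
by apply: cvgD; apply: IH => //; move=> w; exact: gM.
Qed.

Lemma weak_limit_local : weak_limit Pn P.
Proof.
move=> f cf [M fM].
(* Deleting the items outside [J] makes the integrand local at a small uniform cost. *)
pose cut J (w : config G) : config G := fun i => (i \in J) && w i.
have cutP e : 0 < e -> exists J, forall w, `|f w - f (cut J w)| < e.
  move=> e0; have [J JP] := cylinder_uniform cf e0.
  by exists J => w; apply: JP => i iJ; rewrite /cut iJ.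
have lcut J : local_fun J (f \o cut J).
  move=> w w' ww' /=; congr f; apply/funext => i; rewrite /cut.
  by case: (boolP (i \in J)) => //= /ww'.
(* The sigma-algebra comes from the coordinates and not from the topology, so measurability is
   obtained from a pointwise limit of local functions. *)
have mf : measurable_fun [set: config G] (f : config G -> R).
  have [J JP] := choice (fun n : nat => cutP n.+1%:R^-1 ltac:(by rewrite invr_gt0)).
  apply: (measurable_realfun.measurable_fun_cvg (h := fun n => f \o cut (J n))).
    by move=> n; exact: local_fun_measurable (lcut _) _.
  move=> w _; apply/cvgrPdist_lt => e e0.
  have := @near_infty_natSinv_lt R (PosNum e0); apply: filterS => n /= ne.
  exact: lt_trans (JP n w) ne.
have intf (Q : probability (config G) R) : Q.-integrable setT (EFin \o f).
  exact: (@bounded_integrable_prob _ _ M).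
apply/cvgrPdist_lt => e e0.
have e40 : 0 < e / 4 by rewrite divr_gt0.
have [J JP] := cutP _ e40.
have close (Q : probability (config G) R) :
    `|\int[Q]_w f w - \int[Q]_w (f \o cut J) w| <= e / 4.
  have intc : Q.-integrable setT (EFin \o (f \o cut J)).
    apply: (@bounded_integrable_prob _ _ M) => //.
      exact: local_fun_measurable (lcut _) _.
    by move=> w; exact: fM.
  have intfQ := intf Q; rewrite -RintegralB //.
  have intd : Q.-integrable setT (EFin \o (fun w => f w - (f \o cut J) w)).
    have := integrableB measurableT (intf Q) intc.
    by apply: eq_integrable => // w _ /=; rewrite EFinB.
  apply: le_trans (le_normr_Rintegral _ intd) _ => //.
  apply: le_trans (_ : \int[Q]_(w in setT) (e / 4) <= _).
    apply: le_Rintegral => //.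
    - have := integrable_abse intd.
      by apply: eq_integrable.
    - by apply: (@bounded_integrable_prob _ _ (e / 4)) => // w; rewrite gtr0_norm.
    - by move=> w _; exact/ltW/JP.
  by rewrite Rintegral_cst // [fine _](probT Q) mulr1.
have fcM w : `|(f \o cut J) w| <= M by exact: fM.
have lT : local [set: config G] by exact: (local_const True).
have /cvgrPdist_lt/(_ _ e40) cc := local_fun_cvg (lcut J) fcM lT.
near=> n; have ne : `|\int[P]_w (f \o cut J) w - \int[Pn n]_w (f \o cut J) w| < e / 4.
  by near: n; exact: cc.
have := close P; have := close (Pn n); move: ne.
move: (\int[P]_w f w) (\int[Pn n]_w f w) => a b.
move: (Rintegral _ _ _) (Rintegral _ _ _) => c d.
rewrite !ltr_norml !ler_norml => /andP[? ?] /andP[? ?] /andP[? ?].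
by apply/andP; split; lra.
Unshelve. all: by end_near. Qed.

End WeakLimit.

(** * Finite subgraphs *)

Lemma finite_uniq_seq (T : eqType) (A : set T) :
  finite_set A -> exists2 s : seq T, uniq s & A = [set` s].
Proof.
move=> /finite_seqP[s ->]; exists (undup s); first exact: undup_uniq.
by apply/seteqP; split => x /=; rewrite mem_undup.
Qed.

Lemma ler_sum_uniq (R : numDomainType) (T : eqType) (s t : seq T) (F : T -> R) :
  uniq s -> uniq t -> {subset s <= t} -> (forall x, 0 <= F x) ->
  \sum_(x <- s) F x <= \sum_(x <- t) F x.
Proof.
move=> us ut st F0; rewrite [leRHS](bigID (mem s)) /=.
have -> : \sum_(x <- s) F x = \sum_(x <- t | x \in s) F x.
  rewrite -[RHS]big_filter; apply: perm_big; apply: uniq_perm => //.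
    exact: filter_uniq.
  by move=> x; rewrite mem_filter; case: (boolP (x \in s)) => // /st ->.
by rewrite lerDl sumr_ge0.
Qed.

Section FiniteSubgraph.
Context {R : realType} {G : drawn_graph R} (k : R).
Implicit Types (H : set (vertex G) * set (edge G)).
Implicit Types (a b : vertex G) (e : edge G).

Lemma presentation_exists H : finite_subgraph H ->
  exists n N (v : 'I_n -> vertex G) (it : 'I_N -> edge G + vertex G),
    presentation H v it.
Proof.
move=> [/finite_uniq_seq[A uA HA] /finite_uniq_seq[E uE HE] Hsub].
pose s : seq (edge G + vertex G) := [seq inl e | e <- E] ++ [seq inr a | a <- A].
have us : uniq s.
  rewrite cat_uniq !map_inj_uniq ?uA ?uE ?andbT /=; first last.
  - by move=> ? ? [].
  - by move=> ? ? [].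
  by apply/hasPn => _ /mapP[a _ ->]; apply/negP => /mapP[].
exists (size A), (size s), (tnth (in_tuple A)), (tnth (in_tuple s)).
split=> //.
- exact/tuple_uniqP.
- exact/tuple_uniqP.
- move=> a; rewrite HA /=; split.
    by move=> aA; have /tnthP[i ->] : a \in in_tuple A by []; exists i.
  by move=> [i <-]; exact: mem_tnth.
- move=> i; transitivity (i \in s).
    rewrite mem_cat; case: i => [e|a] /=.
      rewrite HE /= mem_map; last by move=> ? ? [].
      by split=> [->//|/orP[//|/mapP[]]].
    rewrite HA /= orbC mem_map; last by move=> ? ? [].
    by split=> [->//|/orP[//|/mapP[]]].
  split; first by move=> iS; have /tnthP[j ->] : i \in in_tuple s by []; exists j.
  by move=> [j <-]; exact: mem_tnth.
Qed.

Hypothesis sG : simple_graph G.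
Hypothesis incident_finite : forall a, finite_set [set e | incident e a].
Hypothesis rho_gt0 : forall e, 0 < rho k e.
Hypothesis mass_gt0 : forall a, 0 < mass2 k a.

Local Notation c := (@item_weight R G k).

Let c_gt0 i : 0 < c i.
Proof. by case: i => [e|a] /=. Qed.

Section Presentation.
Context H n N (v : 'I_n -> vertex G) (it : 'I_N -> edge G + vertex G).
Hypothesis pr : presentation H v it.

Local Notation L := (lapmx v it c).
Local Notation W f := (\prod_x c (it (f x))).

Lemma weight_gt0 (f : {ffun 'I_n -> 'I_N}) : 0 < W f.
Proof. by apply: prodr_gt0 => x _. Qed.

(** The witness is the forest without edges, in which every vertex is a root; it makes the partition
    function positive. *)
Lemma good_exists : exists f, good v it f.
Proof.
have wr : rooted_spanning_forest H (fun i => if i is inr a then `[< H.1 a >] else false).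
  split.
  - by [].
  - by move=> a /asboolP.
  - case=> [|a [|b s]] //= _ _; apply/negP => /andP[/asboolP[e]]; by [].
  - move=> a Ha; exists a; split; first by split; [exact/asboolP|exact: connected_refl].
    move=> b [_ [[|b' s] /=]]; first by move=> _ <-.
    by move=> /andP[/asboolP[]].
by have [f gf _] := forest_pointer sG pr wr; exists f.
Qed.

Lemma partition_functionE : partition_function k H = \det L.
Proof.
rewrite /partition_function (det_lapmx sG pr).
have := forest_sum sG pr k setT.
rewrite (_ : [set w | _ /\ setT w] = [set w | rooted_spanning_forest H w]).
  by move=> ->; apply: eq_bigl => f; rewrite asboolT ?andbT.
by apply/seteqP; split => w /= => [[]|].
Qed.

Lemma det_lapmx_gt0 : 0 < \det L.
Proof.
rewrite (det_lapmx sG pr); have [f gf] := good_exists.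
rewrite (bigD1 f) //= ltr_pwDl ?weight_gt0//.
by apply: sumr_ge0 => f' _; exact/ltW/weight_gt0.
Qed.

Lemma boltzmann_exists : exists P : probability (config G) R, boltzmann k H P.
Proof.
pose V f := if good v it f then W f else 0.
have V0 f : 0 <= V f by rewrite /V; case: ifP => // _; exact/ltW/weight_gt0.
have ZE : \sum_f V f = \det L.
  by rewrite (det_lapmx sG pr) [RHS]big_mkcond.
have Z0 : 0 < \sum_f V f by rewrite ZE det_lapmx_gt0.
have [P PE] := finite_probability (forest_of it : _ -> config G) V0 Z0.
exists P => A mA; rewrite PE ZE partition_functionE (forest_sum sG pr).
suff -> : \sum_(f | `[< A (forest_of it f) >]) V f =
  \sum_(f | good v it f && `[< A (forest_of it f) >]) W f by [].
by rewrite [RHS]big_mkcondl.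
Qed.

Variable P : probability (config G) R.
Hypothesis bP : boltzmann k H P.

Lemma boltzmannE A : measurable A ->
  prob P A = (\sum_(f | good v it f && `[< A (forest_of it f) >]) W f) / \det L.
Proof.
by move=> mA; rewrite /prob bP //= partition_functionE (forest_sum sG pr).
Qed.

Lemma boltzmann_present p (J : 'I_p -> edge G + vertex G) : injective J ->
  (forall l, in_subgraph H (J l)) ->
  prob P (present [seq J l | l <- enum 'I_p]) =
  \det (\matrix_(l, l') transfer c (green_ext v it c) (J l) (J l')).
Proof.
move=> Ji JH; rewrite boltzmannE; last exact: measurable_present.
rewrite -[RHS](mulKf (lt0r_neq0 det_lapmx_gt0)).
rewrite -(transfer_forest_sum sG pr Ji JH (lt0r_neq0 det_lapmx_gt0)) mulrC.
congr (_ * _); apply: eq_bigl => f; congr (_ && _).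
apply/asboolP/forallP => [/allP h l|h].
  by apply: h; rewrite map_f ?mem_enum.
by apply/allP => _ /mapP[l _ ->].
Qed.

Lemma boltzmann_root x r :
  let A := [set w : config G | roots_of w (v r) /\
                               connected_by (edges_of w) (v x) (v r)] in
  measurable A ->
  prob P A = mass2 k (v r) * green_ext v it c (v x) (v r).
Proof.
move=> A mA; rewrite boltzmannE // (green_extE pr).
rewrite -[RHS](mulKf (lt0r_neq0 det_lapmx_gt0)).
rewrite (lapmx_inv sG pr x r (lt0r_neq0 det_lapmx_gt0)) mulrC.
congr (_ * _); apply: eq_bigl => f; case: (boolP (good v it f)) => //= /andP[va _].
by apply/asboolP/idP => /(forest_ends sG pr x r va).
Qed.

Lemma green_ext_sym a b : green_ext v it c a b = green_ext v it c b a.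
Proof.
rewrite /green_ext exchange_big; apply: eq_bigr => x _; apply: eq_bigr => y _.
rewrite [(v x == b)%:R * _]mulrC; congr (_ * _).
have Ls : L^T = L.
  by apply/matrixP => x' y'; rewrite !mxE; apply: eq_bigr => i _; rewrite -mulrA mulrCA mulrC -!mulrA mulrCA.
by rewrite -[in LHS]Ls -trmx_inv mxE.
Qed.

(* The rows of the Laplacian pair the incidence of x with the increments. *)
Lemma lapmx_row (phi : vertex G -> R) x :
  \sum_y L x y * phi (v y) =
  \sum_(t < N) c (it t) * incidence (it t) (v x) * pairing phi (it t).
Proof.
under eq_bigr => y _ do rewrite mxE mulr_suml.
rewrite exchange_big; apply: eq_bigr => t _.
rewrite (pairingE pr); last by apply/(items_im pr); exists t.
by rewrite mulr_sumr; apply: eq_bigr => y _; rewrite mulrA.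
Qed.

Lemma sum_items_root (F : R) x :
  \sum_(t < N) (if it t == inr (v x) then F else 0) = F.
Proof.
have [t0 e0] : exists t, it t = inr (v x).
  by apply/(items_im pr)/(vertices_im pr); exists x.
rewrite (bigD1 t0) //= e0 eqxx big1 ?addr0// => t tt0.
by rewrite -e0 (inj_eq (items_inj pr)) (negbTE tt0).
Qed.

(** Only for interior vertices: the subgraph inherits the masses of the whole graph but loses the
    edges leaving it. *)
Lemma lapmx_laplacian (phi : vertex G -> R) x :
  (forall e, incident e (v x) -> H.2 e) ->
  \sum_y L x y * phi (v y) = laplacian k phi (v x).
Proof.
move=> inc; rewrite lapmx_row /laplacian -(sum_items_root (mass2 k (v x) * phi (v x)) x).
rewrite (@fsbig_pmap _ _ _ _ _ _ (enum 'I_N)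
  (fun t => if it t is inl e then (if `[< incident e (v x) >] then Some e else None)
            else None)); first last.
- move=> e; split.
    move=> /[dup] ie /inc He; have [t te] := (items_im pr (inl e)).1 He.
    by exists t; [rewrite mem_enum|rewrite te asboolT].
  by move=> [t _]; case: (it t) => [e'|//]; case: asboolP => // ie [<-].
- move=> t t' e; case et: (it t) => [e1|//]; case: asboolP => // _ [ee].
  case et': (it t') => [e2|//]; case: asboolP => // _ [ee'].
  by apply: (items_inj pr); rewrite et et' ee ee'.
- exact: enum_uniq.
rewrite big_enum -big_split; apply: eq_bigr => t _ /=.
case: (it t) => [e|b] /=.
  rewrite addr0; case: asboolP => [ie|nie] /=; last first.
    by move/(incidence_edge sG)/negP/negPn/eqP : nie => /= ->; rewrite mulr0 mul0r.
  have [h1 h2] := sG; have := h1 e.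
  case: (other_endP ie) => -[<- <-].
    by rewrite eqxx eq_sym; case: eqP => // _ _; rewrite subr0 mulr1.
  by rewrite eqxx; case: eqP => // _ _; rewrite /= sub0r mulrN1 mulNr -mulrN opprB.
rewrite add0r; case: (b =P v x) => [->|nb]; first by rewrite eqxx mulr1.
by rewrite mulr0 mul0r; case: eqP => // -[].
Qed.

Lemma green_ext_laplacian x r : (forall e, incident e (v x) -> H.2 e) ->
  laplacian k (fun a => green_ext v it c a (v r)) (v x) = (x == r)%:R.
Proof.
move=> inc; rewrite -lapmx_laplacian //.
have uL : L \in unitmx by rewrite unitmxE unitfE lt0r_neq0 // det_lapmx_gt0.
have /matrixP/(_ x r) := mulmxV uL; rewrite !mxE => <-.
by apply: eq_bigr => y _; rewrite (green_extE pr) mxE.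
Qed.

(** The Laplacian of the subgraph sends the constant 1 to the mass, as edges see no increment; it
    remains to invert. *)
Lemma green_ext_row_sum x :
  \sum_r mass2 k (v r) * green_ext v it c (v x) (v r) = 1.
Proof.
have uL : L \in unitmx by rewrite unitmxE unitfE lt0r_neq0 // det_lapmx_gt0.
have L1 : L *m (const_mx 1 : 'cV_n) = \col_y mass2 k (v y).
  apply/colP => y; rewrite !mxE.
  transitivity (\sum_z L y z * 1); first by apply: eq_bigr => z _; rewrite [const_mx 1 _ _]mxE.
  rewrite (lapmx_row (fun=> 1) y) -[RHS](sum_items_root _ y); apply: eq_bigr => t _.
  case: (it t) => [e|b] /=; first by rewrite subrr mulr0.
  case: (b =P v y) => [->|nb]; first by rewrite eqxx !mulr1.
  by rewrite mulr0 mul0r; case: eqP => // -[].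
have /colP/(_ x) := congr1 (mulmx (invmx L)) L1.
rewrite mulKmx // mxE => ->; rewrite mxE; apply: eq_bigr => r _.
by rewrite (green_extE pr) mxE mulrC.
Qed.

Lemma energyE (phi : vertex G -> R) :
  \sum_x phi (v x) * (\sum_y L x y * phi (v y)) =
  \sum_(t < N) c (it t) * pairing phi (it t) ^+ 2.
Proof.
under eq_bigr => x _ do rewrite lapmx_row mulr_sumr.
rewrite exchange_big; apply: eq_bigr => t _.
have it_t : in_subgraph H (it t) by apply/(items_im pr); exists t.
rewrite expr2 [X in c _ * (X * _)](pairingE pr) // mulr_suml mulr_sumr.
by apply: eq_bigr => x _; ring.
Qed.

Lemma mass_le_energy (phi : vertex G -> R) :
  \sum_x mass2 k (v x) * phi (v x) ^+ 2 <=
  \sum_(t < N) c (it t) * pairing phi (it t) ^+ 2.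
Proof.
under eq_bigr => x _ do rewrite -(sum_items_root (mass2 k (v x) * phi (v x) ^+ 2) x).
rewrite exchange_big; apply: ler_sum => t _.
have ge0 : 0 <= c (it t) * pairing phi (it t) ^+ 2.
  by rewrite mulr_ge0 ?sqr_ge0 // ltW.
case: (boolP [exists x, it t == inr (v x)]) => [/existsP[x /eqP e]|].
  rewrite (bigD1 x) //= e eqxx big1 ?addr0 //= => y yx.
  by case: eqP => // -[] /(vertices_inj pr) xy; rewrite xy eqxx in yx.
by rewrite negb_exists => /forallP no; rewrite big1 // => x _; rewrite (negbTE (no x)).
Qed.

(** An l^2 bound that does not depend on the subgraph: the energy gives m0 |u|^2 <= <u, h>, and 2 m0
    <u, h> <= m0^2 |u|^2 + |h|^2. *)
Lemma finite_solver (h : vertex G -> R) (m0 : R) :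
  0 < m0 -> (forall a, m0 <= mass2 k a) ->
  exists u : vertex G -> R,
    (forall x, (forall e, incident e (v x) -> H.2 e) ->
       laplacian k u (v x) = h (v x)) /\
    (forall a, ~ H.1 a -> u a = 0) /\
    m0 ^+ 2 * \sum_x u (v x) ^+ 2 <= \sum_x h (v x) ^+ 2.
Proof.
move=> m00 m0m.
have uL : L \in unitmx by rewrite unitmxE unitfE lt0r_neq0 // det_lapmx_gt0.
pose u a := \sum_r green_ext v it c a (v r) * h (v r).
have Lu x : \sum_y L x y * u (v y) = h (v x).
  have /colP/(_ x) := mulKVmx uL (\col_y h (v y)); rewrite !mxE => <-.
  apply: eq_bigr => y _; congr (_ * _); rewrite mxE.
  by apply: eq_bigr => r _; rewrite (green_extE pr) mxE.
exists u; split; first by move=> x inc; rewrite -lapmx_laplacian.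
split.
  move=> a Ha; rewrite /u big1 // => r _; rewrite /green_ext big1 ?mul0r // => x _.
  rewrite big1 // => y _; case: eqP => [va|_]; last by rewrite !mul0r.
  by case: Ha; apply/(vertices_im pr); exists x.
have := mass_le_energy u; rewrite -energyE.
under [X in _ <= X -> _]eq_bigr => x _ do rewrite Lu.
move=> en.
have h1 : m0 * \sum_x u (v x) ^+ 2 <= \sum_x u (v x) * h (v x).
  apply: le_trans en; rewrite mulr_sumr; apply: ler_sum => x _.
  by rewrite ler_wpM2r ?sqr_ge0.
have h2 : (m0 * \sum_x u (v x) * h (v x)) *+ 2 <=
    m0 ^+ 2 * \sum_x u (v x) ^+ 2 + \sum_x h (v x) ^+ 2.
  rewrite mulr_sumr mulr_sumr -sumrMnl -big_split; apply: ler_sum => x _ /=.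
  have := sqr_ge0 (m0 * u (v x) - h (v x)); rewrite sqrrB exprMn.
  rewrite -mulrA; lra.
have h3 : m0 * (m0 * \sum_x u (v x) ^+ 2) <= m0 * \sum_x u (v x) * h (v x).
  by rewrite ler_pM2l.
move: h2 h3; rewrite mulrA -expr2 mulr2n; lra.
Qed.

End Presentation.
End FiniteSubgraph.

(** * Bounded solutions of the massive Laplace equation *)

Lemma cvg_sumr (R : realType) (I : Type) (r : seq I) (P : pred I)
    (u : I -> nat -> R) (l : I -> R) :
  (forall i, P i -> u i n @[n --> \oo] --> l i) ->
  \sum_(i <- r | P i) u i n @[n --> \oo] --> \sum_(i <- r | P i) l i.
Proof.
move=> ul; elim: r => [|i r IH].
  by rewrite big_nil; under eq_fun do rewrite big_nil; exact: cvg_cst.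
rewrite big_cons; under eq_fun do rewrite big_cons.
by case: ifP => // Pi; apply: cvgD => //; exact: ul.
Qed.

Section Potential.
Context {R : realType} {G : drawn_graph R} (k : R).
Implicit Types (a b x y : vertex G) (e : edge G) (f g h u : vertex G -> R).

Hypothesis incident_finite : forall a : vertex G, finite_set [set e | incident e a].
Hypothesis rho_gt0 : forall e : edge G, 0 < rho k e.
Variables (m0 K : R).
Hypothesis m0_gt0 : 0 < m0.
Hypothesis mass_ge : forall a : vertex G, m0 <= mass2 k a.
Hypothesis K_ge0 : 0 <= K.
Hypothesis rho_le : forall a : vertex G,
  \sum_(e \in [set e | incident e a]) rho k e <= K * mass2 k a.

Lemma incident_seq : exists s : vertex G -> seq (edge G),
  forall a, uniq (s a) /\ [set e | incident e a] = [set` s a].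
Proof.
have H (a : vertex G) : exists s : seq (edge G),
    uniq s /\ [set e | incident e a] = [set` s].
  by have [s us e] := finite_uniq_seq (incident_finite a); exists s.
by have [s sP] := choice H; exists s.
Qed.

Let inc := projT1 (cid incident_seq).
Let inc_uniq a : uniq (inc a). Proof. exact: (projT2 (cid incident_seq) a).1. Qed.
Let incE a : [set e | incident e a] = [set` inc a].
Proof. exact: (projT2 (cid incident_seq) a).2. Qed.

Let mass_gt0 a : 0 < mass2 k a. Proof. exact: lt_le_trans (mass_ge a). Qed.

Let lapE f a : laplacian k f a =
  \sum_(e <- inc a) rho k e * (f a - f (other_end e a)) + mass2 k a * f a.
Proof. by rewrite /laplacian incE -fsbig_seq. Qed.

Let rho_le' a : \sum_(e <- inc a) rho k e <= K * mass2 k a.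
Proof. by have := rho_le a; rewrite incE -fsbig_seq. Qed.

Let q := K / (1 + K).

Let q_ge0 : 0 <= q. Proof. by rewrite divr_ge0 // addr_ge0. Qed.
Let q_lt1 : q < 1. Proof. by rewrite ltr_pdivrMr ?mul1r ?ltrDr// ltr_wpDr. Qed.

Lemma laplacianB f g a : laplacian k (fun x => f x - g x) a =
  laplacian k f a - laplacian k g a.
Proof.
rewrite !lapE opprD addrACA -sumrB -mulrBr; congr (_ + _).
by apply: eq_bigr => e _; rewrite -mulrBr; congr (_ * _); ring.
Qed.

Lemma laplacianZ (t : R) f a : laplacian k (fun x => t * f x) a = t * laplacian k f a.
Proof.
rewrite !lapE mulrDr mulr_sumr mulrCA; congr (_ + _).
by apply: eq_bigr => e _; rewrite -mulrBr mulrCA.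
Qed.

(* [rho_le] makes the averaging part of the Laplacian at most q times its
   diagonal part. *)
Lemma laplacian_contraction f a (M : R) : 0 <= M ->
  laplacian k f a = 0 ->
  (forall e, incident e a -> `|f (other_end e a)| <= M) -> `|f a| <= q * M.
Proof.
move=> M0 Lf fM; pose S := \sum_(e <- inc a) rho k e.
have S0 : 0 <= S by apply: sumr_ge0 => e _; exact/ltW.
have fM' : S * M >= `|\sum_(e <- inc a) rho k e * f (other_end e a)|.
  rewrite mulr_suml; apply: le_trans (ler_norm_sum _ _ _) _.
  rewrite big_seq [leRHS]big_seq; apply: ler_sum => e ea.
  rewrite normrM gtr0_norm //; apply: ler_wpM2l; first exact: ltW.
  by apply: fM; have : [set` inc a] e by []; rewrite -incE.
have E : (S + mass2 k a) * f a = \sum_(e <- inc a) rho k e * f (other_end e a).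
  move: Lf; rewrite lapE; under eq_bigr do rewrite mulrBr.
  rewrite sumrB -mulr_suml -/S => /eqP; rewrite addrAC subr_eq0 => /eqP <-.
  by rewrite mulrDl.
have D0 : 0 < S + mass2 k a by rewrite ltr_wpDl.
have H1 : (S + mass2 k a) * `|f a| <= S * M by rewrite -(gtr0_norm D0) -normrM E.
have K1 : 0 < 1 + K by rewrite ltr_wpDr.
have H2 : (1 + K) * S <= K * (S + mass2 k a).
  by rewrite mulrDl mul1r mulrDr addrC lerD2l rho_le'.
rewrite -(ler_pM2l D0) -(ler_pM2l K1); apply: le_trans (_ : (1 + K) * (S * M) <= _).
  by rewrite ler_pM2l.
have -> : (1 + K) * ((S + mass2 k a) * (q * M)) = K * (S + mass2 k a) * M.
  by rewrite /q; field; exact: lt0r_neq0.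
by rewrite mulrA ler_wpM2r.
Qed.

Let geom (M : R) : q ^+ n * M @[n --> \oo] --> (0 : R).
Proof.
rewrite -(mul0r M); apply: cvgM; last exact: cvg_cst.
by apply: cvg_expr; rewrite ger0_norm.
Qed.

Lemma bounded_harmonic f (M : R) : (forall a, `|f a| <= M) ->
  (forall a, laplacian k f a = 0) -> forall a, f a = 0.
Proof.
move=> fM Lf a; have M0 : 0 <= M by apply: le_trans (fM a).
have H n : forall b, `|f b| <= q ^+ n * M.
  elim: n => [|n IH] b; first by rewrite mul1r.
  rewrite exprS -mulrA; apply: laplacian_contraction => //.
  by rewrite mulr_ge0 // exprn_ge0.
apply/eqP; rewrite -normr_le0; have /cvg_lim <- // := geom M.
apply: limr_ge; first by apply/cvg_ex; exists 0; exact: geom.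
by apply: nearW => n; exact: H.
Qed.

Lemma bounded_unique f g (M : R) : (forall a, `|f a| <= M) -> (forall a, `|g a| <= M) ->
  (forall a, laplacian k f a = laplacian k g a) -> f = g.
Proof.
move=> fM gM fg; apply/funext => a; apply/eqP; rewrite -subr_eq0; apply/eqP.
apply: (@bounded_harmonic (fun x => f x - g x) (M + M)) => b.
  by rewrite (le_trans (ler_normB _ _)) // lerD.
by rewrite laplacianB fg subrr.
Qed.

Lemma laplacian_cvg (u : nat -> vertex G -> R) f a :
  (forall b, u n b @[n --> \oo] --> f b) ->
  laplacian k (u n) a @[n --> \oo] --> laplacian k f a.
Proof.
move=> uf; rewrite lapE; under eq_fun do rewrite lapE.
apply: cvgD; last by apply: cvgM; [exact: cvg_cst|exact: uf].
apply: cvg_sumr => e _; apply: cvgM; first exact: cvg_cst.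
by apply: cvgB; exact: uf.
Qed.

(** The difference of two members eventually satisfies the homogeneous equation at a given vertex,
    and then at the vertices around it. Each further layer gains a factor [q] at the centre, which
    makes the sequence Cauchy there. *)
Lemma bounded_solutions_cvg (u : nat -> vertex G -> R) h (M : R) :
  (forall n a, `|u n a| <= M) ->
  (forall a, \forall n \near \oo, laplacian k (u n) a = h a) ->
  exists f, [/\ (forall a, u n a @[n --> \oo] --> f a), (forall a, `|f a| <= M)
    & (forall a, laplacian k f a = h a)].
Proof.
move=> uM uh.
have H j : forall a, exists N, forall n m, (N <= n)%N -> (N <= m)%N ->
    `|u n a - u m a| <= q ^+ j * (M + M).
  elim: j => [|j IH] a.
    exists 0%N => n m _ _; rewrite mul1r.
    by rewrite (le_trans (ler_normB _ _)) // lerD.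
  have [N NP] := choice IH; have [N0 _ N0P] := uh a.
  exists (maxn N0 (\max_(e <- inc a) N (other_end e a))) => n m.
  rewrite !geq_max => /andP[n0 nN] /andP[m0' mN].
  rewrite exprS -mulrA; apply: (@laplacian_contraction (fun x => u n x - u m x)).
  - by apply: le_trans (NP a _ _ (leqnn _) (leqnn _)); rewrite normr_ge0.
  - by rewrite laplacianB !N0P ?subrr.
  move=> e; rewrite -/([set e | incident e a] e) incE /= => ea.
  have le : (N (other_end e a) <= \max_(e <- inc a) N (other_end e a))%N.
    exact: (leq_bigmax_seq _ ea isT).
  by apply: NP; apply: leq_trans le _.
have cu a : cvgn (fun n => u n a).
  apply/cauchy_cvgP/cauchy_exP => e e0.
  have /cvgrPdist_lt/(_ _ e0) [j _ jP] := geom (M + M).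
  have [N NP] := H j a; exists (u N a); exists N => // n /= Nn.
  rewrite /ball /=; apply: le_lt_trans (NP _ _ (leqnn _) Nn) _.
  by have := jP j (leqnn _); rewrite /= sub0r normrN; apply: le_lt_trans; exact: ler_norm.
pose f a := limn (fun n => u n a).
have uf a : u n a @[n --> \oo] --> f a by exact: cu.
exists f; split=> // a.
  have /cvg_lim <- // : `|u n a| @[n --> \oo] --> `|f a| by apply: cvg_norm; exact: uf.
  by apply: limr_le; [apply: is_cvg_norm; exact: cu|exact: nearW].
have := laplacian_cvg (a := a) uf.
have : laplacian k (u n) a @[n --> \oo] --> h a.
  by apply: cvg_near_cst; apply: filterS (uh a) => n ->.
by move=> c1 c2; apply: cvg_unique c2 c1.
Qed.

Lemma ell2_sum_le f (B : R) :
  (forall s : seq (vertex G), uniq s -> \sum_(x <- s) f x ^+ 2 <= B) -> ell2 f.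
Proof.
move=> fB; rewrite /ell2; apply: le_lt_trans (ltry B).
apply: ge_ereal_sup => _ [X [finX _] <-].
have [s us ->] := finite_uniq_seq finX.
by rewrite -fsbig_seq // sumEFin lee_fin fB.
Qed.

Lemma ell2_sum_ge f : ell2 f -> exists2 B : R, 0 <= B &
  forall s : seq (vertex G), uniq s -> \sum_(x <- s) f x ^+ 2 <= B.
Proof.
rewrite /ell2 => lf.
have lf0 : (0 <= \esum_(x in [set: vertex G]) (f x ^+ 2)%:E)%E.
  by apply: esum_ge0 => x _; rewrite lee_fin sqr_ge0.
exists (fine (\esum_(x in [set: vertex G]) (f x ^+ 2)%:E)); first exact: fine_ge0.
move=> s us; rewrite -lee_fin fineK ?ge0_fin_numE //.
apply: ereal_sup_ubound; exists [set` s]; first by split.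
by rewrite -fsbig_seq // sumEFin.
Qed.

Lemma ell2_bounded f : ell2 f -> exists M : R, forall a, `|f a| <= M.
Proof.
move=> /ell2_sum_ge[B B0 HB]; exists (1 + B) => a.
have := HB [:: a] isT; rewrite big_seq1 -real_normK ?num_real // => h.
have := normr_ge0 (f a); have := sqr_ge0 (`|f a| - 1); rewrite sqrrB expr1n mulr1; lra.
Qed.

Hypothesis sG : simple_graph G.
Variable Gn : nat -> set (vertex G) * set (edge G).
Hypothesis exG : exhaustion Gn.

Lemma exhaustion_mono m n : (m <= n)%N ->
  (Gn m).1 `<=` (Gn n).1 /\ (Gn m).2 `<=` (Gn n).2.
Proof.
have [_ mono _ _] := exG; elim: n => [|n IH]; first by rewrite leqn0 => /eqP->; split.
rewrite leq_eqVlt => /orP[/eqP ->|]; first by split.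
rewrite ltnS => /IH[IH1 IH2].
by have [m1 m2] := mono n; split=> [x /IH1/m1//|e /IH2/m2].
Qed.

Lemma exhaustion_in_subgraph (J : seq (edge G + vertex G)) :
  \forall n \near \oo, forall i, i \in J -> in_subgraph (Gn n) i.
Proof.
have [_ _ exV exE] := exG.
elim: J => [|i J [N _ NP]]; first by apply: nearW.
have [n ni] : exists n, in_subgraph (Gn n) i by case: i => [e|a]; [exact: exE|exact: exV].
exists (maxn N n) => // m /=; rewrite geq_max => /andP[Nm nm] j.
rewrite inE => /orP[/eqP ->|]; last exact: NP.
by have := exhaustion_mono nm; case: i ni => [e|a] /= h [h1 h2]; [exact: h2|exact: h1].
Qed.

Lemma exhaustion_incident a : \forall n \near \oo,
  (Gn n).1 a /\ forall e, incident e a -> (Gn n).2 e.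
Proof.
have := exhaustion_in_subgraph (inr a :: [seq inl e | e <- inc a]).
apply: filterS => n nP; split; first by have := nP (inr a) (mem_head _ _).
move=> e ea; apply: (nP (inl e)); rewrite inE /= map_f //.
by have : [set e | incident e a] e by []; rewrite incE.
Qed.

(** The solutions in finite subgraphs share an l^2 bound, hence a sup bound, and converge pointwise.
    The l^2 bound passes to the limit on finite sets of vertices. *)
Lemma ell2_solution h : ell2 h -> exists2 u, ell2 u & laplacian k u = h.
Proof.
move=> /ell2_sum_ge[B B0 hB]; have [finG _ _ _] := exG.
pose B' := B / m0 ^+ 2.
have H n : exists u, (forall a, (Gn n).1 a -> (forall e, incident e a -> (Gn n).2 e) ->
      laplacian k u a = h a) /\
    (forall s : seq (vertex G), uniq s -> \sum_(x <- s) u x ^+ 2 <= B').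
  have [p [N [v [it pr]]]] := presentation_exists (finG n).
  have [u [uL [u0 uB]]] := finite_solver sG rho_gt0 mass_gt0 pr h m0_gt0 mass_ge.
  exists u; split; first by move=> a /(vertices_im pr)[x <-]; exact: uL.
  have uv : uniq (map v (enum 'I_p)).
    by rewrite map_inj_uniq ?enum_uniq //; exact: vertices_inj pr.
  have E (f : vertex G -> R) : \sum_(x : 'I_p) f (v x) = \sum_(a <- (map v (enum 'I_p))) f a.
    by rewrite big_map big_enum.
  move=> s us; rewrite (bigID (mem (map v (enum 'I_p)))) /=.
  rewrite [X in _ + X]big1 ?addr0 => [|a na]; last first.
    rewrite u0 ?expr0n //; move/negP : na; apply: contra_not.
    by move=> /(vertices_im pr)[x <-]; rewrite map_f ?mem_enum.
  rewrite -big_filter; apply: le_trans (_ : \sum_(x : 'I_p) u (v x) ^+ 2 <= _).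
    rewrite (E (fun a => u a ^+ 2)); apply: ler_sum_uniq => //.
    - exact: filter_uniq.
    - by move=> a; rewrite mem_filter => /andP[].
    - by move=> a; exact: sqr_ge0.
  rewrite /B' ler_pdivlMr ?exprn_gt0 // mulrC; apply: le_trans uB _.
  by rewrite (E (fun a => h a ^+ 2)); exact: hB.
have [u uP] := choice H.
have uM n a : `|u n a| <= 1 + B'.
  have := (uP n).2 [:: a] isT; rewrite big_seq1 -real_normK ?num_real // => hh.
  have := normr_ge0 (u n a); have := sqr_ge0 (`|u n a| - 1).
  rewrite sqrrB expr1n mulr1; lra.
have uh a : \forall n \near \oo, laplacian k (u n) a = h a.
  by apply: filterS (exhaustion_incident a) => n [h1 h2]; exact: (uP n).1.
have [f [uf _ fh]] := bounded_solutions_cvg uM uh.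
exists f; last exact/funext.
apply: (@ell2_sum_le _ B') => s us.
have cs : \sum_(x <- s) u n x ^+ 2 @[n --> \oo] --> \sum_(x <- s) f x ^+ 2.
  by apply: cvg_sumr => x _; under eq_fun do rewrite expr2; rewrite expr2; apply: cvgM.
have /cvg_lim <- // := cs; apply: limr_le; first by apply/cvg_ex; eexists; exact: cs.
by apply: nearW => n; exact: (uP n).2.
Qed.

(** [laplacian_inv] is a chosen inverse, about which nothing is known until one is shown to exist.
    Uniqueness of preimages holds because l^2 functions are bounded. *)
Lemma laplacian_invP : inverse_on_ell2 k (laplacian_inv (G := G) k).
Proof.
apply: (@xgetPex _ _ [set A | inverse_on_ell2 k A]).
pose A h := xget (fun=> 0) [set u | ell2 u /\ laplacian k u = h].
have AP h : ell2 h -> ell2 (A h) /\ laplacian k (A h) = h.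
  move=> /ell2_solution[u u2 Lu].
  exact: (@xgetPex _ (fun=> 0) [set u | ell2 u /\ laplacian k u = h] (ex_intro _ u (conj u2 Lu))).
exists A; split=> // f f2 Lf2; have [u2 Lu] := AP _ Lf2.
have [M1 M1P] := ell2_bounded u2; have [M2 M2P] := ell2_bounded f2.
apply: (@bounded_unique _ _ (Num.max M1 M2)) => a.
- by rewrite le_max M1P.
- by rewrite le_max M2P orbT.
- by rewrite Lu.
Qed.

Lemma ell2_delta y : ell2 (delta (G := G) (R := R) y).
Proof.
apply: (@ell2_sum_le _ 1) => s us.
have [ys|ys] := boolP (y \in s).
  rewrite (bigD1_seq y) //= /delta eqxx expr1n big1 ?addr0 // => x /negbTE ->.
  by rewrite expr0n.
rewrite big_seq big1 // => x xs; rewrite /delta; case: eqP => [xy|_].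
  by rewrite -xy xs in ys.
by rewrite expr0n.
Qed.

Lemma greenP y : (exists M : R, forall x, `|green k x y| <= M) /\
  laplacian k (green k ^~ y) = delta y.
Proof.
have [h1 h2] := laplacian_invP; have [g2 Lg] := h1 _ (ell2_delta y).
by split => //; exact: ell2_bounded g2.
Qed.

(** Characterizes the Green function without l^2, in the terms available for a limit of finite Green
    functions. *)
Lemma bounded_solution_green f y (M : R) : (forall x, `|f x| <= M) ->
  laplacian k f = delta y -> forall x, f x = green k x y.
Proof.
move=> fM Lf x; have [[M' gM] Lg] := greenP y.
have -> // : f = green k ^~ y.
apply: (@bounded_unique _ _ (Num.max M M')) => a.
- by rewrite le_max fM.
- by rewrite le_max gM orbT.
- by rewrite Lf Lg.
Qed.

End Potential.

(** * Infinite-volume forests *)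

Section Reach.
Context {R : realType} {G : drawn_graph R}.
Implicit Types (a b : vertex G) (e : edge G) (w : config G).

Definition root_event b a : set (config G) :=
  [set w | roots_of w b /\ connected_by (edges_of w) a b].

(** Local approximations of [root_event b a], increasing to it as [L] grows. The recursion over the
    finitely many edges at each vertex is what makes their locality provable. *)
Fixpoint reach (L : nat) b a : set (config G) :=
  if L is L'.+1 then
    reach L' b a `|` \bigcup_(e in [set e | incident e a])
       ([set w : config G | w (inl e)] `&` reach L' b (other_end e a))
  else [set w : config G | w (inr b) /\ a = b].

Lemma adj_incident (S : set (edge G)) a a' : adj S a a' ->
  exists e, [/\ S e, incident e a & other_end e a = a'].
Proof.
move=> /asboolP[e Se h]; exists e; split=> //.
  by case: h => -[? ?]; [left|right].
rewrite /other_end; case: h => -[h1 h2]; first by rewrite h1 eqxx.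
by rewrite h1; case: eqP => // ->.
Qed.

Lemma reachP L b a w : reach L b a w <->
  w (inr b) /\ exists s, [/\ (size s <= L)%N, path (adj (edges_of w)) a s & last a s = b].
Proof.
elim: L a => [|L IH] a /=.
  split; first by move=> [wb ab]; split=> //; exists [::].
  by move=> [wb [s [+ _ ls]]]; case: s ls => [|//] /= ->.
split.
  move=> [/IH[wb [s [sL ps ls]]]|[e /= ie [/= we /IH[wb [s [sL ps ls]]]]]]; split=> //.
    by exists s; split=> //; exact: leqW.
  exists (other_end e a :: s); split=> //=; rewrite ps andbT.
  exact: other_end_adj.
move=> [wb [[|a' s] [sL ps ls]]].
  by left; apply/IH; split=> //; exists [::].
move: ps => /= /andP[/adj_incident[e [we ie ea]] ps].
by right; exists e => //; split=> //; apply/IH; split=> //; exists s; rewrite ea.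
Qed.

Lemma root_eventE b a : root_event b a = \bigcup_L reach L b a.
Proof.
apply/seteqP; split => w.
  by move=> [wb [s ps ls]]; exists (size s) => //; apply/reachP; split=> //; exists s.
by move=> [L _ /reachP[wb [s [_ ps ls]]]]; split=> //; exists s.
Qed.

Lemma reach_le L L' b a : (L <= L')%N -> reach L b a `<=` reach L' b a.
Proof.
move=> LL w /reachP[wb [s [sL ps ls]]]; apply/reachP; split=> //.
by exists s; split=> //; exact: leq_trans LL.
Qed.

Hypothesis incident_finite : forall a : vertex G, finite_set [set e | incident e a].

Lemma local_reach L b a : local (reach L b a).
Proof.
elim: L a => [|L IH] a /=.
  have -> : [set w : config G | w (inr b) /\ a = b] =
    [set w : config G | w (inr b)] `&` [set w : config G | a = b] by [].
  by apply: localI; [exact: local_coordinate|exact: local_const].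
apply: localU => //; apply: local_bigcup => // e _.
by apply: localI => //; exact: local_coordinate.
Qed.

Lemma measurable_root_event b a : measurable (root_event b a).
Proof.
rewrite root_eventE; apply: bigcup_measurable => L _.
apply: local_measurable; exact: local_reach.
Qed.

Lemma local_adj a a' : local [set w : config G | adj (edges_of w) a a'].
Proof.
have -> : [set w : config G | adj (edges_of w) a a'] =
    \bigcup_(e in [set e | incident e a])
      ([set w : config G | w (inl e)] `&` [set w : config G | other_end e a = a']).
  apply/seteqP; split => w /=.
    by move=> /adj_incident[e [we ie ea]]; exists e.
  by move=> [e ie [we <-]]; exact: other_end_adj.
apply: local_bigcup => // e _.
by apply: localI; [exact: local_coordinate|exact: local_const].
Qed.

Lemma local_path a (s : seq (vertex G)) :
  local [set w : config G | path (adj (edges_of w)) a s].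
Proof.
elim: s a => [|a' s IH] a /=; first exact: (local_const true).
have -> : [set w : config G | adj (edges_of w) a a' && path (adj (edges_of w)) a' s] =
  [set w : config G | adj (edges_of w) a a'] `&`
  [set w : config G | path (adj (edges_of w)) a' s].
  by apply/seteqP; split => w /= => [/andP|h]; [|apply/andP].
by apply: localI => //; exact: local_adj.
Qed.

End Reach.

(** * Green functions of finite subgraphs, freed from matrices *)

Section FiniteGreen.
Context {R : realType} {G : drawn_graph R} (k : R).
Implicit Types (a b : vertex G) (e : edge G) (w : config G).

Hypothesis sG : simple_graph G.
Hypothesis incident_finite : forall a : vertex G, finite_set [set e | incident e a].
Hypothesis rho_gt0 : forall e : edge G, 0 < rho k e.
Variable m0 : R.
Hypothesis m0_gt0 : 0 < m0.
Hypothesis mass_ge : forall a : vertex G, m0 <= mass2 k a.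

Let mass_gt0 a : 0 < mass2 k a. Proof. exact: lt_le_trans (mass_ge a). Qed.

(** All that the passage to the limit uses about a finite subgraph. The bounds, the symmetry and the
    sum hold at every vertex, since the Green function is extended by zero; [green_reach] is the
    tail bound uniform in [H]. *)
Record green_spec (H : set (vertex G) * set (edge G))
    (P : probability (config G) R) (g : vertex G -> vertex G -> R) : Prop := GreenSpec {
  green_present : forall J : seq (edge G + vertex G), uniq J ->
    (forall i, i \in J -> in_subgraph H i) ->
    prob P (present J) = \det (\matrix_(l < size J, l' < size J)
      transfer (item_weight k) g (tnth (in_tuple J) l) (tnth (in_tuple J) l'));
  green_root : forall a b, H.1 a -> H.1 b ->
    prob P (root_event b a) = mass2 k b * g a b;
  green_bound : forall a b, 0 <= g a b <= m0^-1;
  green_equation : forall a b, H.1 a -> H.1 b ->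
    (forall e, incident e a -> H.2 e) -> laplacian k (g ^~ b) a = delta b a;
  green_sym : forall a b, g a b = g b a;
  green_sum : forall a (s : seq (vertex G)), uniq s ->
    \sum_(b <- s) mass2 k b * g a b <= 1;
  green_reach : forall a b (L : nat), H.1 a -> H.1 b ->
    mass2 k b * g a b - mass2 k b / m0 / L.+1%:R <= prob P (reach L b a);
  green_null : forall A, measurable A ->
    (forall w, rooted_spanning_forest H w -> ~ A w) -> prob P A = 0 }.

Lemma green_spec_exists H : finite_subgraph H ->
  exists P g, boltzmann k H P /\ green_spec H P g.
Proof.
move=> fH; have [n [N [v [it pr]]]] := presentation_exists fH.
have [P bP] := boltzmann_exists sG rho_gt0 mass_gt0 pr.
exists P, (green_ext v it (item_weight k)); split=> //.
set g := green_ext _ _ _.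
have vim a : H.1 a -> exists x, v x = a by move/(vertices_im pr).
have gsym a b : g a b = g b a by exact: green_ext_sym.
have groot a b : H.1 a -> H.1 b -> prob P (root_event b a) = mass2 k b * g a b.
  move=> /vim[x <-] /vim[r <-].
  exact: (boltzmann_root sG rho_gt0 mass_gt0 pr bP (measurable_root_event incident_finite _ _)).
have g0 a b : ~ H.1 a -> g a b = 0.
  move=> Ha; rewrite /g /green_ext big1 // => x _; rewrite big1 // => y _.
  case: eqP => [va|_]; last by rewrite !mul0r.
  by case: Ha; apply/(vertices_im pr); exists x.
have gge0 a b : 0 <= g a b.
  have [Ha|/g0 -> //] := pselect (H.1 a).
  have [Hb|/g0 h] := pselect (H.1 b); last by rewrite gsym h.
  by rewrite -(pmulr_rge0 _ (mass_gt0 b)) -groot // prob_ge0.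
have gsum a (s : seq (vertex G)) : uniq s -> \sum_(b <- s) mass2 k b * g a b <= 1.
  move=> us; have [/vim[x <-]|na] := pselect (H.1 a); last first.
    by rewrite big1 ?ler01 // => b _; rewrite g0 ?mulr0.
  rewrite -(green_ext_row_sum sG rho_gt0 mass_gt0 pr x).
  rewrite (bigID (mem (map v (enum 'I_n)))) /=.
  rewrite [X in _ + X]big1 ?addr0 => [|b nb]; last first.
    rewrite gsym g0 ?mulr0 //; move/negP : nb; apply: contra_not.
    by move=> /vim[y <-]; rewrite map_f ?mem_enum.
  rewrite -big_filter -[leRHS](big_enum _ _ predT (fun r => mass2 k (v r) * g (v x) (v r))) /=.
  rewrite -(big_map v predT (fun b => mass2 k b * g (v x) b)).
  apply: ler_sum_uniq.
  - exact: filter_uniq.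
  - by rewrite map_inj_uniq ?enum_uniq //; exact: vertices_inj pr.
  - by move=> b; rewrite mem_filter => /andP[].
  - by move=> b; rewrite mulr_ge0 // ltW.
split=> //.
- move=> J uJ JH.
  have := boltzmann_present sG rho_gt0 mass_gt0 pr bP (J := tnth (in_tuple J)).
  rewrite map_tnth_enum; apply; first exact/tuple_uniqP.
  by move=> l; apply: JH; exact: mem_tnth.
- move=> a b; rewrite gge0 /=; have := gsum a [:: b] isT; rewrite big_seq1 => h.
  rewrite -(ler_pM2l m0_gt0) mulfV ?lt0r_neq0 //; apply: le_trans h.
  by rewrite ler_wpM2r.
- move=> a b /vim[x <-] /vim[r <-] inc.
  rewrite (green_ext_laplacian sG rho_gt0 mass_gt0 pr r inc) /delta.
  by rewrite (inj_eq (vertices_inj pr)).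
- move=> a b L Ha Hb.
  have mR := measurable_root_event incident_finite b a.
  have mr : measurable (reach L b a) by apply: local_measurable; exact: local_reach.
  have rR : reach L b a `<=` root_event b a by rewrite root_eventE => w; exists L.
  have := probD P mr mR rR; rewrite groot // => Deq.
  (* If a is at distance more than L from its root b, then the tree of b has more
     than L vertices, while its expected size is [mass2 b * sum_y g y b]. *)
  suff : prob P (root_event b a `\` reach L b a) <= mass2 k b / m0 / L.+1%:R.
    by rewrite Deq !lerBlDr addrC.
  have mD : measurable (root_event b a `\` reach L b a) by exact: measurableD.
  rewrite ler_pdivlMr // mulrC.
  have [x vx] := vim a Ha; have [r vr] := vim b Hb.
  apply: le_trans (_ : \sum_y prob P (root_event b (v y)) <= _).
    under [leRHS]eq_bigr => y _.
      rewrite (boltzmannE sG pr bP (measurable_root_event incident_finite _ _)). over.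
    rewrite (boltzmannE sG pr bP mD) mulrA -mulr_suml.
    rewrite ler_pM2r ?invr_gt0 ?(det_lapmx_gt0 sG rho_gt0 mass_gt0 pr) //.
    rewrite mulr_sumr big_mkcond /=.
    under [leRHS]eq_bigr => y _ do rewrite big_mkcond /=.
    rewrite exchange_big /=; apply: ler_sum => f _.
    have W0 : 0 < \prod_z item_weight k (it (f z)) by exact: weight_gt0.
    rewrite -big_mkcond /=.
    case: ifP => [/andP[gf /asboolP[Rf nr]]|_]; last first.
      by apply: sumr_ge0 => y _; exact: ltW.
    rewrite gf /= sumr_const -[leRHS]mulr_natl ler_pM2r // ler_nat.
    have /andP[va _] := gf.
    have [wb [s ps ls]] := Rf.
    (* A path from [a] to [b] without repetition has more than [L] edges, and all its vertices have
       root [b]; this gives at least [L + 1] vertices in the tree. *)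
    move: ls; case/shortenP: ps => s' ps' us' _ ls'.
    have Ls : (L < size s')%N.
      rewrite ltnNge; apply/negP => sL; apply: nr; apply/reachP; split=> //.
      by exists s'.
    apply: leq_trans (leqW Ls) _; rewrite -/(size (a :: s')) cardE.
    rewrite -(size_map v); apply: uniq_leq_size => // c cs.
    have ca : connected_by (edges_of (forest_of it f)) (v x) c.
      rewrite vx; case/splitPl: cs ps' => p1 p2 lp1; rewrite cat_path => /andP[pp1 _].
      by exists p1.
    have [y -> hy] := connected_ends sG pr va ca.
    have ey : ends (parent v it f) y r.
      by rewrite -hy; apply/(forest_ends sG pr x r va); rewrite vx vr.
    by apply: map_f; rewrite mem_enum inE -vr; exact: (forest_ends sG pr y r va).1 ey.
  under eq_bigr => y _.
    rewrite groot //; last by apply/(vertices_im pr); exists y. over.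
  rewrite -mulr_sumr ler_wpM2l ?(ltW (mass_gt0 _)) //.
  (* By symmetry the column sum of [g] at [b] is a row sum, to which [gsum] applies once each mass
     is bounded below by [m0]. *)
  rewrite -(ler_pM2l m0_gt0) mulfV ?lt0r_neq0 // mulr_sumr.
  apply: le_trans (gsum b (map v (enum 'I_n)) _); last first.
    by rewrite map_inj_uniq ?enum_uniq //; exact: vertices_inj pr.
  rewrite big_map big_enum /=; apply: ler_sum => y _.
  by rewrite [g b _]gsym ler_wpM2r.
- move=> A mA An; rewrite (boltzmannE sG pr bP mA) big1 ?mul0r // => f /andP[gf /asboolP Af].
  by case: (An _ (good_forest sG pr gf)).
Qed.

End FiniteGreen.

Lemma cvg_prodr (R : realType) (I : Type) (r : seq I) (P : pred I)
    (u : I -> nat -> R) (l : I -> R) :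
  (forall i, P i -> u i n @[n --> \oo] --> l i) ->
  \prod_(i <- r | P i) u i n @[n --> \oo] --> \prod_(i <- r | P i) l i.
Proof.
move=> ul; elim: r => [|i r IH].
  by rewrite big_nil; under eq_fun do rewrite big_nil; exact: cvg_cst.
rewrite big_cons; under eq_fun do rewrite big_cons.
by case: ifP => // Pi; apply: cvgM => //; exact: ul.
Qed.

Lemma cvg_det (R : realType) (p : nat) (A : nat -> 'M[R]_p) (B : 'M[R]_p) :
  (forall i j, A n i j @[n --> \oo] --> B i j) -> \det (A n) @[n --> \oo] --> \det B.
Proof.
move=> AB; rewrite /determinant; apply: cvg_sumr => s _.
by apply: cvgM; [exact: cvg_cst|apply: cvg_prodr => i _; exact: AB].
Qed.

(** * Passage to the limit along an exhaustion *)

Section InfiniteVolume.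
Context {R : realType} {G : drawn_graph R} (k : R).
Implicit Types (a b : vertex G) (e : edge G) (w : config G).

Hypothesis sG : simple_graph G.
Hypothesis incident_finite : forall a : vertex G, finite_set [set e | incident e a].
Hypothesis rho_gt0 : forall e : edge G, 0 < rho k e.
Variables (m0 K : R).
Hypothesis m0_gt0 : 0 < m0.
Hypothesis mass_ge : forall a : vertex G, m0 <= mass2 k a.
Hypothesis K_ge0 : 0 <= K.
Hypothesis rho_le : forall a : vertex G,
  \sum_(e \in [set e | incident e a]) rho k e <= K * mass2 k a.

Local Notation c := (@item_weight R G k).
Local Notation gr := (green k).

Let mass_gt0 a : 0 < mass2 k a. Proof. exact: lt_le_trans (mass_ge a). Qed.

Section Exhaustion.
Variable Gn : nat -> set (vertex G) * set (edge G).
Hypothesis exG : exhaustion Gn.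
Variables (Pn : nat -> probability (config G) R)
  (gn : nat -> vertex G -> vertex G -> R).
Hypothesis specP : forall n, green_spec k m0 (Gn n) (Pn n) (gn n).

Let in_sub J := exhaustion_in_subgraph exG J.

Lemma green_cvg a b : gn n a b @[n --> \oo] --> gr a b.
Proof.
have [f [fc fM fL]] : exists f, [/\ (forall x, gn n x b @[n --> \oo] --> f x),
    (forall x, `|f x| <= m0^-1) & forall x, laplacian k f x = delta b x].
  (* only eventually is b in G_n *)
  apply: (bounded_solutions_cvg incident_finite rho_gt0 m0_gt0 mass_ge K_ge0 rho_le).
    move=> n x; have /andP[h1 h2] := green_bound (specP n) x b.
    by rewrite ger0_norm.
  move=> x; have hb := in_sub [:: inr b].
  near=> n.
  have [nx nE] : (Gn n).1 x /\ forall e, incident e x -> (Gn n).2 e.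
    by near: n; exact: exhaustion_incident exG x.
  have nb : (Gn n).1 b.
    have : forall i, i \in [:: inr b : edge G + vertex G] -> in_subgraph (Gn n) i.
      by near: n; exact: hb.
    by move=> /(_ (inr b)); rewrite mem_head => /(_ isT).
  exact: (green_equation (specP n)).
rewrite -(bounded_solution_green incident_finite rho_gt0 m0_gt0 mass_ge K_ge0 rho_le sG exG fM).
  exact: fc.
exact/funext.
Unshelve. all: by end_near. Qed.

Lemma transfer_cvg i i' :
  transfer c (gn n) i i' @[n --> \oo] --> transfer c gr i i'.
Proof.
rewrite /transfer; apply: cvgM; first exact: cvg_cst.
case: i => [e|a]; case: i' => [e'|a'] /=.
- by apply: cvgB; apply: cvgB; exact: green_cvg.
- by apply: cvgB; exact: green_cvg.
- by apply: cvgB; exact: green_cvg.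
- exact: green_cvg.
Qed.

(** A repeated item would give two equal rows and a zero determinant, hence [undup]. *)
Definition present_det (J : seq (edge G + vertex G)) : R :=
  \det (\matrix_(l < size (undup J), l' < size (undup J))
    transfer c gr (tnth (in_tuple (undup J)) l) (tnth (in_tuple (undup J)) l')).

Lemma present_undup (J : seq (edge G + vertex G)) : present J = present (undup J).
Proof.
by apply/seteqP; split => w /allP h; apply/allP => i iJ; apply: h;
  rewrite mem_undup in iJ *.
Qed.

Lemma present_cvg J : prob (Pn n) (present J) @[n --> \oo] --> present_det J.
Proof.
have : \det (\matrix_(l < size (undup J), l' < size (undup J))
    transfer c (gn n) (tnth (in_tuple (undup J)) l) (tnth (in_tuple (undup J)) l'))
    @[n --> \oo] --> present_det J.
  by apply: cvg_det => i j; rewrite mxE; under eq_fun do rewrite mxE; exact: transfer_cvg.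
apply: cvg_trans; apply: near_eq_cvg; rewrite present_undup.
apply: filterS (in_sub (undup J)) => n nJ.
by rewrite (green_present (specP n)) // undup_uniq.
Qed.

Lemma green_sum_le1 a (s : seq (vertex G)) : uniq s ->
  \sum_(b <- s) mass2 k b * gr a b <= 1.
Proof.
move=> us; have cs : \sum_(b <- s) mass2 k b * gn n a b @[n --> \oo] -->
    \sum_(b <- s) mass2 k b * gr a b.
  by apply: cvg_sumr => b _; apply: cvgM; [exact: cvg_cst|exact: green_cvg].
have /cvg_lim <- // := cs; apply: limr_le; first by apply/cvg_ex; eexists; exact: cs.
by apply: nearW => n; exact: (green_sum (specP n)).
Qed.

Lemma green_symmetric a b : gr a b = gr b a.
Proof.
apply: (cvg_unique _ (@green_cvg a b)) => //.
rewrite (_ : (fun n => gn n a b) = (fun n => gn n b a)); first exact: green_cvg.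
by apply/funext => n; exact: (green_sym (specP n)).
Qed.

Lemma green_ge0 a b : 0 <= gr a b.
Proof.
have cg := @green_cvg a b.
have /cvg_lim <- // := cg; apply: limr_ge; first by apply/cvg_ex; eexists; exact: cg.
by apply: nearW => n; have /andP[] := green_bound (specP n) a b.
Qed.

Variables (vidx : nat -> vertex G) (vrnk : vertex G -> nat).
Hypotheses (vidxK : cancel vidx vrnk) (vrnkK : cancel vrnk vidx).

Let first_vertices n := [seq vidx i | i <- iota 0 n].

Let first_uniq n : uniq (first_vertices n).
Proof. by rewrite map_inj_uniq ?iota_uniq //; exact: can_inj vidxK. Qed.

(** Mass could escape to infinity if the finite identity were merely passed to the limit. Instead,
    the partial sums are bounded by one and their Laplacian is eventually the mass at each vertex;
    their limit is therefore the bounded solution 1. *)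
Lemma green_sum_cvg a :
  \sum_(0 <= i < n) mass2 k (vidx i) * gr a (vidx i) @[n --> \oo] --> (1 : R).
Proof.
pose u n x := \sum_(0 <= i < n) mass2 k (vidx i) * gr x (vidx i).
have u01 n x : 0 <= u n x <= 1.
  rewrite /u sumr_ge0 /=; last by move=> i _; rewrite mulr_ge0 ?green_ge0 // ltW.
  have := green_sum_le1 x (first_uniq n).
  by rewrite /first_vertices big_map -{1}[n]subn0.
have u1 n x : `|u n x| <= 1 by have /andP[h1 h2] := u01 n x; rewrite ger0_norm.
have uL n x : laplacian k (u n) x = \sum_(0 <= i < n) mass2 k (vidx i) * delta (vidx i) x.
  rewrite /u; elim: n => [|n IH].
    rewrite big_geq // /laplacian fsbig1 ?add0r ?big_geq ?mulr0 // => e _.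
    by rewrite !big_geq // subrr mulr0.
  rewrite [RHS]big_nat_recr //= -IH.
  have -> : (fun y => \sum_(0 <= i < n.+1) mass2 k (vidx i) * gr y (vidx i)) =
     (fun y => \sum_(0 <= i < n) mass2 k (vidx i) * gr y (vidx i)
               - (- mass2 k (vidx n)) * gr y (vidx n)).
    by apply/funext => y; rewrite big_nat_recr //= mulNr opprK.
  rewrite (laplacianB k incident_finite _ (fun y => - mass2 k (vidx n) * gr y (vidx n))).
  rewrite (laplacianZ k incident_finite) mulNr opprK; congr (_ + _ * _).
  have [_ /(congr1 (fun F => F x)) -> //] := greenP incident_finite rho_gt0 m0_gt0 mass_ge K_ge0 rho_le sG exG (vidx n).
have uh x : \forall n \near \oo, laplacian k (u n) x = mass2 k x.
  exists (vrnk x).+1 => // n /= xn; rewrite uL.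
  rewrite (bigD1_seq (vrnk x)) ?mem_index_iota ?iota_uniq //= vrnkK /delta eqxx mulr1.
  rewrite big1 ?addr0 // => i ix; case: eqP => [xi|]; last by rewrite mulr0.
  by rewrite xi vidxK eqxx in ix.
have [f [uf fM fL]] := bounded_solutions_cvg incident_finite rho_gt0 m0_gt0 mass_ge K_ge0 rho_le u1 uh.
have -> : 1 = f a; last exact: uf.
have -> // : f = cst 1.
apply: (bounded_unique incident_finite rho_gt0 m0_gt0 mass_ge K_ge0 rho_le fM).
  by move=> x; rewrite normr1.
move=> x; rewrite fL /laplacian fsbig1 ?add0r ?mulr1 // => e _.
by rewrite subrr mulr0.
Qed.

Variable P : probability (config G) R.
Hypothesis cP : forall A : set (config G), local A -> prob (Pn n) A @[n --> \oo] --> prob P A.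

(** The way in which the forest structure reaches the limit: a local defect that no finite forest
    has keeps probability zero. *)
Lemma local_null (A : set (config G)) : local A ->
  (forall n w, rooted_spanning_forest (Gn n) w -> ~ A w) -> P A = 0%E.
Proof.
move=> lA nA; have mA := local_measurable lA.
rewrite probE //; congr (_%:E); have := cP lA.
have -> : (fun n => prob (Pn n) A) = cst 0.
  by apply/funext => n; exact: (green_null (specP n) mA (nA n)).
by move=> h; apply: (cvg_unique _ h) => //; exact: cvg_cst.
Qed.

Lemma prob_reach_ge a b L :
  mass2 k b * gr a b - mass2 k b / m0 / L.+1%:R <= prob P (reach L b a).
Proof.
have cr := cP (local_reach incident_finite L b a).
have cg : mass2 k b * gn n a b - mass2 k b / m0 / L.+1%:R @[n --> \oo] -->
    mass2 k b * gr a b - mass2 k b / m0 / L.+1%:R.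
  apply: cvgB; last exact: cvg_cst.
  by apply: cvgM; [exact: cvg_cst|exact: green_cvg].
have /cvg_lim <- // := cr; have /cvg_lim <- // := cg; apply: ler_lim.
- by apply/cvg_ex; eexists; exact: cg.
- by apply/cvg_ex; eexists; exact: cr.
apply: filterS (in_sub [:: inr a; inr b]) => n nab.
apply: (green_reach (specP n)).
- by have := nab (inr a); rewrite mem_head => /(_ isT).
- by have := nab (inr b); rewrite !inE eqxx orbT => /(_ isT).
Qed.

Lemma prob_reach_le a b L : prob P (reach L b a) <= mass2 k b * gr a b.
Proof.
have cr := cP (local_reach incident_finite L b a).
have cg : mass2 k b * gn n a b @[n --> \oo] --> mass2 k b * gr a b.
  by apply: cvgM; [exact: cvg_cst|exact: green_cvg].
have /cvg_lim <- // := cr; have /cvg_lim <- // := cg; apply: ler_lim.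
- by apply/cvg_ex; eexists; exact: cr.
- by apply/cvg_ex; eexists; exact: cg.
apply: filterS (in_sub [:: inr a; inr b]) => n nab.
rewrite -(green_root (specP n)).
- apply: prob_le.
  + by apply: local_measurable; exact: local_reach.
  + exact: measurable_root_event.
  + by rewrite root_eventE => w; exists L.
- by have := nab (inr a); rewrite mem_head => /(_ isT).
- by have := nab (inr b); rewrite !inE eqxx orbT => /(_ isT).
Qed.

(** With [L] fixed, [reach] is local and n may tend to infinity; then [L] does, as the error is
    independent of n. *)
Lemma prob_root_event a b : prob P (root_event b a) = mass2 k b * gr a b.
Proof.
have mreach L : measurable (reach L b a).
  by apply: local_measurable; exact: local_reach.
have cR : prob P (reach L b a) @[L --> \oo] --> prob P (root_event b a).
  have : P (reach L b a) @[L --> \oo] --> P (root_event b a).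
    rewrite root_eventE; apply: nondecreasing_cvg_mu => //.
      exact: bigcupT_measurable.
    by move=> m n mn; apply/subsetPset; exact: reach_le.
  by move=> cE; apply: fine_cvg; rewrite -probE //; exact: measurable_root_event.
have cl : mass2 k b * gr a b - mass2 k b / m0 / L.+1%:R @[L --> \oo] -->
   mass2 k b * gr a b.
  rewrite -[X in _ --> X]subr0; apply: cvgB; first exact: cvg_cst.
  rewrite -(mulr0 (mass2 k b / m0)); apply: cvgM; first exact: cvg_cst.
  exact: cvg_harmonic.
apply: (cvg_unique _ cR) => //.
apply: (squeeze_cvgr _ cl (cvg_cst (mass2 k b * gr a b))).
by apply: nearW => L; rewrite prob_reach_ge prob_reach_le.
Qed.

Lemma null_ae (A : set (config G)) : measurable A -> P A = 0%E ->
  {ae P, forall w, ~ A w}.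
Proof. by move=> mA A0; exists A; split=> // w /contrapT. Qed.

Lemma ae_countable (T : countType) (Q : T -> config G -> Prop) :
  (forall t, {ae P, forall w, Q t w}) -> {ae P, forall w, forall t, Q t w}.
Proof.
move=> aeQ.
have H n : {ae P, forall w, forall t, unpickle n = Some t -> Q t w}.
  case e: (unpickle n) => [t|]; last by apply: aeW.
  by apply: filterS (aeQ t) => w Qw u [<-].
by apply: filterS (ae_foralln H) => w Qw t; apply: (Qw (pickle t)); rewrite pickleK.
Qed.

Lemma acyclic_ae : {ae P, forall w : config G, acyclic (edges_of w)}.
Proof.
(* Cycles are indexed by sequences of numbers of vertices, a countable type, so that a union of null
   events suffices. *)
have H (s : seq nat) : {ae P, forall w : config G,
    (2 < size s)%N -> uniq s -> ~~ path.cycle (adj (edges_of w)) [seq vidx i | i <- s]}.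
  have [[s2 us]|no] := pselect ((2 < size s)%N /\ uniq s); last first.
    by apply: aeW => w h1 h2; case: no.
  pose A := [set w : config G | path.cycle (adj (edges_of w)) [seq vidx i | i <- s]].
  have lA : local A.
    rewrite /A; case: [seq vidx i | i <- s] => [|x p]; first exact: (local_const true).
    exact: local_path.
  have := null_ae (local_measurable lA) (local_null lA _); move=> h.
  apply: filterS (h _) => [w nA _ _|n w [_ _ wac _] Aw]; first by apply/negP.
  have := wac [seq vidx i | i <- s]; rewrite size_map map_inj_uniq; last exact: can_inj vidxK.
  by move=> /(_ s2 us); rewrite Aw.
apply: filterS (ae_countable H) => w Hw s s2 us.
have sE : s = [seq vidx i | i <- [seq vrnk a | a <- s]].
  by rewrite -map_comp -[LHS]map_id; apply: eq_map => a /=; rewrite vrnkK.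
rewrite sE; apply: Hw; first by rewrite size_map.
by rewrite map_inj_uniq //; exact: can_inj vrnkK.
Qed.

Lemma reach_disjoint a b b' L L' : b <> b' -> P (reach L b a `&` reach L' b' a) = 0%E.
Proof.
move=> bb'; apply: local_null; first by apply: localI; exact: local_reach.
move=> n w [_ wV _ wr] [/reachP[wb [s [_ ps ls]]] /reachP[wb' [s' [_ ps' ls']]]].
have cb : connected_by (edges_of w) b a.
  by apply: connected_sym; exists s.
have cb' : connected_by (edges_of w) b b'.
  by apply: connected_trans cb _; exists s'.
have [r [_ rP]] := wr b (wV _ wb).
apply: bb'; rewrite -(rP b) ?(rP b') //; split=> //; exact: connected_refl.
Qed.

Lemma root_event_disjoint a b b' : b <> b' ->
  P (root_event b a `&` root_event b' a) = 0%E.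
Proof.
move=> bb'; apply/eqP; rewrite eq_le measure_ge0 andbT.
have -> : root_event b a `&` root_event b' a =
    \bigcup_L (reach L b a `&` reach L b' a).
  rewrite !root_eventE; apply/seteqP; split => w.
    move=> [[L _ h] [L' _ h']]; exists (maxn L L') => //; split.
      by apply: reach_le h; exact: leq_maxl.
    by apply: reach_le h'; exact: leq_maxr.
  by move=> [L _ [h h']]; split; exists L.
have mL L : measurable (reach L b a `&` reach L b' a).
  by apply: local_measurable; apply: localI; exact: local_reach.
apply: le_trans (measure_sigma_subadditive P mL (bigcupT_measurable _ mL) (fun w h => h)) _.
by rewrite eseries0 // => L _ _; exact: reach_disjoint.
Qed.

Lemma unique_root_ae : {ae P, forall w, forall a b b',
  root_event b a w -> root_event b' a w -> b = b'}.
Proof.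
have mr := measurable_root_event incident_finite.
have H (t : nat * nat * nat) : {ae P, forall w, vidx t.1.2 <> vidx t.2 ->
    ~ (root_event (vidx t.1.2) (vidx t.1.1) `&` root_event (vidx t.2) (vidx t.1.1)) w}.
  have [e|ne] := pselect (vidx t.1.2 = vidx t.2); first by apply: aeW.
  have mI : measurable (root_event (vidx t.1.2) (vidx t.1.1) `&`
                         root_event (vidx t.2) (vidx t.1.1)) by exact: measurableI.
  have ae := null_ae mI (root_event_disjoint _ ne).
  by apply: filterS ae => w h _.
apply: filterS (ae_countable H) => w Hw a b b' ab ab'.
apply: contrapT => bb'; have := Hw (vrnk a, vrnk b, vrnk b'); rewrite /= !vrnkK.
by apply.
Qed.

(** The root events of one vertex are disjoint up to null sets, so a root among the first m vertices
    has as probability a partial sum of the series of [green_sum_cvg], which tends to 1. *)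
Lemma has_root_ae : {ae P, forall w, forall a, exists b, root_event b a w}.
Proof.
have mr := measurable_root_event incident_finite.
suff H n : {ae P, forall w, exists b, root_event b (vidx n) w}.
  by apply: filterS (ae_countable H) => w Hw a; rewrite -(vrnkK a).
set a := vidx n.
pose U m : set (config G) := \bigcup_(i in [set i | (i < m)%N]) root_event (vidx i) a.
have mU m : measurable (U m) by exact: bigcup_measurable.
have US m : U m.+1 = U m `|` (root_event (vidx m) a `\` (root_event (vidx m) a `&` U m)).
  apply/seteqP; split => w.
    move=> [i /=]; rewrite ltnS leq_eqVlt => /orP[/eqP -> rm|im ri]; last by left; exists i.
    by have [u|nu] := pselect (U m w); [left|right; split=> // -[]].
  by move=> [[i /= im ri]|[rm _]]; [exists i => //; exact: ltnW|exists m => /=].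
have null m : P (root_event (vidx m) a `&` U m) = 0%E.
  apply/eqP; rewrite eq_le measure_ge0 andbT.
  pose F i := if (i < m)%N then root_event (vidx m) a `&` root_event (vidx i) a else set0.
  have mF i : measurable (F i).
    by rewrite /F; case: ifP => // _; apply: measurableI; exact: mr.
  apply: le_trans (measure_sigma_subadditive P mF (measurableI _ _ (mr _ _) (mU m)) _) _.
    by move=> w [rm [i /= im ri]]; exists i => //; rewrite /F im.
  rewrite eseries0 // => i _ _; rewrite /F; case: ifP => im; last exact: measure0.
  apply: root_event_disjoint => e; move: im.
  by rewrite -(vidxK i) -e vidxK ltnn.
have PU m : prob P (U m) = \sum_(0 <= i < m) mass2 k (vidx i) * gr a (vidx i).
  elim: m => [|m IH].
    rewrite big_geq // (_ : U 0%N = set0) ?/prob ?measure0 //.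
    by apply/seteqP; split => w // -[].
  have mI : measurable (root_event (vidx m) a `&` U m) by apply: measurableI; [exact: mr|].
  rewrite [RHS]big_nat_recr //= -IH -prob_root_event US probU //.
  - by rewrite probD // [prob P (_ `&` U m)]/prob null subr0.
  - by apply: measurableD => //; exact: mr.
  - by rewrite -subset0 => w [u [rm]]; apply; split.
pose V := \bigcup_m U m.
have mV : measurable V by exact: bigcupT_measurable.
have PV : prob P V = 1.
  apply/eqP; rewrite eq_le prob_le1 //=.
  have cs := @green_sum_cvg a; have /cvg_lim <- // := cs.
  apply: limr_le; first by apply/cvg_ex; eexists; exact: cs.
  apply: nearW => m; rewrite -PU; apply: prob_le => // w h; by exists m.
have nV : P (~` V) = 0%E.
  have mVC := measurableC mV; rewrite probE //.
  by have := probD P mV measurableT (@subsetT _ V); rewrite setTD probT PV subrr => ->.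
apply: filterS (null_ae (measurableC mV) nV) => w /= nw.
by have /contrapT [m _ [i _ ri]] := nw; exists (vidx i).
Qed.

(* Borel-Cantelli: by symmetry of the Green function, the probabilities that b is
   the root of y have a finite sum over y. *)
Lemma finite_tree_ae : {ae P, forall w, forall b, finite_set [set a | root_event b a w]}.
Proof.
have mr := measurable_root_event incident_finite.
suff H n : {ae P, forall w, finite_set [set a | root_event (vidx n) a w]}.
  by apply: filterS (ae_countable H) => w Hw b; rewrite -(vrnkK b).
set b := vidx n.
have L0 : P (lim_sup_set (fun i => root_event b (vidx i))) = 0%E.
  apply: lim_sup_set_cvg0 => //.
  apply: le_lt_trans (ltry (mass2 k b / m0)); apply: lime_le.
    by apply: is_cvg_nneseries => i _ _; exact: measure_ge0.
  apply: nearW => m.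
  rewrite (eq_bigr (fun i => (mass2 k b * gr (vidx i) b)%:E)); last first.
    by move=> i _; rewrite -prob_root_event; exact: probE.
  rewrite sumEFin lee_fin -mulr_sumr; apply: ler_wpM2l; first exact: ltW.
  rewrite -(ler_pM2l m0_gt0) mulfV ?lt0r_neq0 // mulr_sumr.
  have := green_sum_le1 b (first_uniq m).
  rewrite /first_vertices big_map -{1}[m]subn0; apply: le_trans.
  apply: ler_sum => i _; rewrite green_symmetric ler_wpM2r ?green_ge0 //.
have mL : measurable (lim_sup_set (fun i => root_event b (vidx i))).
  by apply: bigcap_measurable => // i _; exact: bigcup_measurable.
apply: filterS (null_ae mL L0) => w nw.
have [m mP] : exists m, forall i, (m <= i)%N -> ~ root_event b (vidx i) w.
  apply: contrapT => no; apply: nw => m _; apply: contrapT => nU; apply: no.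
  by exists m => i mi ri; apply: nU; exists i.
apply: (@sub_finite_set _ _ (vidx @` `I_m)); last exact: finite_image.
move=> a ra; exists (vrnk a); last exact: vrnkK.
rewrite /= ltnNge; apply/negP => /mP; rewrite vrnkK; exact.
Qed.

Lemma rooted_forest_ae : on_rooted_spanning_forests P.
Proof.
have := has_root_ae; have := unique_root_ae; have := acyclic_ae.
apply: filterS3 => w wac wu wr; split=> // a _.
by have [b [h1 h2]] := wr a; exists b; split=> // b' h; exact: (wu a).
Qed.

Lemma finite_components_ae : {ae P, forall w, finite_components w}.
Proof.
have := has_root_ae; have := finite_tree_ae; apply: filterS2 => w wf wr x.
have [b [wb xb]] := wr x; apply: sub_finite_set (wf b) => y xy.
by split=> //; exact: connected_trans (connected_sym xy) xb.
Qed.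

End Exhaustion.
End InfiniteVolume.

Lemma countable_enumeration (T : choiceType) :
  countable [set: T] -> infinite_set [set: T] ->
  exists (idx : nat -> T) (rnk : T -> nat), cancel idx rnk /\ cancel rnk idx.
Proof.
move=> cT iT; have /card_set_bijP[f] := eq_card_nat cT iT.
by rewrite setTT_bijective => -[g fK gK]; exists g, f.
Qed.

Lemma countable_sumT (T U : choiceType) : countable [set: T] ->
  countable [set: U] -> countable [set: T + U].
Proof.
move=> /countable_injP[f fi] /countable_injP[g gi].
apply/countable_injP; exists (fun i => match i with inl t => (f t).*2 | inr u => (g u).*2.+1 end).
have fI t t' : f t = f t' -> t = t' by apply: fi; rewrite inE.
have gI t t' : g t = g t' -> t = t' by apply: gi; rewrite inE.
move=> [t|u] [t'|u'] _ _ /=.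
- by move/double_inj/fI ->.
- by move/(congr1 odd); rewrite /= !odd_double.
- by move/(congr1 odd); rewrite /= !odd_double.
- by case; move/double_inj/gI ->.
Qed.

(** * The measure for a graph with conductances controlled by its masses *)

Section Main.
Context {R : realType} {G : drawn_graph R} (k : R).
Implicit Types (a b : vertex G) (e : edge G) (w : config G).

Hypothesis sG : simple_graph G.
Hypothesis incident_finite : forall a : vertex G, finite_set [set e | incident e a].
Hypothesis rho_gt0 : forall e : edge G, 0 < rho k e.
Variables (m0 K : R).
Hypothesis m0_gt0 : 0 < m0.
Hypothesis mass_ge : forall a : vertex G, m0 <= mass2 k a.
Hypothesis K_ge0 : 0 <= K.
Hypothesis rho_le : forall a : vertex G,
  \sum_(e \in [set e | incident e a]) rho k e <= K * mass2 k a.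
Hypothesis Vcount : countable [set: vertex G].
Hypothesis Ecount : countable [set: edge G].
Hypothesis Vinf : infinite_set [set: vertex G].

Let item_inf : infinite_set [set: edge G + vertex G].
Proof.
move=> fin; apply: Vinf.
have := finite_preimage (f := inr : vertex G -> edge G + vertex G) (B := setT).
by rewrite preimage_setT; apply=> // x y _ _ [].
Qed.

(** The measure is built along this one exhaustion; any other has the same limit, since the limiting
    determinants involve only the Green function of the whole graph. *)
Lemma exhaustion_exists : exists Gn : nat -> set (vertex G) * set (edge G), exhaustion Gn.
Proof.
have [idx [rnk [idxK rnkK]]] := countable_enumeration (countable_sumT Ecount Vcount) item_inf.
pose E n := [set e : edge G | (rnk (inl e) < n)%N].
have finE n : finite_set (E n).
  apply: (@sub_finite_set _ _ (inl @^-1` (idx @` `I_n))).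
    by move=> e en; exists (rnk (inl e)) => //; exact: rnkK.
  by apply: finite_preimage => [? ? _ _ []//|]; exact: finite_image.
pose V n := [set a : vertex G | (rnk (inr a) < n)%N] `|` (@em _ G @` E n `|` @ep _ G @` E n).
exists (fun n => (V n, E n)); split.
- move=> n; split=> //=.
    rewrite !finite_setU; split; last by split; exact: finite_image.
    apply: (@sub_finite_set _ _ (inr @^-1` (idx @` `I_n))).
      by move=> a an; exists (rnk (inr a)) => //; exact: rnkK.
    by apply: finite_preimage => [? ? _ _ []//|]; exact: finite_image.
  by move=> e en; split; right; [left|right]; exists e.
- have EE n : E n `<=` E n.+1 by move=> e; rewrite /E /= => h; exact: ltnW.
  move=> n; split=> //=; apply: setUSS.
    by move=> a /= h; exact: ltnW.
  by apply: setUSS; exact: image_subset.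
- by move=> a; exists (rnk (inr a)).+1; left; exact: ltnSn.
- by move=> e; exists (rnk (inl e)).+1; exact: ltnSn.
Qed.

Let spec (Gn : nat -> set (vertex G) * set (edge G)) : exhaustion Gn ->
  exists (Pn : nat -> probability (config G) R) (gn : nat -> vertex G -> vertex G -> R), (forall n, boltzmann k (Gn n) (Pn n)) /\
  (forall n, green_spec k m0 (Gn n) (Pn n) (gn n)).
Proof.
move=> [finG _ _ _].
have H n : exists Pg : probability (config G) R * (vertex G -> vertex G -> R),
    boltzmann k (Gn n) Pg.1 /\ green_spec k m0 (Gn n) Pg.1 Pg.2.
  have [P [g h]] := green_spec_exists sG incident_finite rho_gt0 m0_gt0 mass_ge (finG n).
  by exists (P, g).
have [Pg PgP] := choice H.
exists (fun n => (Pg n).1), (fun n => (Pg n).2); split=> n; by case: (PgP n).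
Qed.

Definition families (j kappa : nat) (e : 'I_j -> edge G) (x : 'I_kappa -> vertex G)
  : seq (edge G + vertex G) :=
  [seq inl (e i) | i <- enum 'I_j] ++ [seq inr (x i) | i <- enum 'I_kappa].

Lemma present_families (j kappa : nat) (e : 'I_j -> edge G) (x : 'I_kappa -> vertex G) :
  present (families e x) =
  [set w | (forall i, edges_of w (e i)) /\ (forall i, roots_of w (x i))].
Proof.
apply/seteqP; split => w; rewrite /present /families /= all_cat.
  move=> /andP[/allP h1 /allP h2]; split=> i.
    by apply: h1; rewrite map_f ?mem_enum.
  by apply: h2; rewrite map_f ?mem_enum.
move=> [h1 h2]; apply/andP; split; apply/allP => _ /mapP[i _ ->].
  exact: h1.
exact: h2.
Qed.

(** Sorts the items into edges and roots, so that the determinantal formula applies to any event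
    [present J]. *)
Lemma families_surj (J : seq (edge G + vertex G)) : uniq J ->
  exists j kappa (e : 'I_j -> edge G) (x : 'I_kappa -> vertex G),
    [/\ injective e, injective x & present J = present (families e x)].
Proof.
move=> uJ.
pose es := pmap (fun i : edge G + vertex G => if i is inl e then Some e else None) J.
pose xs := pmap (fun i : edge G + vertex G => if i is inr a then Some a else None) J.
have ues : uniq es.
  by apply: (@pmap_uniq _ _ _ inl) => // -[].
have uxs : uniq xs.
  by apply: (@pmap_uniq _ _ _ inr) => // -[].
exists (size es), (size xs), (tnth (in_tuple es)), (tnth (in_tuple xs)).
split; [exact/tuple_uniqP|exact/tuple_uniqP|].
rewrite present_families; apply/seteqP; split => w.
  move=> /allP h; split=> i.
    have := mem_tnth i (in_tuple es); rewrite mem_pmap => /mapP[[e|//] eJ [->]].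
    exact: h eJ.
  have := mem_tnth i (in_tuple xs); rewrite mem_pmap => /mapP[[//|a] aJ [->]].
  exact: h aJ.
move=> [h1 h2]; apply/allP => -[e|a] iJ.
  have ees : e \in in_tuple es by rewrite mem_pmap; apply/mapP; exists (inl e).
  by have /tnthP[i ->] := ees; exact: h1.
have axs : a \in in_tuple xs by rewrite mem_pmap; apply/mapP; exists (inr a).
by have /tnthP[i ->] := axs; exact: h2.
Qed.

Lemma present_det_families (j kappa : nat) (e : 'I_j -> edge G) (x : 'I_kappa -> vertex G) :
  injective e -> injective x ->
  present_det k (families e x) = \det (transfer_matrix k e x).
Proof.
move=> ei xi.
have uf : uniq (families e x).
  have u1 : uniq [seq inl (e i) : edge G + vertex G | i <- enum 'I_j].
    by rewrite map_inj_uniq ?enum_uniq // => i i' [] /ei.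
  have u2 : uniq [seq inr (x i) : edge G + vertex G | i <- enum 'I_kappa].
    by rewrite map_inj_uniq ?enum_uniq // => i i' [] /xi.
  rewrite cat_uniq u1 u2 andbT /=.
  by apply/hasPn => _ /mapP[a _ ->]; apply/negP => /mapP[].
rewrite /present_det (undup_id uf).
have sf : size (families e x) = (j + kappa)%N.
  by rewrite size_cat (size_map (fun i => inl (e i))) (size_map (fun i => inr (x i)))
    !size_enum_ord.
have nthf (i0 : edge G + vertex G) (l : 'I_(j + kappa)) : seq.nth i0 (families e x) l =
    match fintype.split l with inl i => inl (e i) | inr i => inr (x i) end.
  have s1 : size [seq inl (e i) : edge G + vertex G | i <- enum 'I_j] = j.
    by rewrite size_map size_enum_ord.
  case: fintype.splitP => i li; rewrite /families nth_cat s1 li.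
    by rewrite ltn_ord (nth_map i) ?size_enum_ord // nth_ord_enum.
  by rewrite ltnNge leq_addr /= addKn (nth_map i) ?size_enum_ord // nth_ord_enum.
(* The length of the list equals [j + kappa] by a proof and not by computation, whence a transport
   between the two matrix types. *)
have E (p : nat) (epq : p = (j + kappa)%N) (M : 'M[R]_p) (M' : 'M[R]_(j + kappa)) :
    (forall l l' : 'I_p, M l l' = M' (cast_ord epq l) (cast_ord epq l')) -> \det M = \det M'.
  case: _ / epq M' => M' MM'; congr (\det _); apply/matrixP => l l'.
  by rewrite MM' !cast_ord_id.
apply: (E _ sf) => l l'; rewrite !mxE.
have i0 : edge G + vertex G := tnth (in_tuple (families e x)) l.
rewrite !(tnth_nth i0) /= (nthf i0 (cast_ord sf l)) (nthf i0 (cast_ord sf l')).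
case: (fintype.split (cast_ord sf l)) => i; rewrite !mxE;
  case: (fintype.split (cast_ord sf l')) => i'; rewrite !mxE /transfer /=.
- by rewrite /Hee; congr (_ * _); ring.
- by rewrite /Hev.
- by rewrite /Hve.
- by rewrite /Hvv.
Qed.

(** Geometry and elliptic functions enter only through the hypotheses on degrees, signs and bounds
    of conductances and masses, and countability. *)
Theorem forest_measure :
  exists P : probability (config G) R,
    [/\ on_rooted_spanning_forests P /\ determinantal_formula k P,
        (forall Q : probability (config G) R,
           on_rooted_spanning_forests Q -> determinantal_formula k Q ->
           forall A : set (config G), measurable A -> Q A = P A),
        (forall Gn : nat -> set (vertex G) * set (edge G), exhaustion Gn ->
           exists Pn : nat -> probability (config G) R,
             (forall n, boltzmann k (Gn n) (Pn n)) /\ weak_limit Pn P)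
      & {ae P, forall w, finite_components w}].
Proof.
have [Gn exG] := exhaustion_exists; have [Pn [gn [bP sP]]] := spec exG.
have [idx [rnk [idxK rnkK]]] := countable_enumeration (countable_sumT Ecount Vcount) item_inf.
have [vidx [vrnk [vidxK vrnkK]]] := countable_enumeration Vcount Vinf.
have pcvg (Gn' : nat -> set (vertex G) * set (edge G)) (exG' : exhaustion Gn') Pn' gn' sP' :=
  @present_cvg R G k sG incident_finite rho_gt0 m0 K m0_gt0 mass_ge K_ge0 rho_le Gn' exG' Pn' gn' sP'.
have [P PP] := local_limit_exists
  (fun J => cvgP _ (pcvg _ exG _ _ sP J)) idxK rnkK.
have Pdet J : prob P (present J) = present_det k J.
  exact: (cvg_unique _ (PP _ (local_present J)) (pcvg _ exG _ _ sP J)).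
have Pform : determinantal_formula k P.
  move=> j kappa e x ei xi; rewrite -present_families probE; last exact: measurable_present.
  by rewrite Pdet present_det_families.
exists P; split.
- split=> //; exact: (rooted_forest_ae sG incident_finite rho_gt0 m0_gt0 mass_ge K_ge0 rho_le exG sP vidxK vrnkK PP).
- move=> Q _ Qform; apply: present_unique => J uJ.
  have [j [kappa [e [x [ei xi ->]]]]] := families_surj uJ.
  by rewrite present_families Qform // Pform.
- move=> Gn' exG'; have [Pn' [gn' [bP' sP']]] := spec exG'.
  exists Pn'; split=> //; apply: weak_limit_local => A lA.
  by apply: local_cvg => // J; rewrite Pdet; exact: (pcvg _ exG' _ _ sP').
- exact: (finite_components_ae sG incident_finite rho_gt0 m0_gt0 mass_ge K_ge0 rho_le exG sP vidxK vrnkK PP).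
Qed.

End Main.

(** * Isoradial graphs *)

Section PlaneTopology.
Context {R : realType}.
Implicit Types p q z c d : R * R.

Definition box p (e : R) : set (R * R) :=
  [set z | `|z.1 - p.1| < e /\ `|z.2 - p.2| < e].

Lemma nbhs_box p (U : set (R * R)) :
  nbhs p U <-> exists2 e : R, 0 < e & box p e `<=` U.
Proof.
split.
  move=> /nbhs_ballP[e /= e0 eU]; exists e => // z [h1 h2]; apply: eU.
  by split; rewrite /ball /= distrC.
move=> [e e0 eU]; apply/nbhs_ballP; exists e => //= z [h1 h2]; apply: eU.
by move: h1 h2; rewrite /ball /= => h1 h2; split; rewrite distrC.
Qed.

Lemma closure_box (A : set (R * R)) p :
  closure A p <-> forall e : R, 0 < e -> exists2 z, A z & box p e z.
Proof.
split.
  move=> cA e e0; have [|z [Az bz]] := cA (box p e); last by exists z.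
  by apply/nbhs_box; exists e.
move=> cA B /nbhs_box[e e0 eB]; have [z Az /eB Bz] := cA e e0; by exists z.
Qed.

Lemma segment_source p q : segment p q p.
Proof.
by exists 0; rewrite lexx ler01 subr0 !mul1r !mul0r !addr0; split=> //; case: p.
Qed.

Lemma segment_target p q : segment p q q.
Proof.
by exists 1; rewrite lexx ler01 subrr !mul1r !mul0r !add0r; split=> //; case: q.
Qed.

Let segment_image p q : segment p q =
  (fun t : R => ((1 - t) * p.1 + t * q.1, (1 - t) * p.2 + t * q.2)) @` `[0, 1].
Proof.
apply/seteqP; split => z /=.
  by move=> [t [t01 ->]]; exists t => //=; rewrite in_itv.
by move=> [t /=]; rewrite in_itv /= => t01 <-; exists t.
Qed.

Let segment_continuous p q : continuous
  (fun t : R => ((1 - t) * p.1 + t * q.1, (1 - t) * p.2 + t * q.2)).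
Proof.
move=> t.
have c (x y : R) : (fun s : R => (1 - s) * x + s * y) @ t --> (1 - t) * x + t * y.
  apply: cvgD; apply: cvgM; try exact: cvg_cst; try exact: cvg_id.
  by apply: cvgB; [exact: cvg_cst|exact: cvg_id].
exact: cvg_pair (c _ _) (c _ _).
Qed.

Lemma connected_segment p q : connected (segment p q).
Proof.
rewrite segment_image; apply: connected_continuous_connected.
  exact: segment_connected.
by apply: continuous_subspaceT; exact: segment_continuous.
Qed.

Lemma plane_hausdorff : hausdorff_space (R * R)%type.
Proof. exact: (@norm_hausdorff R (R^o * R^o)%type). Qed.

Lemma closed_segment p q : closed (segment p q).
Proof.
apply: compact_closed; first exact: plane_hausdorff.
rewrite segment_image; apply: continuous_compact; last exact: segment_compact.
by apply: continuous_subspaceT; exact: segment_continuous.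
Qed.

Lemma component_segment (U : set (R * R)) p q z : connected_component U p q ->
  segment q z `<=` U -> connected_component U p z.
Proof.
move=> pq sU; apply: connected_component_trans pq _.
apply: (@connected_component_max _ _ (segment q z)) => //.
- exact: segment_source.
- exact: connected_segment.
- exact: segment_target.
Qed.

Lemma edist_norm_le p q : Defs.edist p q <= `|p.1 - q.1| + `|p.2 - q.2|.
Proof.
rewrite /Defs.edist -[leRHS]ger0_norm ?addr_ge0 // -sqrtr_sqr ler_wsqrtr //.
rewrite [leRHS]sqrrD !real_normK ?num_real // lerD2r lerDl.
by rewrite mulrn_wge0 // mulr_ge0.
Qed.

Lemma norm_le_edist p q : `|p.1 - q.1| <= Defs.edist p q /\ `|p.2 - q.2| <= Defs.edist p q.
Proof.
by rewrite /Defs.edist; split; rewrite -sqrtr_sqr ler_wsqrtr // ?lerDl ?lerDr sqr_ge0.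
Qed.

Lemma ebounded_compact_closure (A : set (R * R)) : ebounded A -> compact (closure A).
Proof.
move=> [M AM].
have cK : compact (`[- M, M]%classic `*` `[- M, M]%classic : set (R * R)).
  by apply: compact_setX; exact: segment_compact.
apply: (subclosed_compact (@closed_closure _ A) cK).
have /closure_id -> := compact_closed plane_hausdorff cK.
apply: closureS => z /AM; have := norm_le_edist (0, 0) z.
rewrite /= !sub0r !normrN => -[h1 h2] h3.
by split; rewrite /= in_itv /= -ler_norml; [exact: le_trans h3|exact: le_trans h3].
Qed.

Definition cross z d : R := z.1 * d.2 - z.2 * d.1.

Definition shift z (s : R) d : R * R := (z.1 + s * d.1, z.2 + s * d.2).

Let perturb (t a b x y : R) : 0 <= t <= 1 -> `|a| < x -> `|b| <= y ->
  `|a + t * b| < x + y.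
Proof.
move=> /andP[t0 t1] ax bY; apply: le_lt_trans (ler_normD _ _) _.
rewrite ltr_leD // normrM ger0_norm //; apply: le_trans bY.
by rewrite -[leRHS]mul1r ler_wpM2r.
Qed.

(** Near [z] the complement of [U] lies on the line through [z] with direction [d]. A point of the
    component close to [z] and off this line can be translated parallel to it without leaving
    [U]. *)
Lemma component_line_shift (U : set (R * R)) p z d (del : R) :
  0 < del -> d <> (0, 0) -> closure (connected_component U p) z ->
  (forall w, box z del w -> ~ U w -> cross (w.1 - z.1, w.2 - z.2) d = 0) ->
  exists2 s : R, 0 < s & forall sg : R, `|sg| = s ->
    closure (connected_component U p) (shift z sg d).
Proof.
move=> del0 d0 cz line; set F := connected_component U p.
have dd : 0 < d.1 ^+ 2 + d.2 ^+ 2.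
  rewrite lt_neqAle addr_ge0 ?sqr_ge0 // andbT eq_sym; apply/eqP => e; apply: d0.
  have /eqP := e; rewrite paddr_eq0 ?sqr_ge0 // !sqrf_eq0 => /andP[/eqP e1 /eqP e2].
  by case: d e1 e2 {line e} => ? ? /= -> ->.
pose N := `|d.1| + `|d.2| + 1.
have N0 : 0 < N by rewrite ltr_wpDl // addr_ge0.
have dN1 : `|d.1| <= N by rewrite /N -addrA lerDl addr_ge0.
have dN2 : `|d.2| <= N by rewrite /N addrAC lerDr addr_ge0.
exists (del / 2 / N); first by rewrite !divr_gt0.
move=> sg sgE; apply/closure_box => e e0.
(* The point [q'] will be within [2 * eta] of [z]: at most [e] for the closure, and at most
   [del / 2], the other half of [del] being left for the translation. *)
pose eta := Num.min (e / 2) (del / 4).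
have eta0 : 0 < eta by rewrite lt_min !divr_gt0.
have eta1 : eta <= e / 2 by rewrite ge_min lexx.
have eta2 : eta <= del / 4 by rewrite ge_min lexx orbT.
have sgd x : `|x| <= N -> `|sg * x| <= del / 2.
  move=> xN; rewrite normrM sgE; apply: le_trans (_ : del / 2 / N * N <= _).
    by apply: ler_wpM2l => //; rewrite ltW // !divr_gt0.
  by rewrite divfK // lt0r_neq0.
have FU w : F w -> U w by exact: connected_component_sub.
have [q Fq [bq1 bq2]] := (closure_box _ _).1 cz eta eta0.
have [q' [Fq' cq' bq1' bq2']] : exists q', [/\ F q', cross (q'.1 - z.1, q'.2 - z.2) d != 0,
    `|q'.1 - z.1| < 2 * eta & `|q'.2 - z.2| < 2 * eta].
  have [cq|cq] := eqVneq (cross (q.1 - z.1, q.2 - z.2) d) 0; last first.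
    by exists q; split=> //; [move: bq1|move: bq2]; lra.
  (* A point [q] on the line is moved along the normal [(d.2, - d.1)]; its cross product with [d]
     becomes nonzero at once, so the move stays in [U]. *)
  pose tau := eta / (2 * N).
  have tau0 : 0 < tau by rewrite divr_gt0 // mulr_gt0.
  have taud x : `|x| <= N -> `|tau * x| <= eta / 2.
    move=> xN; rewrite normrM gtr0_norm //; apply: le_trans (_ : tau * N <= _).
      by apply: ler_wpM2l => //; exact: ltW.
    by rewrite /tau (_ : eta / (2 * N) * N = eta / 2) //; field; exact: lt0r_neq0.
  have b1 t : 0 <= t <= 1 -> `|q.1 + t * (tau * d.2) - z.1| < eta + eta / 2.
    by move=> t01; rewrite addrAC perturb // taud.
  have b2 t : 0 <= t <= 1 -> `|q.2 + t * (- (tau * d.1)) - z.2| < eta + eta / 2.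
    by move=> t01; rewrite addrAC perturb // normrN taud.
  exists (q.1 + 1 * (tau * d.2), q.2 + 1 * (- (tau * d.1))); split => /=.
  - apply: (component_segment Fq) => w [t [t01 /= wE]].
    have {}wE : w = (q.1 + t * (tau * d.2), q.2 + t * (- (tau * d.1))).
      by rewrite wE; congr (_, _); ring.
    have [t0|t0] := eqVneq t 0.
      by rewrite wE t0 !mul0r !addr0; apply: FU; rewrite -surjective_pairing.
    apply: contrapT => nU; have bw : box z del w.
      have t01' := t01; rewrite wE; split => /=.
        by apply: lt_le_trans (b1 _ t01) _; lra.
      by apply: lt_le_trans (b2 _ t01) _; lra.
    have := line w bw nU; rewrite wE /cross /= => /eqP.
    rewrite (_ : _ - _ = cross (q.1 - z.1, q.2 - z.2) d + t * tau * (d.1 ^+ 2 + d.2 ^+ 2));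
      last by rewrite /cross /=; ring.
    rewrite cq add0r; apply/negP; rewrite mulf_neq0 ?(lt0r_neq0 dd) //.
    by rewrite mulf_neq0 ?(lt0r_neq0 tau0).
  - rewrite (_ : cross _ _ = cross (q.1 - z.1, q.2 - z.2) d + tau * (d.1 ^+ 2 + d.2 ^+ 2));
      last by rewrite /cross /=; ring.
    by rewrite cq add0r mulf_neq0 ?(lt0r_neq0 tau0) ?(lt0r_neq0 dd).
  - by have := b1 1; rewrite ler01 lexx => /(_ isT); lra.
  - by have := b2 1; rewrite ler01 lexx => /(_ isT); lra.
exists (shift q' sg d).
  apply: (component_segment Fq') => w [t [/andP[t0 t1] wE]].
  apply: contrapT => nU.
  have t01 : 0 <= t <= 1 by rewrite t0.
  have {}wE : w = (q'.1 + t * (sg * d.1), q'.2 + t * (sg * d.2)).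
    by rewrite wE /shift /=; congr (_, _); ring.
  have bw : box z del w.
    rewrite wE; split => /=; rewrite addrAC.
      by apply: lt_le_trans (perturb t01 bq1' (sgd _ dN1)) _; lra.
    by apply: lt_le_trans (perturb t01 bq2' (sgd _ dN2)) _; lra.
  have := line w bw nU; rewrite wE /cross /shift /= => c0.
  move/eqP: cq'; apply; rewrite -c0 /cross /=; ring.
split; rewrite /shift /=.
  by rewrite (_ : _ - _ = q'.1 - z.1); [move: bq1'; lra|ring].
by rewrite (_ : _ - _ = q'.2 - z.2); [move: bq2'; lra|ring].
Qed.

End PlaneTopology.

Section IsoradialGeometry.
Context {R : realType} (G : drawn_graph R).
Hypothesis hG : isoradial G.
Hypothesis cover : faces_cover_plane G.
Implicit Types (v a b : vertex G) (e : edge G) (p q z c : R * R).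

Let planar : planar_embedding G := hG.1.

Let pos_inj : injective (@pos R G).
Proof. by have [] := planar. Qed.

Let no_loop e : em e <> ep e.
Proof. by have [] := planar. Qed.

Let on_edge e v : edge_segment e (pos v) -> incident e v.
Proof. by have [_ _ h _ _] := planar; exact: h. Qed.

Let crossing e e' p : e <> e' -> edge_segment e p -> edge_segment e' p ->
  exists v, [/\ incident e v, incident e' v & pos v = p].
Proof. by have [_ _ _ h _] := planar; exact: h. Qed.

Let locally_finite (M : R) :
  finite_set [set v : vertex G | Defs.edist (0, 0) (pos v) <= M] /\
  finite_set [set e : edge G | exists2 p, edge_segment e p &
                                 Defs.edist (0, 0) p <= M].
Proof. by have [_ _ _ _ h] := planar; exact: h. Qed.

Lemma incident_edge_segment e v : incident e v -> edge_segment e (pos v).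
Proof. by move=> [<-|<-]; [exact: segment_source|exact: segment_target]. Qed.

(** Two edges with the same ends share their midpoint; as a crossing it would be the position of an
    end. *)
Lemma isoradial_simple : simple_graph G.
Proof.
split; first exact: no_loop.
move=> e e' ends; apply: contrapT => ee'.
pose mid (p q : R * R) : R * R :=
  ((1 - 2^-1) * p.1 + 2^-1 * q.1, (1 - 2^-1) * p.2 + 2^-1 * q.2).
have m1 : edge_segment e (mid (pos (em e)) (pos (ep e))).
  by exists 2^-1; split=> //; apply/andP; split; lra.
have m2 : edge_segment e' (mid (pos (em e)) (pos (ep e))).
  exists 2^-1; split; first by apply/andP; split; lra.
  case: ends => -[-> ->] //; rewrite /mid; congr (_, _); lra.
have [v [iv _ vm]] := crossing ee' m1 m2.
apply: (@no_loop e); apply: pos_inj.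
case: iv => ev; move: vm; rewrite -ev /mid; case: (pos (em e)) (pos (ep e)) => x1 x2 [y1 y2] /= [h1 h2];
  by congr (_, _); lra.
Qed.

Lemma isoradial_incident_finite v : finite_set [set e : edge G | incident e v].
Proof.
apply: sub_finite_set (locally_finite (Defs.edist (0, 0) (pos v))).2 => e ie.
by exists (pos v) => //; exact: incident_edge_segment.
Qed.

Let exists_nat_ge (x : R) : exists n : nat, x <= n%:R.
Proof.
exists (Num.bound `|x|); apply: le_trans (ler_norm x) _.
by apply: ltW; exact: archi_boundP.
Qed.

Lemma isoradial_vertex_countable : countable [set: vertex G].
Proof.
have -> : [set: vertex G] = \bigcup_n [set v : vertex G | Defs.edist (0, 0) (pos v) <= n%:R].
  apply/seteqP; split=> // v _; have [n vn] := exists_nat_ge (Defs.edist (0, 0) (pos v)).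
  by exists n.
apply: bigcup_countable => // n _; apply: finite_set_countable.
exact: (locally_finite n%:R).1.
Qed.

Lemma isoradial_edge_countable : countable [set: edge G].
Proof.
have -> : [set: edge G] = \bigcup_n [set e : edge G | exists2 p, edge_segment e p &
    Defs.edist (0, 0) p <= n%:R].
  apply/seteqP; split=> // e _.
  have [n vn] := exists_nat_ge (Defs.edist (0, 0) (pos (em e))).
  by exists n => //; exists (pos (em e)) => //; exact: segment_source.
apply: bigcup_countable => // n _; apply: finite_set_countable.
exact: (locally_finite n%:R).2.
Qed.

(** By local finiteness, the nearby vertices and edges that avoid [p] form a closed set, and a small
    box around [p] avoids it. A vertex is treated as a degenerate segment. *)
Lemma drawing_near p : exists2 del : R, 0 < del & forall z, box p del z ->
  drawing G z -> (z = p) \/ exists e, edge_segment e z /\ edge_segment e p.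
Proof.
pose M := (`|p.1| + 1) + (`|p.2| + 1).
pose Vs := [set v : vertex G | Defs.edist (0, 0) (pos v) <= M /\ pos v <> p].
pose Es := [set e : edge G | (exists2 q, edge_segment e q & Defs.edist (0, 0) q <= M)
                             /\ ~ edge_segment e p].
have fV : finite_set Vs by apply: sub_finite_set (locally_finite M).1 => v [].
have fE : finite_set Es by apply: sub_finite_set (locally_finite M).2 => e [].
pose D := (\bigcup_(v in Vs) segment (pos v) (pos v)) `|` \bigcup_(e in Es) edge_segment e.
have segp (q z : R * R) : segment q q z -> z = q.
  move=> [t [_ ->]]; case: q => x y /=; congr (_, _); ring.
have cD : closed D.
  by apply: closedU; apply: closed_bigcup => // ? _; exact: closed_segment.
have nD : nbhs p (~` D).
  apply: open_nbhs_nbhs; split; first exact: closed_openC.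
  by move=> [[v [_ vp] /segp]|[e [_ nep]]] //; move/esym.
have [d d0 dD] := (nbhs_box _ _).1 nD.
exists (Num.min d 1); first by rewrite lt_min d0 ltr01.
move=> z [b1 b2].
have bz : box p d z by split; [apply: lt_le_trans b1 _|apply: lt_le_trans b2 _]; rewrite ge_min lexx.
have zM : Defs.edist (0, 0) z <= M.
  apply: le_trans (edist_norm_le _ _) _; rewrite /= !sub0r !normrN.
  have nn (x y : R) : `|y - x| < Num.min d 1 -> `|y| <= `|x| + 1.
    rewrite lt_min => /andP[_ h]; rewrite -(subrK x y) addrC.
    by apply: le_trans (ler_normD _ _) _; rewrite lerD2l ltW.
  by apply: lerD; exact: nn.
have {dD}nDz := dD z bz.
move=> [[v vz]|[e ez]].
  left; apply: contrapT => zp; apply: nDz; left; exists v; first by split; rewrite vz.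
  by rewrite vz; exact: segment_source.
right; exists e; split=> //; apply: contrapT => nep; apply: nDz; right.
by exists e => //; split=> //; exists z.
Qed.

Let sqdist c z : R := (c.1 - z.1) ^+ 2 + (c.2 - z.2) ^+ 2.

Let sqdist_continuous c : continuous (sqdist c).
Proof.
move=> z.
have h1 : (fun w : R * R => c.1 - w.1) @ z --> c.1 - z.1.
  by apply: cvgB; [exact: cvg_cst|exact: cvg_fst].
have h2 : (fun w : R * R => c.2 - w.2) @ z --> c.2 - z.2.
  by apply: cvgB; [exact: cvg_cst|exact: cvg_snd].
exact: cvgD (cvgM h1 h1) (cvgM h2 h2).
Qed.

(* Otherwise the vertex would be isolated, and a farthest point from the
   circumcenter in the closure of a face at the vertex could be improved by
   sliding along a line. *)
Lemma vertex_has_edge v : exists e : edge G, incident e v.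
Proof.
apply: contrapT => isolated; have {}isolated e : ~ incident e v.
  by move=> ie; apply: isolated; exists e.
have [F [faceF Fv]] := cover (pos v).
have [c [circ _]] := hG.2 F faceF.
have [[p0 _ FE] bF] := faceF.
have D1 a : closure F (pos a) -> sqdist c (pos a) = 1.
  move=> /circ h; have := congr1 (fun x => x ^+ 2) h; rewrite /= sqr_sqrtr ?expr1n //.
  by rewrite addr_ge0 ?sqr_ge0.
have [z Fz zmax] : exists2 z, z \in closure F &
    forall t, t \in closure F -> sqdist c t <= sqdist c z.
  apply: compact_EVT_max; first by exists (pos v).
    exact: ebounded_compact_closure.
  by apply: continuous_subspaceT; exact: sqdist_continuous.
rewrite inE in Fz.
(* Both translates of [z'] by [s d] and [- s d] stay in the closure of the face, and by the
   parallelogram identity one of them is farther from [c] than [z']. *)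
have improve z' d (del : R) : closure F z' -> sqdist c z <= sqdist c z' -> 0 < del -> d <> (0, 0) ->
   (forall w, box z' del w -> drawing G w -> cross (w.1 - z'.1, w.2 - z'.2) d = 0) -> False.
  move=> Fz' zz' del0 d0 line.
  have [||s s0 sP] := @component_line_shift _ (~` drawing G) p0 z' d del del0 d0.
  - by rewrite -FE.
  - by move=> w bw /contrapT; exact: line.
  have h1 := sP s (gtr0_norm s0); have h2 := sP (- s) (etrans (normrN s) (gtr0_norm s0)).
  rewrite -FE in h1 h2.
  have le1 := zmax _ (mem_set h1); have le2 := zmax _ (mem_set h2).
  have dd : 0 < s ^+ 2 * (d.1 ^+ 2 + d.2 ^+ 2).
    rewrite mulr_gt0 ?exprn_gt0 // lt_neqAle addr_ge0 ?sqr_ge0 // andbT eq_sym.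
    apply/eqP => /eqP; rewrite paddr_eq0 ?sqr_ge0 // !sqrf_eq0 => /andP[/eqP e1 /eqP e2].
    by apply: d0; case: d e1 e2 {line sP h1 h2 le1 le2} => ? ? /= -> ->.
  have : sqdist c (shift z' s d) + sqdist c (shift z' (- s) d) =
      sqdist c z' *+ 2 + (s ^+ 2 * (d.1 ^+ 2 + d.2 ^+ 2)) *+ 2.
    by rewrite /sqdist /shift /=; ring.
  by move: le1 le2 zz' dd; rewrite !mulr2n; lra.
have e1 : ((1, 0) : R * R) <> (0, 0) by move=> [/eqP]; rewrite oner_eq0.
(* If the farthest point is a vertex, its distance to [c] is 1, the same as for the isolated vertex
   [v], which then takes its place. Otherwise the drawing near it lies on at most one edge, which
   gives the direction to slide. *)
have [[a az]|zV] := pselect (exists a, pos a = z).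
  have [del del0 near_v] := drawing_near (pos v).
  apply: (improve (pos v) (1, 0) del) => //.
    by rewrite D1 // -az D1 // az.
  move=> w bw /(near_v w bw)[->|[e [_ /on_edge /isolated//]]].
  by rewrite /cross /=; ring.
have [del del0 near_z] := drawing_near z.
have [[e0 ze0]|zE] := pselect (exists e, edge_segment e z); last first.
  apply: (improve z (1, 0) del) => //.
  move=> w bw /(near_z w bw)[->|[e [_ ez]]]; first by rewrite /cross /=; ring.
  by case: zE; exists e.
pose d : R * R := ((pos (ep e0)).1 - (pos (em e0)).1, (pos (ep e0)).2 - (pos (em e0)).2).
apply: (improve z d del) => //.
  move=> [h1 h2]; apply: (@no_loop e0); apply: pos_inj.
  by rewrite [LHS]surjective_pairing [RHS]surjective_pairing; congr (_, _); lra.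
move=> w bw /(near_z w bw)[->|[e [we ze]]]; first by rewrite /cross /=; ring.
have [ee|ne] := pselect (e = e0).
  subst e; move: we ze => [t [_ ->]] [t' [_ ->]]; rewrite /cross /d /=; ring.
by have [a [_ _ az]] := crossing ne ze ze0; case: zV; exists a.
Qed.

End IsoradialGeometry.

(** * Elliptic functions *)

Section OrientedIntegral.
Context {R : realType}.
Implicit Types (g : R -> R) (x y : R).
Local Notation mu := (@lebesgue_measure R).

Lemma oint_ge0 g x : 0 <= x -> oint g 0 x = \int[mu]_(t in `[0, x]) g t.
Proof.
rewrite /oint le_eqVlt => /orP[/eqP <-|x0]; first by rewrite set_itv1 !Rintegral_set1 subr0.
by rewrite [X in _ - X](_ : _ = 0) ?subr0 // set_itv_ge ?Rintegral_set0 // bnd_simp -ltNge.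
Qed.

Lemma oint0 g : oint g 0 0 = 0.
Proof. by rewrite /oint subrr. Qed.

(** Near [x] the oriented integral is a difference of two integrals from a common left end [- M],
    below both 0 and [x]; this covers both signs of the upper limit. *)
Lemma oint_is_derive g x : continuous g -> is_derive x (1 : R) (oint g 0) (g x).
Proof.
move=> cg; pose M := `|x| + 1.
have M0 : 0 < M by rewrite ltr_wpDl.
have xM : - M < x < M by rewrite -ltr_norml ltrDl.
have ig : mu.-integrable `[- M, M] (EFin \o g).
  apply: continuous_compact_integrable; first exact: segment_compact.
  exact: continuous_subspaceT.
pose F y := \int[mu]_(t in `[- M, y]) g t.
have ig' a b : - M <= a -> b <= M -> mu.-integrable `[a, b] (EFin \o g).
  move=> aM bM; apply: integrableS ig => //.
  by move=> y /=; rewrite !in_itv /= => /andP[h1 h2]; rewrite (le_trans aM) ?(le_trans h2).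
have FB a b : - M <= a -> a <= b -> b <= M -> \int[mu]_(t in `[a, b]) g t = F b - F a.
  move=> Ma ab bM; rewrite /F Rintegral_itvB ?bnd_simp //; last exact: ig'.
  apply/esym/Rintegral_itv_obnd_cbnd; apply: integrableS (ig' a b Ma bM) => //.
  by move=> y /=; rewrite !in_itv /= => /andP[/ltW -> ->].
have FE y : - M < y < M -> oint g 0 y = F y - F 0.
  move=> /andP[My yM]; have [y0|y0] := leP 0 y.
    by rewrite oint_ge0 // FB // ?oppr_le0 ltW.
  rewrite /oint [X in X - _](_ : _ = 0) ?sub0r; last first.
    by rewrite set_itv_ge ?Rintegral_set0 // bnd_simp -ltNge.
  by rewrite FB ?opprB // ltW.
have [xM1 xM2] := andP xM.
have [dF F'] := continuous_FTC1_closed xM2 ig xM1 (cg x).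
have DF : is_derive x (1 : R) F (g x).
  by apply: DeriveDef => //; rewrite -derive1E F'.
have DF0 : is_derive x (1 : R) (fun y => F y - F 0) (g x).
  by rewrite -[g x]subr0; apply: is_deriveB.
apply: near_eq_is_derive DF0; near=> y; rewrite FE //.
have : y \in `]- M, M[ by near: y; apply: near_in_itvoo; rewrite in_itv /= xM.
by rewrite in_itv.
Unshelve. all: by end_near.
Qed.

End OrientedIntegral.

(** * Elliptic integrals and the difference of A and sc *)

Section EllipticIntegrals.
Context {R : realType} (k : R).
Hypothesis hk : 0 < k < 1.
Local Notation D := (ell_delta k).
Local Notation k' := (compl_modulus k).
Implicit Types (p u : R).

Lemma is_derive_continuous (f df : R -> R) :
  (forall x, is_derive x (1 : R) f (df x)) -> continuous f.
Proof.
move=> h x; have [d _] := h x.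
by apply: differentiable_continuous; exact/derivable1_diffP.
Qed.

Lemma is_deriveM_fun (f g : R -> R) (x a b : R) :
  is_derive x (1 : R) f a -> is_derive x (1 : R) g b ->
  is_derive x (1 : R) (fun t => f t * g t) (a * g x + f x * b).
Proof.
move=> da db; apply: (is_derive_eq (is_deriveM da db)).
by rewrite addrC /GRing.scale /= [g x * a]mulrC.
Qed.

Lemma is_deriveV_fun (f : R -> R) (x a : R) : f x != 0 ->
  is_derive x (1 : R) f a -> is_derive x (1 : R) (fun t => (f t)^-1) (- (a / f x ^+ 2)).
Proof.
move=> fx [df <-]; apply: DeriveDef; first exact: derivableV.
by rewrite deriveV // /GRing.scale /= mulNr mulrC.
Qed.

Lemma ell_delta_radicand p : 0 < 1 - k ^+ 2 * sin p ^+ 2.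
Proof.
have [k0 k1] := andP hk; rewrite subr_gt0.
apply: (@le_lt_trans _ _ (k ^+ 2)); last by rewrite expr_lt1 // ltW.
by rewrite ler_piMr ?sqr_ge0 // -(cos2Dsin2 p) lerDr sqr_ge0.
Qed.

Lemma ell_delta_gt0 p : 0 < D p.
Proof. by rewrite sqrtr_gt0 ell_delta_radicand. Qed.

Lemma ell_delta_sq p : D p ^+ 2 = 1 - k ^+ 2 * sin p ^+ 2.
Proof. by rewrite sqr_sqrtr // ltW ?ell_delta_radicand. Qed.

Lemma compl_modulus_gt0 : 0 < k'.
Proof. by have [k0 k1] := andP hk; rewrite sqrtr_gt0 subr_gt0 expr_lt1 // ltW. Qed.

Lemma compl_modulus_sq : k' ^+ 2 = 1 - k ^+ 2.
Proof. by have [k0 k1] := andP hk; rewrite sqr_sqrtr // subr_ge0 expr_le1 // ltW. Qed.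

Lemma is_derive_ell_delta p :
  is_derive p (1 : R) D (- (k ^+ 2 * sin p * cos p / D p)).
Proof.
have d1 : is_derive p (1 : R) (fun t => 1 - k ^+ 2 * sin t ^+ 2)
    (- (k ^+ 2 * (2 * sin p * cos p))).
  have d := is_deriveM_fun (is_derive_cst (k ^+ 2) p 1) (is_deriveM_fun (is_derive_sin p) (is_derive_sin p)).
  apply: (is_derive_eq (is_deriveB (is_derive_cst (1 : R) p 1) d)) => /=; ring.
have d2 := is_derive1_sqrt (ell_delta_radicand p).
have d3 : is_derive p (1 : R) D ((2 * D p)^-1 * - (k ^+ 2 * (2 * sin p * cos p))).
  exact: (@is_derive1_comp _ Num.sqrt (fun t => 1 - k ^+ 2 * sin t ^+ 2) p _ _ d2 d1).
apply: (is_derive_eq d3).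
have D0 := lt0r_neq0 (ell_delta_gt0 p); rewrite -/(D p); field; exact: D0.
Qed.

Lemma continuous_ell_delta : continuous D.
Proof. exact: is_derive_continuous is_derive_ell_delta. Qed.

Lemma is_derive_ellF p : is_derive p (1 : R) (ellF k) (D p)^-1.
Proof.
apply: (@oint_is_derive _ (fun t => (D t)^-1)) => x.
by apply: cvgV; [exact: lt0r_neq0 (ell_delta_gt0 x)|exact: continuous_ell_delta].
Qed.

Lemma continuous_ellF : continuous (ellF k).
Proof. exact: is_derive_continuous is_derive_ellF. Qed.

Lemma ellF0 : ellF k 0 = 0.
Proof. exact: oint0. Qed.

Lemma ltr_ellF : {mono ellF k : x y / x < y}.
Proof.
apply/leW_mono/le_mono => x y xy.
have [|z _ e] := @MVT _ (ellF k) (fun p => (D p)^-1) x y xy (fun z _ => is_derive_ellF z).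
  exact/continuous_subspaceT/continuous_ellF.
by rewrite -subr_gt0 e mulr_gt0 ?invr_gt0 ?ell_delta_gt0 ?subr_gt0.
Qed.

Lemma ellF_inj : injective (ellF k).
Proof.
move=> x y xy; apply/eqP; rewrite eq_le.
by rewrite !leNgt -(ltr_ellF y x) -(ltr_ellF x y) xy ltxx.
Qed.

Lemma jacobi_amK : cancel (ellF k) (jacobi_am k).
Proof.
move=> p; rewrite /jacobi_am; case: xgetP => [q _ /= /ellF_inj //|/(_ p)].
by move/(_ erefl).
Qed.

Lemma ellF_onto a b u : a <= b -> ellF k a <= u <= ellF k b ->
  exists2 p, a <= p <= b & ellF k p = u.
Proof.
move=> ab /andP[au ub].
have [||p] := @IVT _ (ellF k) a b u ab.
- exact/continuous_subspaceT/continuous_ellF.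
- by rewrite ge_min au le_max ub orbT.
by rewrite in_itv /=; exists p.
Qed.

Lemma is_derive_jacobi_am p : is_derive (ellF k p) (1 : R) (jacobi_am k) (D p).
Proof.
rewrite -[D p]invrK; apply: is_derive_inverse.
- by near=> q; exact: jacobi_amK.
- by near=> q; exact: continuous_ellF.
- exact: is_derive_ellF.
- by rewrite invr_neq0 // lt0r_neq0 // ell_delta_gt0.
Unshelve. all: by end_near.
Qed.

Lemma ellK_gt0 : 0 < ellK k.
Proof. by rewrite /ellK -ellF0 ltr_ellF divr_gt0 // pi_gt0. Qed.

Local Notation E := (oint D 0).

Lemma is_derive_E p : is_derive p (1 : R) E (D p).
Proof. exact/oint_is_derive/continuous_ell_delta. Qed.

(** The antiderivative u - E(am u) + dn u sc u of dc^2, written in the amplitude p, where du = dp /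
    D and dc^2 du = (D / cos^2) dp. *)
Let H p := ellF k p - E p + D p * (sin p * (cos p)^-1).

Let is_derive_H p : cos p != 0 -> is_derive p (1 : R) H (D p / cos p ^+ 2).
Proof.
move=> c0; have D0 := lt0r_neq0 (ell_delta_gt0 p).
have d1 := is_deriveM_fun (is_derive_ell_delta p)
  (is_deriveM_fun (is_derive_sin p) (is_deriveV_fun c0 (is_derive_cos p))).
apply: (is_derive_eq (is_deriveD (is_deriveB (is_derive_ellF p) (is_derive_E p)) d1)).
have e1 := ell_delta_sq p; have e2 : sin p ^+ 2 = 1 - cos p ^+ 2 := sin2cos2 p.
field: e1 e2; by rewrite D0 c0.
Qed.

Lemma cos_neq0 p q : 0 <= q <= p -> p < pi / 2 -> cos q != 0.
Proof.
move=> /andP[q0 qp] p1; rewrite lt0r_neq0 // cos_gt0_pihalf // (le_lt_trans qp) // andbT.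
by rewrite (lt_le_trans _ q0) // oppr_lt0 divr_gt0 // pi_gt0.
Qed.

Lemma integral_dc2 p : 0 < p < pi / 2 ->
  oint (fun v => jacobi_dc k v ^+ 2) 0 (ellF k p) =
  ellF k p - E p + D p * (sin p / cos p).
Proof.
move=> /andP[p0 p1]; set f := fun v => jacobi_dc k v ^+ 2.
have u0 : 0 < ellF k p by rewrite -ellF0 ltr_ellF.
have am0 : jacobi_am k 0 = 0 by rewrite -{1}ellF0 jacobi_amK.
have dH v : 0 <= v <= ellF k p -> is_derive v (1 : R) (H \o jacobi_am k) (f v).
  rewrite -{1}ellF0 => /(ellF_onto (ltW p0))[q q01 <-].
  have dam := is_derive_jacobi_am q.
  have := is_derive_H (cos_neq0 q01 p1); rewrite -{1}(jacobi_amK q) => dh.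
  apply: (is_derive_eq (is_derive1_comp dh dam)).
  rewrite /f /jacobi_dc /jacobi_dn /jacobi_cn jacobi_amK.
  by field; exact: cos_neq0 q01 p1.
have cH v : 0 <= v <= ellF k p -> {for v, continuous (H \o jacobi_am k)}.
  by move=> /dH[d _]; apply: differentiable_continuous; exact/derivable1_diffP.
have cf : {within `[0, ellF k p], continuous f}.
  apply: continuous_in_subspaceT => v; rewrite inE /= in_itv /= -{1}ellF0.
  move=> /(ellF_onto (ltW p0))[q q01 <-].
  have cam : {for ellF k q, continuous (jacobi_am k)}.
    by have [d _] := is_derive_jacobi_am q;
      apply: differentiable_continuous; exact/derivable1_diffP.
  apply: (@continuous_comp _ _ _ (jacobi_am k) (fun t => (D t / cos t) ^+ 2)) => //.
  rewrite jacobi_amK; apply: cvgM; apply: cvgM; try exact: continuous_ell_delta;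
    by apply: cvgV; [exact: cos_neq0 q01 p1|exact: continuous_cos].
rewrite oint_ge0 ?ltW // /Rintegral (@continuous_FTC2 _ f (H \o jacobi_am k)) //=.
- by rewrite am0 jacobi_amK /H ellF0 oint0 sin0 mul0r mulr0 subrr addr0 subr0.
- split.
  + by move=> v; rewrite in_itv /= => /andP[/ltW v0 /ltW v1]; case: (dH v _); rewrite ?v0.
  + by apply/cvg_at_right_filter/cH; rewrite lexx ltW.
  + by apply/cvg_at_left_filter/cH; rewrite lexx ltW.
- move=> v; rewrite in_itv /= => /andP[/ltW v0 /ltW v1]; rewrite derive1E.
  by apply: derive_val; apply: dH; rewrite v0.
Qed.

Lemma ell_delta_lt p q : 0 <= p -> p < q -> q <= pi / 2 -> D q < D p.
Proof.
move=> p0 pq q1; rewrite ltr_sqrt ?ell_delta_radicand // ltrD2l ltrN2.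
have [k0 _] := andP hk.
have sp : 0 <= sin p.
  by rewrite sin_ge0_pi // p0 (le_trans (ltW pq)) // (le_trans q1) // ler_pdivrMr // ler_peMr ?pi_ge0 // ler1n.
rewrite ltr_pM2l ?exprn_gt0 // ltrXn2r //.
have pi0 : - (pi / 2 : R) <= 0 by rewrite oppr_le0 divr_ge0 // pi_ge0.
rewrite ltr_sin // in_itv /= ?(le_trans pi0) ?(le_trans p0) ?(ltW pq) //.
by rewrite (le_trans (ltW pq)).
Qed.

(** The singular terms of k'(A - sc) combine into (D - k') tan p, and D - k' = k^2 cos^2 p / (D +
    k') removes the pole at pi/2. So [f] is differentiable everywhere, and can be studied on the
    closed interval. *)
Let f p := k ^+ 2 * (sin p * cos p / (D p + k')) - E p + E (pi / 2) / ellK k * ellF k p.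
Let bracket p := k ^+ 2 * (D p / (D p + k')) - 1 + E (pi / 2) / ellK k.

Lemma ellA_sub_sc p : 0 < p < pi / 2 ->
  ellA k (ellF k p) - jacobi_sc k (ellF k p) = k'^-1 * f p.
Proof.
move=> p01; have [p0 p1] := andP p01.
rewrite /ellA integral_dc2 // /jacobi_sc /jacobi_sn /jacobi_cn jacobi_amK /f -/(ellE k).
have c0 : cos p != 0 by rewrite (@cos_neq0 p) // lexx ltW.
have K0 := lt0r_neq0 ellK_gt0; have k0 := lt0r_neq0 compl_modulus_gt0.
have S0 : D p + k' != 0 by rewrite lt0r_neq0 // addr_gt0 ?ell_delta_gt0 ?compl_modulus_gt0.
have e1 := ell_delta_sq p; have e2 : sin p ^+ 2 = 1 - cos p ^+ 2 := sin2cos2 p.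
have e3 : k ^+ 2 = 1 - k' ^+ 2 by rewrite compl_modulus_sq; ring.
field: e1 e2 e3; by rewrite S0 K0 c0 k0.
Qed.

Let is_derive_f p : is_derive p (1 : R) f ((D p)^-1 * bracket p).
Proof.
have D0 := lt0r_neq0 (ell_delta_gt0 p); have K0 := lt0r_neq0 ellK_gt0.
have S0 : D p + k' != 0 by rewrite lt0r_neq0 // addr_gt0 ?ell_delta_gt0 ?compl_modulus_gt0.
have dS := is_deriveD (is_derive_ell_delta p) (is_derive_cst k' p 1).
have d1 := is_deriveM_fun (is_derive_cst (k ^+ 2) p 1) (is_deriveM_fun
  (is_deriveM_fun (is_derive_sin p) (is_derive_cos p)) (@is_deriveV_fun (fun t => D t + k') p _ S0 dS)).
have d2 := is_deriveM_fun (is_derive_cst (E (pi / 2) / ellK k) p 1) (is_derive_ellF p).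
apply: (is_derive_eq (is_deriveD (is_deriveB d1 (is_derive_E p)) d2)).
have e1 := ell_delta_sq p; have e2 : sin p ^+ 2 = 1 - cos p ^+ 2 := sin2cos2 p.
have e3 : k ^+ 2 = 1 - k' ^+ 2 by rewrite compl_modulus_sq; ring.
rewrite /bracket /=.
field: e1 e2 e3; by rewrite S0 K0 D0.
Qed.

Let bracket_decr p q : 0 <= p -> p < q -> q <= pi / 2 -> bracket q < bracket p.
Proof.
move=> p0 pq q1; have [k0 _] := andP hk; have k'0 := compl_modulus_gt0.
have S0 t : 0 < D t + k' by rewrite addr_gt0 ?ell_delta_gt0.
rewrite ltrD2r ltrD2r ltr_pM2l ?exprn_gt0 // ltr_pdivrMr ?S0 // mulrAC ltr_pdivlMr ?S0 //.
by rewrite !mulrDr [D p * D q]mulrC ltrD2l ltr_pM2r // ell_delta_lt.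
Qed.

Let continuous_f : continuous f.
Proof. exact: is_derive_continuous is_derive_f. Qed.

(* The derivative of f has the sign of a decreasing function, and f vanishes at
   both ends, where the second end is the definition of K and E. *)
Let f_gt0 p : 0 < p < pi / 2 -> 0 < f p.
Proof.
move=> /andP[p0 p1]; rewrite ltNge; apply/negP => fp.
have cf a b : {within `[a, b], continuous f} by exact/continuous_subspaceT/continuous_f.
have f0 : f 0 = 0 by rewrite /f sin0 oint0 ellF0 mul0r mul0r !mulr0 subrr add0r.
have f1 : f (pi / 2) = 0.
  rewrite /f cos_pihalf mulr0 mul0r mulr0 sub0r -/(ellK k) divfK ?addNr //.
  exact: lt0r_neq0 ellK_gt0.
have [x] := MVT p0 (fun z _ => is_derive_f z) (cf 0 p).
rewrite in_itv /= f0 !subr0 => /andP[x0 xp] ex.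
have [y] := MVT p1 (fun z _ => is_derive_f z) (cf p (pi / 2)).
rewrite in_itv /= f1 sub0r => /andP[py y1] ey.
have hx : bracket x <= 0.
  by move: fp; rewrite ex pmulr_lle0 // pmulr_rle0 // invr_gt0 ell_delta_gt0.
have hy : 0 <= bracket y.
  by move: fp; rewrite -oppr_ge0 ey pmulr_lge0 ?subr_gt0 // pmulr_rge0 // invr_gt0 ell_delta_gt0.
have := bracket_decr (ltW x0) (lt_trans xp py) (ltW y1).
by rewrite ltNge (le_trans hx hy).
Qed.

(** The amplitudes of the allowed arguments fill a segment from [a] to [b] inside the open interval
    from 0 to pi/2. There [f] has a positive minimum, and sc = tan p is at most 1 / cos b. *)
Lemma elliptic_bounds (eps : R) : 0 < eps ->
  exists2 c : R, 0 < c & exists C : R, forall t, eps < t < pi / 2 - eps ->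
    0 < jacobi_sc k (t * (2 * ellK k / pi)) <= C /\
    c <= ellA k (t * (2 * ellK k / pi)) - jacobi_sc k (t * (2 * ellK k / pi)).
Proof.
move=> eps0; have K0 := ellK_gt0; have pi0 : 0 < pi :> R := pi_gt0 _.
have ph0 : 0 < pi / 2 :> R by rewrite divr_gt0.
have c0 : 0 < 2 * ellK k / pi by rewrite divr_gt0 // mulr_gt0.
have cK : pi / 2 * (2 * ellK k / pi) = ellK k.
  by have := lt0r_neq0 pi0; move: pi (ellK k) => y x y0; field.
(* No [t] is allowed in this case, and any constants do. *)
have [ec|ec] := leP (pi / 2 - eps) eps.
  exists 1 => //; exists 0 => t /andP[t1 t2].
  by have := lt_trans t1 t2; rewrite ltNge ec.
have e1 : eps < pi / 2 by rewrite (lt_trans ec) // ltrBlDr ltrDl.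
have onto (t : R) : 0 <= t <= pi / 2 ->
    exists2 p : R, 0 <= p <= pi / 2 & ellF k p = t * (2 * ellK k / pi).
  move=> /andP[t0 t1]; apply: ellF_onto; first exact: ltW.
  by rewrite ellF0 (mulr_ge0 t0 (ltW c0)) /= -[leRHS]cK ler_pM2r.
have [a /andP[a0 a1] Fa] : exists2 p : R, 0 <= p <= pi / 2 & ellF k p = eps * (2 * ellK k / pi).
  by apply: onto; rewrite !ltW.
have [b /andP[b0 b1] Fb] : exists2 p : R, 0 <= p <= pi / 2 &
    ellF k p = (pi / 2 - eps) * (2 * ellK k / pi).
  by apply: onto; rewrite (le_trans _ (ltW ec)) ?ltW //= ltrBlDr ltrDl.
have a0' : 0 < a by rewrite -ltr_ellF Fa ellF0 mulr_gt0.
have ab : a < b by rewrite -ltr_ellF Fa Fb ltr_pM2r.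
have b1' : b < pi / 2.
  by rewrite -ltr_ellF Fb -[ltRHS]cK ltr_pM2r // ltrBlDr ltrDl.
have [z] := EVT_min (ltW ab) (continuous_subspaceT continuous_f).
rewrite in_itv /= => /andP[az zb] fz.
have k'0 := compl_modulus_gt0.
have z01 : 0 < z < pi / 2 by rewrite (lt_le_trans a0') //= (le_lt_trans zb).
exists (k'^-1 * f z); first by rewrite mulr_gt0 ?invr_gt0 // f_gt0.
exists (cos b)^-1 => t /andP[t1 t2].
have [|p /andP[ap pb] <-] := @ellF_onto a b (t * (2 * ellK k / pi)) (ltW ab).
  by rewrite Fa Fb !ler_pM2r // !ltW.
have p01 : 0 < p < pi / 2 by rewrite (lt_le_trans a0') //= (le_lt_trans pb).
split; last by rewrite ellA_sub_sc // ler_pM2l ?invr_gt0 // fz // in_itv /= ap.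
have [p0 p1] := andP p01.
have cpos (q : R) : 0 <= q -> q < pi / 2 -> 0 < cos q.
  by move=> q0 q1; rewrite cos_gt0_pihalf // q1 andbT (lt_le_trans _ q0) // oppr_lt0.
have ph1 : pi / 2 <= pi :> R by rewrite ler_pdivrMr // ler_peMr ?pi_ge0 // ler1n.
have cp := cpos p (ltW p0) p1; have cb := cpos b (ltW (lt_trans a0' ab)) b1'.
rewrite /jacobi_sc /jacobi_sn /jacobi_cn jacobi_amK divr_gt0 ?sin_gt0_pihalf //=.
rewrite ler_pdivrMr // (le_trans (sin_le1 _)) // mulrC ler_pdivlMr // mul1r.
rewrite leNgt; apply/negP; rewrite ltr_cos ?in_itv /=; first by rewrite ltNge pb.
  by rewrite b0 (le_trans b1 ph1).
by rewrite (ltW p0) (le_trans (ltW p1) ph1).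
Qed.

End EllipticIntegrals.

Theorem theorem34 (R : realType) (G : drawn_graph R) (k : R)
  (hG : isoradial G) (Ginf : infinite_set [set: vertex G])
  (Gcover : faces_cover_plane G)
  (Gangle : exists eps : R, 0 < eps /\
     forall e : edge G, eps < half_angle e < pi / 2 - eps)
  (hk : 0 < k < 1) :
  exists P : probability (config G) R,
    [/\ on_rooted_spanning_forests P /\ determinantal_formula k P,
        (forall Q : probability (config G) R,
           on_rooted_spanning_forests Q -> determinantal_formula k Q ->
           forall A : set (config G), measurable A -> Q A = P A),
        (forall Gn : nat -> set (vertex G) * set (edge G), exhaustion Gn ->
           exists Pn : nat -> probability (config G) R,
             (forall n, boltzmann k (Gn n) (Pn n)) /\ weak_limit Pn P)
      & {ae P, forall w, finite_components w}].
Proof.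
have [eps [eps0 angle_eps]] := Gangle.
have [c c0 [C bounds]] := elliptic_bounds hk eps0.
have rho_gt0 (e : edge G) : 0 < rho k e.
  by have [/andP[]] := bounds _ (angle_eps e).
have rhoC (e : edge G) : rho k e <= C.
  by have [/andP[]] := bounds _ (angle_eps e).
have summand_ge (e : edge G) : c <= ellA k (theta k e) - jacobi_sc k (theta k e).
  by have [] := bounds _ (angle_eps e).
have incident_finite := isoradial_incident_finite hG.
have mass_ge (a : vertex G) : c <= mass2 k a.
  (* The mass is a sum over the edges at [a]; it would vanish without an edge, and one edge already
     contributes at least [c]. *)
  have [e ea] := vertex_has_edge hG Gcover a.
  have [s us Es] := finite_uniq_seq (incident_finite a).
  rewrite /mass2 Es -fsbig_seq //= (bigD1_seq e) //=; last first.
    by move: ea; rewrite -[incident e a]/([set e' | incident e' a] e) Es.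
  rewrite (le_trans (summand_ge e)) // lerDl sumr_ge0 // => e' _.
  exact: le_trans (ltW c0) (summand_ge e').
have [a _] := infinite_setN0 Ginf.
have [e0 _] := vertex_has_edge hG Gcover a.
(* The ratio [C / c] compares each conductance with the contribution of the same edge to the mass,
   so it does not depend on the degree. *)
have C0 : 0 <= C / c by rewrite divr_ge0 ?ltW // (lt_le_trans (rho_gt0 e0)).
apply: (forest_measure (isoradial_simple hG) incident_finite rho_gt0 c0 mass_ge C0) => //.
- move=> {}a; have [s us Es] := finite_uniq_seq (incident_finite a).
  rewrite /mass2 Es -!fsbig_seq //= mulr_sumr ler_sum // => e _.
  rewrite (le_trans (rhoC e)) // mulrAC ler_pdivlMr // ler_wpM2l //.
  exact: le_trans (ltW (rho_gt0 e0)) (rhoC e0).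
- exact: isoradial_vertex_countable hG.
- exact: isoradial_edge_countable hG.
Qed.
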